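(* Let $\mathcal T_n$ be a conditioned Galton--Watson tree defined by an offspring distribution $\xi$ with $\mathbb E\xi=1$ and $0<\sigma^2:=\operatorname{Var}\xi<\infty$. (i) If $\operatorname{Re}\alpha>\frac12$, then, as $n\to\infty$, $$Y_n(\alpha):=n^{-\alpha-\frac12}X_n(\alpha)\xrightarrow{d}\sigma^{-1}Y(\alpha).$$ (ii) If $0<\operatorname{Re}\alpha<\frac12$, then, as $n\to\infty$, $$n^{-\alpha-\frac12}\bigl[X_n(\alpha)-n\mu(\alpha)\bigr]\xrightarrow{d}\sigma^{-1}Y(\alpha).$$ Moreover, in both cases, this holds in the space $\mathcal H(D)$ for the indicated domain $D$ (that is, $D=\{\operatorname{Re}\alpha>\frac12\}$ in (i) and $D=\{0<\operatorname{Re}\alpha<\frac12\}$ in (ii)).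
   Context: The offspring distribution is the distribution of a non-negative integer-valued random variable $\xi$. The Galton--Watson tree $\mathcal T$ with offspring distribution $\xi$ is the random rooted ordered tree in which each node has a number of children that is an independent copy of $\xi$ (it is a.s. finite here). $|T|$ denotes the number of nodes of a tree $T$. The conditioned Galton--Watson tree $\mathcal T_n$ is $\mathcal T$ conditioned on $|\mathcal T|=n$; only $n$ with $\mathbb P(|\mathcal T|=n)>0$ are considered, and $n\to\infty$ through such $n$. For a rooted tree $T$ and a node $v\in T$, $T_v$ is the subtree consisting of $v$ and all its descendants. For $\alpha\in\mathbb C$, $X_n(\alpha):=\sum_{v\in\mathcal T_n}|\mathcal T_{n,v}|^\alpha$ (where $\mathcal T_{n,v}=(\mathcal T_n)_v$), $\tilde X_n(\alpha):=X_n(\alpha)-\mathbb E X_n(\alpha)$. For $\operatorname{Re}\alpha<\frac12$, $\mu(\alpha):=\mathbb E|\mathcal T|^\alpha=\sum_{n\ge1}n^\alpha\,\mathbb P(|\mathcal T|=n)$. For an open $D\subseteq\mathbb C$, $\mathcal H(D)$ is the space of analytic functions on $D$ with the topology of uniform convergence on compact sets; convergence ''in $\mathcal H(D)$'' means convergence in distribution of random elements of $\mathcal H(D)$. Let $H_+:=\{\operatorname{Re}\alpha>0\}$. $\tilde Y=(\tilde Y(\alpha))_{\alpha\in H_+}$ denotes the random analytic function on $H_+$ (unique in distribution and not depending on the offspring distribution) such that, for every offspring distribution $\xi$ with $\mathbb E\xi=1$ and $0<\sigma^2=\operatorname{Var}\xi<\infty$, $\sigma n^{-\alpha-\frac12}\tilde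 X_n(\alpha)\xrightarrow{d}\tilde Y(\alpha)$ in $\mathcal H(H_+)$. For $\operatorname{Re}\alpha>0$, $\alpha\ne\frac12$, $$Y(\alpha):=\tilde Y(\alpha)+\frac1{\sqrt2}\frac{\Gamma(\alpha-\frac12)}{\Gamma(\alpha)}.$$ *)

(* Defs.v *)
From HB Require Import structures.
From mathcomp Require Import all_boot all_order all_algebra complex.
From mathcomp Require Import all_classical all_reals all_analysis.
From mathcomp Require Import zify.
Set Implicit Arguments.
Unset Strict Implicit.
Unset Printing Implicit Defensive.
Import Order.TTheory GRing.Theory Num.Theory.
Import numFieldNormedType.Exports.
Local Open Scope classical_set_scope.
Local Open Scope ring_scope.

(* Typing R[i] as a numFieldType is what gives it the modulus topology and
   makes it a normed module over itself, so that [derivable] below is complex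
   differentiability. *)
Definition Cplx (R : realType) : numFieldType := R[i].

Definition ofR (R : realType) (x : R) : Cplx R := Complex x 0.
Definition cRe (R : realType) (z : Cplx R) : R := complex.Re z.
Definition cIm (R : realType) (z : Cplx R) : R := complex.Im z.

Definition cexp (R : realType) (z : Cplx R) : Cplx R :=
  ofR (expR (cRe z)) * Complex (cos (cIm z)) (sin (cIm z)).

(* n ^ z for n >= 1 *)
Definition npow (R : realType) (n : nat) (z : Cplx R) : Cplx R :=
  cexp (z * ofR (ln n%:R)).

(* The Euler-Gauss limit n! n^z / (z (z + 1) ... (z + n)), which defines Gamma
   on the whole complex plane minus the poles 0, -1, -2, ... *)
Definition cGamma (R : realType) (z : Cplx R) : Cplx R :=
  lim ((fun n : nat =>
          (n`!)%:R * npow n z / \prod_(k < n.+1) (z + k%:R)) @ \oo).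

Definition compact_in (R : realType) (D : set (Cplx R)) : set (set (Cplx R)) :=
  [set K | compact K /\ K `<=` D].

(* H(D) is the subset [analytic_on D] of the space below.  Functions are total,
   but their values outside D are invisible to this topology: functions that
   agree on D have the same neighbourhoods. *)
Definition funD (R : realType) (D : set (Cplx R)) : topologicalType :=
  {family compact_in D, Cplx R -> Cplx R}.

Definition analytic_on (R : realType) (D : set (Cplx R)) : set (funD D) :=
  [set f | forall z, D z -> derivable (f : Cplx R -> Cplx R) z 1].

Inductive tree := Node of seq tree.

HB.instance Definition _ := gen_eqMixin tree.
HB.instance Definition _ := gen_choiceMixin tree.

Definition children (t : tree) : seq tree := let: Node ts := t in ts.

(* The subtrees t_v, listed with one entry for each node v of t. *)
Fixpoint subtrees (t : tree) : seq tree :=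
  let: Node ts := t in t :: flatten (map subtrees ts).

Definition tree_size (t : tree) : nat := size (subtrees t).

Definition trees (n : nat) : set tree := [set t | tree_size t = n].

Definition forests n := [set ts : seq tree | sumn (map tree_size ts) = n].
Lemma tree_sizeE ts : tree_size (Node ts) = (sumn (map tree_size ts)).+1.
Proof. by rewrite /tree_size /= size_flatten /shape -map_comp. Qed.
Lemma finite_forests n : finite_set (forests n).
Proof.
elim/ltn_ind: n => -[|n] IH.
  apply: (@sub_finite_set _ _ [set [::]]); last exact: finite_set1.
  by move=> [|[us] ts] //; rewrite /forests /= tree_sizeE.
apply: (@sub_finite_set _ _ (\bigcup_(m in `I_n.+1)
   ((fun q : seq tree * seq tree => Node q.1 :: q.2) @` (forests m `*` forests (n - m)%N)))).
  move=> [|[us] ts] //; rewrite /forests /= tree_sizeE addSn => -[E].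
  exists (sumn (map tree_size us)); first by rewrite /=; lia.
  by exists (us, ts) => //; split => //=; lia.
apply: bigcup_finite; first exact: finite_II.
move=> m /= mn; apply: finite_image; apply: finite_setX; apply: IH; lia.
Qed.
Lemma finite_trees n : finite_set (trees n).
Proof.
apply: (@sub_finite_set _ _ (Node @` forests n.-1)); last first.
  exact/finite_image/finite_forests.
by move=> [ts]; rewrite /trees /= tree_sizeE => <-; exists ts.
Qed.

(* P(T = t): the numbers of children of the nodes are independent copies
   of xi. *)
Definition gw_prob (R : realType) (xi : probability nat R) (t : tree) : R :=
  \prod_(s <- subtrees t) fine (xi [set size (children s)]).

(* P(|T| = n); by [finite_trees] the sum is a genuine finite sum. *)
Definition size_prob (R : realType) (xi : probability nat R) (n : nat) : R :=
  \sum_(t \in trees n) gw_prob xi t.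

(* P(T_n = t), for t in [trees n]. *)
Definition cgw_prob (R : realType) (xi : probability nat R) (n : nat)
    (t : tree) : R :=
  gw_prob xi t / size_prob xi n.

(* E g(T_n), for real and for complex g. *)
Definition cgw_mean (R : realType) (xi : probability nat R) (n : nat)
    (g : tree -> R) : R :=
  \sum_(t \in trees n) cgw_prob xi n t * g t.

Definition cgw_cmean (R : realType) (xi : probability nat R) (n : nat)
    (g : tree -> Cplx R) : Cplx R :=
  \sum_(t \in trees n) ofR (cgw_prob xi n t) * g t.

Definition admissible (R : realType) (xi : probability nat R) : set nat :=
  [set n | 0 < size_prob xi n].

Definition critical (R : realType) (xi : probability nat R) (sigma : R) : Prop :=
  let X : nat -> R := fun k => k%:R in
  [/\ ('E_xi[X] = 1)%E, 0 < sigma & variance xi X = (sigma ^+ 2)%:E].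

(* X_n(alpha) is [treeX T_n alpha]. *)
Definition treeX (R : realType) (t : tree) (alpha : Cplx R) : Cplx R :=
  \sum_(s <- subtrees t) npow (tree_size s) alpha.

Definition treeX_centered (R : realType) (xi : probability nat R) (n : nat)
    (t : tree) (alpha : Cplx R) : Cplx R :=
  treeX t alpha - cgw_cmean xi n (fun u => treeX u alpha).

Definition mu (R : realType) (xi : probability nat R) (alpha : Cplx R) : Cplx R :=
  lim ((fun N : nat =>
          \sum_(1 <= n < N) npow n alpha * ofR (size_prob xi n)) @ \oo).

Definition bounded_continuous_on (R : realType) (T : topologicalType) (A : set T)
    (Phi : T -> R) : Prop :=
  {within A, continuous Phi} /\ exists M : R, forall x, A x -> `|Phi x| <= M.

(* Y is a Borel random element of the subspace A of T. *)
Definition random_element (d : measure_display)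
    (Omega : measurableType d) (T : topologicalType) (A : set T)
    (Y : Omega -> T) : Prop :=
  (forall w, A (Y w)) /\ (forall U : set T, open U -> measurable (Y @^-1` U)).

(* The random elements Z n T_n of A converge in distribution to Y, as n tends
   to infinity through the n such that P(|T| = n) > 0. *)
Definition cgw_cvg_dist (R : realType) (xi : probability nat R)
    (d : measure_display) (Omega : measurableType d) (P : probability Omega R)
    (T : topologicalType) (A : set T) (Z : nat -> tree -> T) (Y : Omega -> T)
    : Prop :=
  [/\ forall n t, admissible xi n -> trees n t -> A (Z n t),
      random_element A Y &
      forall Phi : T -> R, bounded_continuous_on A Phi ->
        (cgw_mean xi n (fun t => Phi (Z n t)))%:E
          @[n --> within (admissible xi) \oo] --> ('E_P[Phi \o Y])%E].

Definition chalf (R : realType) : Cplx R := ofR 2^-1.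

Definition Hplus (R : realType) : set (Cplx R) := [set z | 0 < cRe z].

(* Yt is a version of the universal limit Y~: the same law must serve all
   offspring distributions. *)
Definition is_Ytilde (R : realType) (d : measure_display)
    (Omega : measurableType d) (P : probability Omega R)
    (Yt : Omega -> Cplx R -> Cplx R) : Prop :=
  forall (xi : probability nat R) (sigma : R), critical xi sigma ->
    cgw_cvg_dist xi P (@analytic_on R (@Hplus R))
      (fun n t alpha =>
         ofR sigma * npow n (- alpha - chalf R) * treeX_centered xi n t alpha)
      Yt.

Definition Ylim (R : realType) (Omega : Type)
    (Yt : Omega -> Cplx R -> Cplx R) (w : Omega) (alpha : Cplx R) : Cplx R :=
  Yt w alpha
  + ofR (Num.sqrt 2)^-1 * (cGamma (alpha - chalf R) / cGamma alpha).

(* Main.v *)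
Require Import Defs.
From HB Require Import structures.
From mathcomp Require Import all_boot all_order all_algebra complex.
From mathcomp Require Import all_classical all_reals all_analysis.
From mathcomp Require Import measurable_realfun.
From mathcomp Require Import zify ring lra.
Set Implicit Arguments.
Unset Strict Implicit.
Unset Printing Implicit Defensive.
Import Order.TTheory GRing.Theory Num.Theory.
Import numFieldNormedType.Exports.
Local Open Scope classical_set_scope.
Local Open Scope ring_scope.


(** Write [X_n = (X_n - E X_n) + E X_n].  The hypothesis on [Yt] takes care of
    the centred part, so the theorem amounts to a statement on means: with the
    offspring law fixed and [b] telling whether [n mu(alpha)] is subtracted,
      [n^(-alpha-1/2) (E X_n(alpha) - b n mu(alpha))
          --> sigma^-1 2^(-1/2) Gamma(alpha - 1/2) / Gamma(alpha)],
    uniformly on compact subsets of the domain ([regime_mean]).  The sum of the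
    two parts then converges by Slutsky's theorem in [H(D)].

    The mean is explicit.  Let [S_n] be a sum of [n] independent copies of the
    offspring variable.  By the cycle lemma, [P(|T| = n) = P(S_n = n - 1) / n]
    and [E X_n(alpha) = n sum_m m^alpha P(|T| = m) P(S_(n-m) = n - m) / P(S_n = n - 1)]
    ([size_prob_walk], [cgw_cmean_treeX]).  If [h] is the span of the offspring
    law, only [n = 1 + h J] and [m = 1 + h j] occur.  The local limit theorem
    ([walk_ub], [walk_diff], [walk_lim]), proved by Fourier inversion and valid
    under a second moment, says that [P(|T| = m)] is of order [m^(-3/2)] and
    that the last quotient is close to [sqrt (J / (J - j))].  Subtracting
    [n mu(alpha)] changes this quotient by [-1] and extends the sum to all
    [j]; it makes the factor small for [j] small compared with [J], which is
    why the critical exponent [1/2] can be crossed.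

    With [z = alpha - 1/2], the summands may therefore be replaced by any
    others with the same asymptotics ([kernel_replacement]).  A choice for which
    the sum is computed exactly is [m^alpha P(|T| = m) ~ Gamma(z) z(z+1)...(z+j-1) / j!]
    up to a constant, and for the quotient the central binomial coefficients
    [binom(2i, i) / 4^i], the return probabilities of the offspring law
    Binomial(2, 1/2), which the local limit theorem covers as well: by
    Chu-Vandermonde the sum is a single rising factorial ([rising_conv]), and
    Gauss's product for Gamma gives the limit ([mean_asymp]).

    Membership in [H(D)] requires that [mu] and the Gamma quotient are analytic.
    Both are pointwise limits of explicit functions with uniform second-order
    Taylor estimates, and such limits are differentiable ([lim_derivable]).
    Slutsky's theorem ([affine_cvg_dist]) rests on approximating a bounded
    continuous functional on [H(D)] from below by functionals that are Lipschitz
    for the supremum over a compact set ([infconv_lim]). *)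


(** * Complex numbers: modulus, exponential and powers *)

Section ComplexBasics.
Variable R : realType.
Implicit Types (x y : R) (z w : Cplx R).

Lemma ofRD x y : ofR (x + y) = ofR x + ofR y. Proof. exact: (rmorphD (real_complex R)). Qed.
Lemma ofRB x y : ofR (x - y) = ofR x - ofR y. Proof. exact: (rmorphB (real_complex R)). Qed.
Lemma ofRN x : ofR (- x) = - ofR x. Proof. exact: (rmorphN (real_complex R)). Qed.
Lemma ofRM x y : ofR (x * y) = ofR x * ofR y. Proof. exact: (rmorphM (real_complex R)). Qed.
Lemma ofRV x : ofR x^-1 = (ofR x)^-1. Proof. exact: (fmorphV (real_complex R)). Qed.
Lemma ofR0 : ofR 0 = 0 :> Cplx R. Proof. by []. Qed.
Lemma ofR1 : ofR 1 = 1 :> Cplx R. Proof. by []. Qed.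
Lemma ofR_nat n : ofR n%:R = n%:R :> Cplx R. Proof. exact: (rmorph_nat (real_complex R)). Qed.
Lemma ofR_sum (I : Type) (r : seq I) (F : I -> R) :
  ofR (\sum_(i <- r) F i) = \sum_(i <- r) ofR (F i).
Proof. exact: (rmorph_sum (real_complex R)). Qed.
Lemma ofR_inj : injective (@ofR R). Proof. by move=> x y []. Qed.

Lemma cReD z w : cRe (z + w) = cRe z + cRe w. Proof. by case: z; case: w. Qed.
Lemma cImD z w : cIm (z + w) = cIm z + cIm w. Proof. by case: z; case: w. Qed.
Lemma cReN z : cRe (- z) = - cRe z. Proof. by case: z. Qed.
Lemma cImN z : cIm (- z) = - cIm z. Proof. by case: z. Qed.
Lemma cReB z w : cRe (z - w) = cRe z - cRe w. Proof. by rewrite cReD cReN. Qed.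
Lemma cImB z w : cIm (z - w) = cIm z - cIm w. Proof. by rewrite cImD cImN. Qed.
Lemma cReM z w : cRe (z * w) = cRe z * cRe w - cIm z * cIm w.
Proof. by case: z; case: w. Qed.
Lemma cImM z w : cIm (z * w) = cRe z * cIm w + cIm z * cRe w.
Proof. by case: z; case: w. Qed.
Lemma cRe_ofR x : cRe (ofR x) = x. Proof. by []. Qed.
Lemma cIm_ofR x : cIm (ofR x) = 0. Proof. by []. Qed.
Lemma cRe_nat n : cRe (n%:R : Cplx R) = n%:R. Proof. by rewrite -ofR_nat. Qed.
Lemma cRe1 : cRe (1 : Cplx R) = 1. Proof. by []. Qed.
Lemma cIm1 : cIm (1 : Cplx R) = 0. Proof. by []. Qed.
Lemma cIm0 : cIm (0 : Cplx R) = 0. Proof. by []. Qed.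

Lemma cplx_eq z w : cRe z = cRe w -> cIm z = cIm w -> z = w.
Proof. by case: z => a b; case: w => c d /= -> ->. Qed.

Lemma cRe_sum (I : Type) (r : seq I) (F : I -> Cplx R) :
  cRe (\sum_(i <- r) F i) = \sum_(i <- r) cRe (F i).
Proof. by apply: (big_morph _ cReD). Qed.

(** The modulus as a real number; the norm of [Cplx R] is complex-valued. *)
Definition cabs z : R := Num.sqrt (cRe z ^+ 2 + cIm z ^+ 2).

Lemma normr_cabs z : `|z| = ofR (cabs z). Proof. exact: normc_def. Qed.

Lemma cabs_ge0 z : 0 <= cabs z. Proof. exact: sqrtr_ge0. Qed.
Lemma cabsM z w : cabs (z * w) = cabs z * cabs w.
Proof. by apply: ofR_inj; rewrite ofRM -!normr_cabs normrM. Qed.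
Lemma cabsN z : cabs (- z) = cabs z.
Proof. by apply: ofR_inj; rewrite -!normr_cabs normrN. Qed.
Lemma cabsV z : cabs z^-1 = (cabs z)^-1.
Proof. by apply: ofR_inj; rewrite ofRV -!normr_cabs normfV. Qed.
Lemma cabs0 : cabs 0 = 0. Proof. by apply: ofR_inj; rewrite -normr_cabs normr0. Qed.
Lemma cabs1 : cabs 1 = 1. Proof. by apply: ofR_inj; rewrite -normr_cabs normr1. Qed.
Lemma cabsX z n : cabs (z ^+ n) = cabs z ^+ n.
Proof. by elim: n => [|n IH]; rewrite ?expr0 ?cabs1 // !exprS cabsM IH. Qed.
Lemma ofR_le x y : (ofR x <= ofR y) = (x <= y). Proof. exact: lecR. Qed.
Lemma ofR_lt x y : (ofR x < ofR y) = (x < y). Proof. exact: ltcR. Qed.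
Lemma cabsD z w : cabs (z + w) <= cabs z + cabs w.
Proof. by rewrite -ofR_le ofRD -!normr_cabs ler_normD. Qed.
Lemma cabsB z w : cabs (z - w) <= cabs z + cabs w.
Proof. by rewrite -(cabsN w) cabsD. Qed.
Lemma cabsBC z w : cabs (z - w) = cabs (w - z).
Proof. by rewrite -cabsN opprB. Qed.
Lemma cabs_ofR x : cabs (ofR x) = `|x|.
Proof. by rewrite /cabs cRe_ofR cIm_ofR expr0n addr0 sqrtr_sqr. Qed.
Lemma cabs_nat n : cabs n%:R = n%:R. Proof. by rewrite -ofR_nat cabs_ofR ger0_norm. Qed.
Lemma cabs_eq0 z : (cabs z == 0) = (z == 0).
Proof. by rewrite -[RHS]normr_eq0 normr_cabs; apply/eqP/eqP => [->|[]]. Qed.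
Lemma cabs_gt0 z : (0 < cabs z) = (z != 0).
Proof. by rewrite lt_def cabs_ge0 andbT cabs_eq0. Qed.
Lemma cabs_Re z : `|cRe z| <= cabs z.
Proof. by rewrite -sqrtr_sqr ler_sqrt ?lerDl ?sqr_ge0 // addr_ge0 // sqr_ge0. Qed.
Lemma cabs_Im z : `|cIm z| <= cabs z.
Proof. by rewrite -sqrtr_sqr ler_sqrt ?lerDr ?sqr_ge0 // addr_ge0 // sqr_ge0. Qed.
Lemma cabs_le_ReIm z : cabs z <= `|cRe z| + `|cIm z|.
Proof.
rewrite -[leRHS]ger0_norm ?addr_ge0 // -sqrtr_sqr ler_sqrt ?sqr_ge0 //.
rewrite sqrrD !real_normK ?num_real //; have : 0 <= `|cRe z| * `|cIm z| by rewrite mulr_ge0.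
by move=> h; lra.
Qed.
Lemma cabs_sqr z : cabs z ^+ 2 = cRe z ^+ 2 + cIm z ^+ 2.
Proof. by rewrite sqr_sqrtr // addr_ge0 // sqr_ge0. Qed.
Lemma cabs_sum (I : Type) (r : seq I) (P : pred I) (F : I -> Cplx R) :
  cabs (\sum_(i <- r | P i) F i) <= \sum_(i <- r | P i) cabs (F i).
Proof.
elim/big_ind2: _ => [|a b c d h1 h2|//]; first by rewrite cabs0.
by apply: le_trans (lerD h1 h2); exact: cabsD.
Qed.
Lemma cabs_distD w z z' : cabs (z - z') <= cabs (z - w) + cabs (w - z').
Proof. by rewrite (_ : z - z' = (z - w) + (w - z')) ?cabsD //; ring. Qed.

Definition cis x : Cplx R := Complex (cos x) (sin x).

Lemma cisD x y : cis (x + y) = cis x * cis y.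
Proof.
by apply: cplx_eq; rewrite ?cReM ?cImM /= ?cosD ?sinD; ring.
Qed.
Lemma cis0 : cis 0 = 1. Proof. by rewrite /cis cos0 sin0. Qed.
Lemma cabs_cis x : cabs (cis x) = 1.
Proof. by rewrite /cabs /= cos2Dsin2 sqrtr1. Qed.
Lemma cisX x n : cis x ^+ n = cis (n%:R * x).
Proof.
elim: n => [|n IH]; first by rewrite expr0 mul0r cis0.
by rewrite exprS IH -cisD -natr1; congr cis; ring.
Qed.

Lemma cexpE z : cexp z = ofR (expR (cRe z)) * cis (cIm z). Proof. by []. Qed.
Lemma cexpD z w : cexp (z + w) = cexp z * cexp w.
Proof. by rewrite !cexpE cReD cImD expRD cisD ofRM; ring. Qed.
Lemma cexp0 : cexp 0 = 1 :> Cplx R.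
Proof. by rewrite cexpE expR0 cis0 mulr1. Qed.
Lemma cabs_cexp z : cabs (cexp z) = expR (cRe z).
Proof. by rewrite cexpE cabsM cabs_cis mulr1 cabs_ofR ger0_norm // expR_ge0. Qed.
Lemma cexp_neq0 z : cexp z != 0.
Proof. by rewrite -cabs_gt0 cabs_cexp expR_gt0. Qed.
Lemma cexpN z : cexp (- z) = (cexp z)^-1.
Proof.
apply: (mulfI (cexp_neq0 z)).
by rewrite -cexpD subrr cexp0 divff // cexp_neq0.
Qed.
Lemma cexp_ofR x : cexp (ofR x) = ofR (expR x).
Proof. by rewrite cexpE cRe_ofR cIm_ofR cis0 mulr1. Qed.

Lemma npowD n z w : npow n (z + w) = npow n z * npow n w.
Proof. by rewrite /npow mulrDl cexpD. Qed.
Lemma npowN n z : npow n (- z) = (npow n z)^-1.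
Proof. by rewrite /npow mulNr cexpN. Qed.
Lemma npow0 n : npow n 0 = 1 :> Cplx R.
Proof. by rewrite /npow mul0r cexp0. Qed.
Lemma npow_neq0 n z : npow n z != 0.
Proof. exact: cexp_neq0. Qed.
Lemma cabs_npow n z : (0 < n)%N -> cabs (npow n z) = n%:R `^ cRe z.
Proof.
move=> n0; rewrite /npow cabs_cexp cReM cRe_ofR cIm_ofR mulr0 subr0.
by rewrite /powR pnatr_eq0 gtn_eqF.
Qed.
Lemma npow_ofR n x : (0 < n)%N -> npow n (ofR x) = ofR (n%:R `^ x).
Proof.
by move=> n0; rewrite /npow -ofRM cexp_ofR /powR pnatr_eq0 gtn_eqF.
Qed.
Lemma npow1 n : (0 < n)%N -> npow n (1 : Cplx R) = n%:R.
Proof. by move=> n0; rewrite -ofR1 npow_ofR // powRr1 // ofR_nat. Qed.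
Lemma npowMn m n z : (0 < m)%N -> (0 < n)%N -> npow (m * n) z = npow m z * npow n z.
Proof.
move=> m0 n0; rewrite /npow natrM lnM ?posrE ?ltr0n //.
by rewrite ofRD mulrDr cexpD.
Qed.
Lemma npow1n z : npow 1 z = 1.
Proof. by rewrite /npow ln1 ofR0 mulr0 cexp0. Qed.

End ComplexBasics.

(** * Random walks and the cycle lemma *)

(** [walk p n k] is the coefficient of [x^k] in [(sum_j p_j x^j)^n]: the
    probability that a sum of [n] independent steps equals [k]. *)
Fixpoint walk (R : realType) (p : nat -> R) (n k : nat) : R :=
  if n is n'.+1 then \sum_(j < k.+1) p j * walk p n' (k - j) else (k == 0)%:R.

Lemma walkS (R : realType) (p : nat -> R) n k :
  walk p n.+1 k = \sum_(j < k.+1) p j * walk p n (k - j).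
Proof. by []. Qed.

Lemma walk_coef (R : realType) (p : nat -> R) n N k : (k < N)%N ->
  walk p n k = ((\poly_(i < N) p i) ^+ n)`_k.
Proof.
elim: n k => [|n IH] k kN; first by rewrite expr0 coef1.
rewrite exprS coefM /=; apply: eq_bigr => j _.
rewrite coef_poly IH; last by lia.
by rewrite (_ : (j < N)%N = true) //; have := ltn_ord j; lia.
Qed.

(** Exchangeability: given the sum of the steps, each step has the same
    conditional mean.  This is the derivative of the generating function. *)
Lemma walk_mean (R : realType) (p : nat -> R) n k :
  n.+1%:R * (\sum_(j < k.+1) j%:R * p j * walk p n (k - j)) = k%:R * walk p n.+1 k.
Proof.
case: k => [|k]; first by rewrite big_ord1 !mul0r mulr0.
set P := \poly_(i < k.+2) p i.
have H : walk p n.+1 k.+1 *+ k.+1 =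
    (\sum_(j < k.+1) P^`()`_j * (P ^+ n)`_(k - j)) *+ n.+1.
  by rewrite -coefM -coefMn (walk_coef p n.+1 (ltnSn k.+1)) -coef_deriv deriv_exp.
rewrite [RHS]mulr_natl H -[RHS]mulr_natl; congr (_ * _).
rewrite big_ord_recl !mul0r add0r.
apply: eq_bigr => i _; rewrite coef_deriv coef_poly lift0.
have ik := ltn_ord i.
rewrite (_ : (i.+1 < k.+2)%N = true); last by lia.
rewrite -(walk_coef p n (_ : (k - i < k.+2)%N)); last by lia.
by rewrite subSS mulr_natl.
Qed.

Lemma walk_ge0 (R : realType) (p : nat -> R) : (forall k, 0 <= p k) ->
  forall n k, 0 <= walk p n k.
Proof.
move=> p0; elim => [|n IH] k /=; first by rewrite ler0n.
by apply: sumr_ge0 => j _; rewrite mulr_ge0.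
Qed.

(** * Forests and their first root *)

(** The forests of [k] trees with [n] nodes in total, listed by removing the
    root of the first tree and putting its children in front of the others. *)
Fixpoint forest_list (k n : nat) {struct n} : seq (seq tree) :=
  match n, k with
  | 0, 0 => [:: [::]]
  | 0, _.+1 => [::]
  | _.+1, 0 => [::]
  | n'.+1, k'.+1 =>
      flatten [seq [seq Node (take j us) :: drop j us
                    | us <- forest_list (k' + j) n'] | j <- iota 0 n]
  end.

Lemma forest_listS k n : forest_list k.+1 n.+1 =
  flatten [seq [seq Node (take j us) :: drop j us
                | us <- forest_list (k + j) n] | j <- iota 0 n.+1].
Proof. by []. Qed.

Lemma forest_sizeE ts k n : ts \in forest_list k n ->
  size ts = k /\ sumn (map tree_size ts) = n.
Proof.
elim: n k ts => [|n IH] [|k] ts //; first by rewrite inE => /eqP ->.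
rewrite forest_listS => /flattenP[l] /mapP[j]; rewrite mem_iota add0n => /andP[_ jn] -> /mapP[us].
move=> /IH [sz tot] -> /=; rewrite tree_sizeE addSn -sumn_cat -map_cat.
by rewrite cat_take_drop tot size_drop sz; split => //; congr _.+1; lia.
Qed.

Lemma size_le_sumn_tree_size ts : (size ts <= sumn (map tree_size ts))%N.
Proof. by elim: ts => //= -[us] ts IH; rewrite tree_sizeE; lia. Qed.

Lemma mem_forest_list ts k n : size ts = k -> sumn (map tree_size ts) = n ->
  ts \in forest_list k n.
Proof.
elim: n k ts => [|n IH] [|k] [|[us] ts] // [sz]; rewrite [sumn _]/= tree_sizeE //.
rewrite addSn forest_listS => -[tot].
have lus := size_le_sumn_tree_size us.
apply/flattenP; exists [seq Node (take (size us) vs) :: drop (size us) vs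
                    | vs <- forest_list (k + size us) n].
  by apply/mapP; exists (size us) => //; rewrite mem_iota; lia.
apply/mapP; exists (us ++ ts); last by rewrite take_size_cat // drop_size_cat.
by apply: IH; rewrite ?map_cat ?sumn_cat ?size_cat //; lia.
Qed.

Lemma uniq_forest_list k n : uniq (forest_list k n).
Proof.
elim: n k => [|n IH] [|k] //; rewrite forest_listS.
rewrite -[X in uniq (flatten X)]/[seq [seq (fun j us => Node (take j us) :: drop j us) j us | us <- forest_list (k + j) n] | j <- iota 0 n.+1].
apply: allpairs_uniq_dep; [exact: iota_uniq|by move=> *; exact: IH|].
move=> _ _ /allpairsPdep[j [us [_ m1 ->]]] /allpairsPdep[j' [us' [_ m2 ->]]] /= [e1 e2].
have [sz _] := forest_sizeE m1; have [sz' _] := forest_sizeE m2.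
have e : us = us' by rewrite -(cat_take_drop j us) e1 e2 cat_take_drop.
by move: sz sz'; rewrite e => -> /addnI ->.
Qed.

Section ForestSums.
Variables (R : realType) (p : nat -> R).

Definition tree_weight (t : tree) : R := \prod_(s <- subtrees t) p (size (children s)).

Definition forest_weight (ts : seq tree) : R := \prod_(t <- ts) tree_weight t.

Lemma forest_weight_graft j us : (j <= size us)%N ->
  forest_weight (Node (take j us) :: drop j us) = p j * forest_weight us.
Proof.
move=> jus; rewrite /forest_weight big_cons {1}/tree_weight /= big_cons /=.
rewrite size_takel // big_flatten big_map -mulrA; congr (_ * _).
by rewrite -[in RHS](cat_take_drop j us) big_cat.
Qed.

Definition forest_sum k n (g : seq tree -> R) : R :=
  \sum_(ts <- forest_list k n) forest_weight ts * g ts.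

Lemma eq_forest_sum k n g g' :
  (forall ts, size ts = k -> sumn (map tree_size ts) = n -> g ts = g' ts) ->
  forest_sum k n g = forest_sum k n g'.
Proof.
move=> e; rewrite /forest_sum !big_seq; apply: eq_bigr => ts.
by move=> /forest_sizeE [? ?]; rewrite e.
Qed.

Lemma forest_sumD k n g g' : forest_sum k n (fun ts => g ts + g' ts) =
  forest_sum k n g + forest_sum k n g'.
Proof. by rewrite -big_split; apply: eq_bigr => ts _; rewrite mulrDr. Qed.

Lemma forest_sum_rec k n g : forest_sum k.+1 n.+1 g =
  \sum_(j < n.+1) p j *
    forest_sum (k + j) n (fun us => g (Node (take j us) :: drop j us)).
Proof.
rewrite /forest_sum forest_listS big_flatten big_map.
rewrite -[iota 0 n.+1]/(index_iota 0 n.+1) big_mkord; apply: eq_bigr => j _.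
rewrite big_map mulr_sumr !big_seq; apply: eq_bigr => us /forest_sizeE [sz _].
by rewrite forest_weight_graft ?mulrA // sz leq_addl.
Qed.

Lemma forest_sum_gt k n g : (n < k)%N -> forest_sum k n g = 0.
Proof.
move=> nk; rewrite /forest_sum big_seq big1 // => ts /forest_sizeE [sz tot].
by move: nk; rewrite -sz -tot ltnNge size_le_sumn_tree_size.
Qed.

Lemma forest_sum0 n g : forest_sum 0 n g = (n == 0)%:R * g [::].
Proof.
case: n => [|n]; rewrite /forest_sum /= ?big_nil ?mul0r //.
by rewrite big_seq1 /forest_weight big_nil.
Qed.

Definition forest_prob k n : R := forest_sum k n (fun=> 1).

Lemma forest_prob_rec k n : forest_prob k.+1 n.+1 =
  \sum_(j < n.+1) p j * forest_prob (k + j) n.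
Proof. exact: forest_sum_rec. Qed.

Lemma ord_sum_shrink (F : nat -> R) m n : (m <= n)%N ->
  (forall j, (m < j <= n)%N -> F j = 0) ->
  \sum_(j < n.+1) F j = \sum_(j < m.+1) F j.
Proof.
move=> mn F0; rewrite -!(big_mkord xpredT) (big_cat_nat (n := m.+1)) //=.
rewrite [X in _ + X]big_nat [X in _ + X]big1 ?addr0 // => j jj; apply: F0; lia.
Qed.

(** A uniform choice among the cyclic shifts of a sequence of steps gives
    [k / n]; the induction on the first root replaces the shifts by
    exchangeability. *)
Lemma forest_prob_walk k n : (k <= n)%N ->
  n%:R * forest_prob k n = k%:R * walk p n (n - k).
Proof.
elim: n k => [|n IH] [|k] // kn.
- by rewrite !mul0r.
- by rewrite /forest_prob forest_sum0 /= mul0r mulr0 mul0r.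
rewrite forest_prob_rec (@ord_sum_shrink (fun j => p j * forest_prob (k + j) n) (n - k)%N);
  [|by lia|by move=> j jj; rewrite /forest_prob forest_sum_gt ?mulr0 //; lia].
case: n => [|n] in IH kn *.
  case: k kn => // _; rewrite !subn0 !big_ord1 add0n /= !big_ord1 /=.
  by rewrite /forest_prob forest_sum0 !mulr1.
apply: (@mulfI _ n.+1%:R); first by rewrite pnatr_eq0.
rewrite mulrCA mulr_sumr.
have -> : \sum_(i < (n.+1 - k).+1) n.+1%:R * (p i * forest_prob (k + i) n.+1) =
    k%:R * walk p n.+2 (n.+1 - k) +
    \sum_(j < (n.+1 - k).+1) j%:R * p j * walk p n.+1 (n.+1 - k - j).
  rewrite [walk p n.+2 _]walkS mulr_sumr -big_split; apply: eq_bigr => j _.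
  have jk := ltn_ord j.
  rewrite mulrCA IH; last by lia.
  by rewrite subnDA natrD /=; ring.
rewrite mulrDr walk_mean subSS.
have -> : n.+2%:R = n.+1%:R + 1 :> R by rewrite -natr1.
have -> : k.+1%:R = k%:R + 1 :> R by rewrite -natr1.
rewrite natrB; last by lia.
by ring.
Qed.

Lemma sumn_tree_size_cons us ts : sumn (map tree_size (Node us :: ts)) =
  (sumn (map tree_size us) + sumn (map tree_size ts)).+1.
Proof. by rewrite map_cons -[LHS]/(tree_size _ + _)%N tree_sizeE addSn. Qed.

(** Cutting a forest after its first [k1] trees is a bijection for which the
    weight is multiplicative: the two parts are independent. *)
Lemma forest_sum_split k1 k2 n m : (m <= n)%N ->
  forest_sum (k1 + k2) n (fun ts => (sumn (map tree_size (take k1 ts)) == m)%:R) =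
  forest_prob k1 m * forest_prob k2 (n - m).
Proof.
elim: n m k1 => [|n IH] m k1 mn.
  case: m mn => // _; case: k1 => [|k1].
    rewrite /forest_prob forest_sum0 /= !mul1r.
    by apply: eq_forest_sum => ts _ _; rewrite take0.
  by rewrite addSn /forest_prob forest_sum_gt // [forest_sum k1.+1 _ _]forest_sum_gt // mul0r.
case: k1 => [|k1].
  rewrite {1}/forest_prob forest_sum0 mulr1 add0n.
  case: m mn => [|m] mn; first by rewrite mul1r subn0; apply: eq_forest_sum => ts _ _; rewrite take0.
  rewrite mul0r /forest_sum big1 // => ts _.
  by rewrite take0 /= mulr0.
rewrite addSn forest_sum_rec.
case: m mn => [|m] mn.
  rewrite {1}/forest_prob forest_sum_gt // mul0r big1 // => j _.
  rewrite /forest_sum big1 ?mulr0 // => us _.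
  by rewrite take_cons sumn_tree_size_cons mulr0.
have -> : forest_prob k1.+1 m.+1 = \sum_(j < n.+1) p j * forest_prob (k1 + j) m.
  rewrite forest_prob_rec; apply/esym.
  apply: (@ord_sum_shrink (fun j => p j * forest_prob (k1 + j) m)) => // j jj.
  by rewrite /forest_prob forest_sum_gt ?mulr0 //; lia.
rewrite subSS mulr_suml; apply: eq_bigr => j _; rewrite -mulrA -IH; last by lia.
rewrite addnAC; congr (_ * _); apply: eq_forest_sum => us sz _.
rewrite take_cons sumn_tree_size_cons eqSS -sumn_cat -map_cat.
by rewrite [(k1 + j)%N]addnC takeD.
Qed.

Definition fringe_count m (ts : seq tree) : nat :=
  \sum_(t <- ts) count (fun s => tree_size s == m) (subtrees t).

Lemma fringe_count_cons m us ts : fringe_count m (Node us :: ts) =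
  ((tree_size (Node us) == m) + fringe_count m (us ++ ts))%N.
Proof.
rewrite /fringe_count big_cons big_cat /= addnA; congr (_ + _)%N.
by congr (_ + _)%N; rewrite count_flatten sumnE !big_map.
Qed.

Lemma fringe_count_gt m ts : (sumn (map tree_size ts) < m)%N -> fringe_count m ts = 0%N.
Proof.
have [n] := ubnP (sumn (map tree_size ts)); elim: n ts => // n IH [|[us] ts] H mm.
  by rewrite /fringe_count big_nil.
move: H mm; rewrite sumn_tree_size_cons => H mm.
rewrite fringe_count_cons IH ?map_cat ?sumn_cat ?tree_sizeE //; [|by lia..].
by rewrite (_ : _ == _ = false) //; lia.
Qed.

Definition fringe_mean k n m : R := forest_sum k n (fun ts => (fringe_count m ts)%:R).

Lemma fringe_mean_rec k n m : (m <= n.+1)%N -> fringe_mean k.+1 n.+1 m =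
  \sum_(j < n.+1) p j * fringe_mean (k + j) n m +
  forest_prob 1 m * forest_prob k (n.+1 - m).
Proof.
move=> mn; rewrite /fringe_mean -(forest_sum_split 1 k mn) add1n.
rewrite [X in _ + X]forest_sum_rec forest_sum_rec -big_split.
apply: eq_bigr => j _ /=; rewrite -mulrDr -forest_sumD; congr (_ * _).
apply: eq_forest_sum => us sz _.
rewrite fringe_count_cons cat_take_drop /= take0 /= addn0.
by rewrite natrD addrC.
Qed.

(** The cycle lemma again: each of the [n] cyclic positions starts a subtree of
    size [m] with probability [P(|T| = m)], and the steps outside this subtree
    form a free walk. *)
Lemma fringe_mean_walk k n m : (0 < m <= n)%N ->
  fringe_mean k n m = k%:R * forest_prob 1 m *
    (if (k <= (n - m).+1)%N then walk p (n - m) ((n - m).+1 - k) else 0).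
Proof.
elim: n k => [|n IH] [|k] /andP[m0 mn]; rewrite ?mul0r.
- by move: m0 mn; lia.
- by move: m0 mn; lia.
- by rewrite /fringe_mean forest_sum0 mul0r.
rewrite fringe_mean_rec //.
case: (ltnP n m) => nm.
  have -> : m = n.+1 by lia.
  rewrite subnn big1 ?add0r; last first.
    move=> j _; rewrite /fringe_mean (_ : forest_sum _ _ _ = 0) ?mulr0 //.
    rewrite (@eq_forest_sum _ _ _ (fun=> 0)); last first.
      by move=> ts _ tot; rewrite fringe_count_gt // tot.
    by rewrite /forest_sum big1 // => ts _; rewrite mulr0.
  case: k => [|k]; first by rewrite /= mul1r /forest_prob [forest_sum 0 _ _]forest_sum0 !mulr1.
  by rewrite /forest_prob [forest_sum k.+1 _ _]forest_sum_gt // !mulr0.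
rewrite subSn //; set d := (n - m)%N.
have -> : \sum_(j < n.+1) p j * fringe_mean (k + j) n m =
   forest_prob 1 m * \sum_(j < n.+1) p j * ((k + j)%:R *
     (if (k + j <= d.+1)%N then walk p d (d.+1 - (k + j)) else 0)).
  by rewrite mulr_sumr; apply: eq_bigr => j _; rewrite IH ?m0 // -/d; ring.
rewrite -mulrDr mulrAC -[RHS]mulrC; congr (_ * _).
case: (leqP k d.+1) => kd; last first.
  rewrite (_ : (k < d.+2)%N = false); last by lia.
  rewrite mulr0 /forest_prob forest_sum_gt // addr0 big1 // => j _.
  by rewrite (_ : (_ <= _)%N = false) ?mulr0 //; lia.
rewrite (_ : (k < d.+2)%N = true); last by lia.
apply: (@mulfI _ d.+1%:R); first by rewrite pnatr_eq0.
rewrite mulrDr forest_prob_walk // subSS.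
set S := \sum_(j < _) _.
have SE : S = k%:R * walk p d.+1 (d.+1 - k) +
    \sum_(j < (d.+1 - k).+1) j%:R * p j * walk p d (d.+1 - k - j).
  rewrite [walk p d.+1 _]walkS mulr_sumr -big_split /S.
  transitivity (\sum_(j < (maxn n (d.+1 - k)).+1) p j * ((k + j)%:R *
     (if (k + j <= d.+1)%N then walk p d (d.+1 - (k + j)) else 0))).
    apply/esym; apply: (@ord_sum_shrink (fun j => p j * ((k + j)%:R *
     (if (k + j <= d.+1)%N then walk p d (d.+1 - (k + j)) else 0)))); first by rewrite leq_maxl.
    move=> j jj; rewrite (_ : (_ <= _)%N = false) ?mulr0 //.
    by move: jj; rewrite /d; lia.
  rewrite (@ord_sum_shrink (fun j => p j * ((k + j)%:R *
     (if (k + j <= d.+1)%N then walk p d (d.+1 - (k + j)) else 0))) (d.+1 - k)%N);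
    [|by rewrite leq_maxr|]; last first.
    by move=> j jj; rewrite (_ : (_ <= _)%N = false) ?mulr0 //; lia.
  apply: eq_bigr => j _; have jk := ltn_ord j.
  rewrite (_ : (_ <= _)%N = true); last by lia.
  by rewrite subnDA natrD /=; ring.
rewrite SE mulrDr walk_mean.
have -> : k.+1%:R = k%:R + 1 :> R by rewrite -natr1.
rewrite natrB //; ring.
Qed.

End ForestSums.

Section ConditionedTrees.
Variables (R : realType) (xi : probability nat R).

Definition offspring (k : nat) : R := fine (xi [set k]).

Lemma offspring_ge0 k : 0 <= offspring k.
Proof. by rewrite /offspring fine_ge0. Qed.

Lemma fsbig_trees (V : zmodType) n (f : tree -> V) :
  \sum_(t \in trees n) f t = \sum_(ts <- forest_list 1 n) \sum_(t <- ts) f t.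
Proof.
have sgl ts : ts \in forest_list 1 n -> ts = [:: head (Node [::]) ts].
  by move=> /forest_sizeE [+ _]; case: ts => // t [].
pose l := [seq head (Node [::]) ts | ts <- forest_list 1 n].
have -> : \sum_(ts <- forest_list 1 n) \sum_(t <- ts) f t = \sum_(t <- l) f t.
  rewrite big_map !big_seq; apply: eq_bigr => ts mts.
  by rewrite {1}(sgl _ mts) big_seq1.
rewrite [RHS]fsbig_seq; last first.
  rewrite map_inj_in_uniq ?uniq_forest_list // => ts us mts mus e.
  by rewrite (sgl _ mts) (sgl _ mus) e.
apply: eq_fsbigl; apply/seteqP; split => t /=.
  move=> tn; apply/mapP; exists [:: t] => //.
  by apply: mem_forest_list => //=; rewrite addn0.
move=> /mapP[ts mts ->]; have := forest_sizeE mts.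
by rewrite (sgl _ mts) /= addn0 => -[].
Qed.

Lemma forest_sum1 n (g : seq tree -> R) : forest_sum offspring 1 n g =
  \sum_(t \in trees n) gw_prob xi t * g [:: t].
Proof.
rewrite fsbig_trees /forest_sum !big_seq; apply: eq_bigr => ts /forest_sizeE [].
by case: ts => // t [] // _ _; rewrite big_seq1 /forest_weight big_seq1.
Qed.

Lemma size_prob_forest n : size_prob xi n = forest_prob offspring 1 n.
Proof. by rewrite /forest_prob forest_sum1; apply: eq_fsbigr => t _; rewrite mulr1. Qed.

Lemma size_prob_walk n : n.+1%:R * size_prob xi n.+1 = walk offspring n.+1 n.
Proof. by rewrite size_prob_forest forest_prob_walk // mul1r subSS subn0. Qed.

Lemma size_prob0 : size_prob xi 0 = 0.
Proof. by rewrite size_prob_forest /forest_prob forest_sum_gt. Qed.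

Lemma size_prob_ge0 n : 0 <= size_prob xi n.
Proof.
case: n => [|n]; first by rewrite size_prob0.
rewrite -(@pmulr_rge0 _ n.+1%:R) ?ltr0n // size_prob_walk.
exact/walk_ge0/offspring_ge0.
Qed.

Lemma sum_by_size (V : zmodType) t (f : nat -> V) :
  \sum_(s <- subtrees t) f (tree_size s) =
  \sum_(1 <= m < (tree_size t).+1) f m *+ fringe_count m [:: t].
Proof.
have H s : s \in subtrees t -> (0 < tree_size s <= tree_size t)%N.
  move=> st; apply/andP; split; first by case: s {st} => us; rewrite tree_sizeE.
  rewrite leqNgt; apply/negP => lt.
  have : fringe_count (tree_size s) [:: t] = 0%N.
    by apply: fringe_count_gt; rewrite /= addn0.
  rewrite /fringe_count big_seq1 => /eqP; apply/negP; rewrite -lt0n -has_count.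
  by apply/hasP; exists s.
rewrite /fringe_count.
under [RHS]eq_bigr do rewrite big_seq1 -sum1_count -sumrMnr big_mkcond /=.
rewrite exchange_big /= !big_seq; apply: eq_bigr => s /H ss.
rewrite -big_mkcond /= (big_nat_widenl _ 0) //.
under eq_bigl do rewrite eq_sym andbC.
rewrite big_mkcond /= big_mkord -big_mkcondr /=.
rewrite (eq_bigl (fun i : 'I_(tree_size t).+1 => i == inord (tree_size s))).
  by rewrite big_pred1_eq inordK //; lia.
move=> i /=; apply/idP/eqP => [/andP[_ /eqP e]|->].
  by apply/val_inj; rewrite /= inordK //; lia.
by rewrite inordK; lia.
Qed.

Lemma cgw_cmean_treeX n (alpha : Cplx R) :
  cgw_cmean xi n (fun u => treeX u alpha) =
  \sum_(1 <= m < n.+1) npow m alpha *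
    ofR (size_prob xi m * walk offspring (n - m) (n - m) / size_prob xi n).
Proof.
rewrite /cgw_cmean.
transitivity (\sum_(t \in trees n) \sum_(1 <= m < n.+1)
   npow m alpha * ofR (gw_prob xi t * (fringe_count m [:: t])%:R / size_prob xi n)).
  apply: eq_fsbigr => t; rewrite inE => tn.
  rewrite /treeX (sum_by_size t (fun m => npow m alpha)) tn mulr_sumr.
  apply: eq_bigr => m _; rewrite -[_ *+ fringe_count _ _]mulr_natr -ofR_nat mulrCA -ofRM.
  by congr (_ * ofR _); rewrite /cgw_prob; ring.
rewrite fsbig_trees; under eq_bigr do rewrite exchange_big /=.
rewrite exchange_big /= !big_nat; apply: eq_bigr => m /andP[m0 mn].
have := fringe_mean_walk offspring 1 (_ : (0 < m <= n)%N).
rewrite m0 -ltnS mn => /(_ isT); rewrite /fringe_mean forest_sum1 fsbig_trees ltnS leq0n.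
rewrite mul1r subSS subn0 -size_prob_forest => <-.
rewrite mulr_suml ofR_sum mulr_sumr; apply: eq_bigr => ts _.
by rewrite mulr_suml ofR_sum mulr_sumr.
Qed.
End ConditionedTrees.

(** * Elementary trigonometric bounds *)

Section TrigBounds.
Variable R : realType.
Implicit Types x y : R.

Lemma ge0_of_derive (f df : R -> R) x :
  (forall y, is_derive y 1 f (df y)) -> (forall y, 0 <= y -> 0 <= df y) ->
  0 <= x -> f 0 <= f x.
Proof.
move=> fd df0 x0; rewrite -subr_ge0.
have [|c] := @MVT_segment R f df 0 x x0 (fun y _ => fd y).
  apply: continuous_subspaceT => y.
  by apply: differentiable_continuous; apply/derivable1_diffP; case: (fd y).
by rewrite in_itv /= => /andP[c0 _] ->; rewrite subr0 mulr_ge0 // df0.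
Qed.

Lemma sin_le_id x : 0 <= x -> sin x <= x.
Proof.
move=> x0; rewrite -subr_ge0.
have := @ge0_of_derive (fun y => y - sin y) (fun y => 1 - cos y) x.
rewrite sin0 subrr; by apply=> // y _; rewrite subr_ge0 cos_le1.
Qed.

Lemma cos_ge_quad_ge0 x : 0 <= x -> 0 <= cos x - 1 + x ^+ 2 / 2.
Proof.
move=> x0.
have := @ge0_of_derive (fun y => cos y - 1 + y ^+ 2 / 2) (fun y => y - sin y) x.
rewrite cos0 subrr expr0n mul0r addr0; apply=> // [y|y y0].
  by apply: is_derive_eq; rewrite /GRing.scale /=; field.
by rewrite subr_ge0 sin_le_id.
Qed.

Lemma sin_ge_cubic x : 0 <= x -> 0 <= sin x - x + x ^+ 3 / 6.
Proof.
move=> x0.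
have := @ge0_of_derive (fun y => sin y - y + y ^+ 3 / 6) (fun y => cos y - 1 + y ^+ 2 / 2) x.
rewrite sin0 subrr expr0n mul0r addr0; apply=> // [y|y y0].
  by apply: is_derive_eq; rewrite /GRing.scale /=; field.
exact: cos_ge_quad_ge0.
Qed.

Lemma cos_le_quartic_ge0 x : 0 <= x -> 0 <= x ^+ 4 / 24 - (cos x - 1 + x ^+ 2 / 2).
Proof.
move=> x0.
have := @ge0_of_derive (fun y => y ^+ 4 / 24 - (cos y - 1 + y ^+ 2 / 2))
  (fun y => sin y - y + y ^+ 3 / 6) x.
rewrite cos0 subrr !expr0n !mul0r addr0 subr0; apply=> // [y|y y0].
  by apply: is_derive_eq; rewrite /GRing.scale /=; field.
exact: sin_ge_cubic.
Qed.

Lemma cos_quad_ge0 x : 0 <= cos x - 1 + x ^+ 2 / 2.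
Proof. by rewrite -cos_norm -real_normK ?num_real // cos_ge_quad_ge0. Qed.

Lemma cos_quad_le x : cos x - 1 + x ^+ 2 / 2 <= x ^+ 4 / 24.
Proof.
rewrite -subr_ge0 -cos_norm -real_normK ?num_real // (_ : x ^+ 4 = `|x| ^+ 4).
  exact: cos_le_quartic_ge0.
by rewrite -[4%N]/(2 * 2)%N !exprM real_normK ?num_real.
Qed.

Lemma sin_id_cubic x : `|sin x - x| <= `|x| ^+ 3 / 6.
Proof.
have H y : 0 <= y -> `|sin y - y| <= y ^+ 3 / 6.
  move=> y0; have := sin_ge_cubic y0; have := sin_le_id y0 => h1 h2.
  by rewrite ler_norml; apply/andP; split; lra.
case: (lerP 0 x) => x0; first by rewrite [`|x|]ger0_norm ?H.
rewrite [`|x|]ltr0_norm //; have := H (- x); rewrite oppr_ge0 ltW // => /(_ isT).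
by rewrite sinN opprK -normrN opprD opprK.
Qed.

Lemma sin_norm_le x : `|sin x| <= `|x|.
Proof.
have H y : 0 <= y -> `|sin y| <= y.
  move=> y0; case: (lerP y 1) => y1.
    rewrite ger0_norm ?sin_le_id // sin_ge0_pi // y0 /=.
    by apply: le_trans y1 _; have := @pi_ge2 R; lra.
  by apply: le_trans (sin_max y) (ltW y1).
case: (lerP 0 x) => x0; first by rewrite [`|x|]ger0_norm ?H.
by rewrite [`|x|]ltr0_norm // -normrN -sinN H // oppr_ge0 ltW.
Qed.

Lemma sin_id_quad x : `|sin x - x| <= x ^+ 2.
Proof.
case: (lerP `|x| 6) => x6.
  apply: le_trans (sin_id_cubic x) _; rewrite -[leRHS]real_normK ?num_real //.
  by have := sqr_ge0 `|x|; rewrite exprS => h; nra.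
apply: le_trans (ler_normB _ _) _; rewrite -[leRHS]real_normK ?num_real //.
have := sin_norm_le x; nra.
Qed.

Lemma trig_cubic x : `|cos x - 1 + x ^+ 2 / 2| + `|sin x - x| <= `|x| ^+ 3.
Proof.
rewrite ger0_norm ?cos_quad_ge0 //.
have h1 := cos_quad_le x; have h2 := sin_id_cubic x; have h3 := cos_le1 x.
have e4 : x ^+ 4 = `|x| ^+ 4 by rewrite -[4%N]/(2 * 2)%N !exprM real_normK ?num_real.
have e2 : x ^+ 2 = `|x| ^+ 2 by rewrite real_normK ?num_real.
rewrite e4 in h1; rewrite e2 in h1 *.
set a := `|x| in h1 h2 *; have a0 : 0 <= a by exact: normr_ge0.
have a3 : 0 <= a ^+ 3 by exact: exprn_ge0.
case: (lerP a 1) => a1.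
  have : a ^+ 4 <= a ^+ 3 by rewrite exprS ler_piMl.
  by lra.
have : a ^+ 2 <= a ^+ 3 by rewrite [leRHS]exprS ler_peMl ?sqr_ge0 // ltW.
by lra.
Qed.

Lemma trig_quad x : `|cos x - 1 + x ^+ 2 / 2| + `|sin x - x| <= 2 * x ^+ 2.
Proof.
rewrite ger0_norm ?cos_quad_ge0 //.
have h2 := sin_id_quad x; have h3 := cos_le1 x; have := sqr_ge0 x.
by lra.
Qed.

(** With [y = x / 2] one has [1 - cos x = 2 (1 - cos y) (1 + cos y)], and
    [cos y >= 0] up to [|x| = pi]. *)
Lemma cos_quad_upper x : `|x| <= pi -> x ^+ 2 / 6 <= 1 - cos x.
Proof.
move=> xpi; pose y := x / 2.
have c0 : 0 <= cos y.
  apply: cos_ge0_pihalf; rewrite -ler_norml /y normrM [`|2^-1|]ger0_norm ?invr_ge0 //.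
  by rewrite ler_pM2r.
have y2 : y ^+ 2 <= 4.
  have : `|y| <= 2.
    rewrite /y normrM [`|2^-1|]ger0_norm ?invr_ge0 //.
    by have := @pihalf_lt2 R; lra.
  by move=> h; rewrite -real_normK ?num_real // (_ : 4 = 2 ^+ 2) ?ler_sqr ?nnegrE //; ring.
have := cos_quad_le y; have := sqr_ge0 y.
rewrite (_ : x = y *+ 2); last by rewrite /y -mulr_natr; field.
rewrite cos_mulr2n -[y *+ 2]mulr_natr (_ : y ^+ 4 = y ^+ 2 * y ^+ 2); last by ring.
rewrite (_ : (y * 2) ^+ 2 = y ^+ 2 * 4); last by ring.
move: c0 y2 (cos_le1 y); set c := cos y; set s := y ^+ 2 => c0 y2 c1 s0 h.
have hs : 0 <= s * (4 - s) by rewrite mulr_ge0 // subr_ge0.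
have hc : s / 3 <= 1 - c by lra.
have : 0 <= c * (1 - c - s / 3) by rewrite mulr_ge0 // subr_ge0.
by nra.
Qed.

Lemma expR_quad x : 0 <= x -> 0 <= expR (- x) - 1 + x <= x ^+ 2.
Proof.
move=> x0; have := expR_ge1Dx (- x); have := expR_ge1Dx x.
rewrite expRN => h1 h2; apply/andP; split; first by lra.
have : (expR x)^-1 <= (1 + x)^-1 by rewrite lef_pV2 ?posrE ?expR_gt0 //; lra.
have : (1 + x)^-1 <= 1 - x + x ^+ 2.
  rewrite -[leRHS]mulr1 -[X in _ <= _ * X](@divff _ (1 + x)); last by lra.
  rewrite mulrA ler_peMl ?invr_ge0; [by []|lra|].
  rewrite (_ : _ * _ = 1 + x ^+ 3); last by ring.
  by have := exprn_ge0 3 x0; lra.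
by lra.
Qed.

End TrigBounds.

(** * The characteristic function of the offspring distribution *)

Section Mean.
Variables (R : realType) (xi : probability nat R).
Local Notation p := (offspring xi).

Definition mean (f : nat -> R) : R := (\int[xi]_k f k)%R.

Lemma nat_measurable (f : nat -> R) : measurable_fun setT f.
Proof. by []. Qed.

Definition integrable_nat (f : nat -> R) := xi.-integrable setT (EFin \o f).

Lemma integrable_nat_le (f g : nat -> R) : integrable_nat g ->
  (forall k, `|f k| <= g k) -> integrable_nat f.
Proof.
move=> ig fg; apply: le_integrable ig => //.
by move=> k _ /=; rewrite lee_fin (le_trans (fg k)) // ler_norm.
Qed.

Lemma integrable_natD f g : integrable_nat f -> integrable_nat g ->
  integrable_nat (fun k => f k + g k).
Proof. by move=> fi gi; exact: (integrableD _ fi gi). Qed.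

Lemma integrable_natZ c f : integrable_nat f -> integrable_nat (fun k => c * f k).
Proof. by move=> fi; exact: (integrableZl _ c fi). Qed.

Lemma integrable_cst c : integrable_nat (fun=> c).
Proof. exact: finite_measure_integrable_cst. Qed.

Lemma integrable_natN f : integrable_nat f -> integrable_nat (fun k => - f k).
Proof.
move=> /(@integrable_natZ (-1)) h.
by apply: eq_integrable h => // k _ /=; rewrite mulN1r.
Qed.

Lemma integrable_bounded f c : (forall k, `|f k| <= c) -> integrable_nat f.
Proof. exact/integrable_nat_le/integrable_cst. Qed.

Lemma meanD f g : integrable_nat f -> integrable_nat g ->
  mean (fun k => f k + g k) = mean f + mean g.
Proof. by move=> fi gi; rewrite /mean RintegralD. Qed.

Lemma meanB f g : integrable_nat f -> integrable_nat g ->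
  mean (fun k => f k - g k) = mean f - mean g.
Proof. by move=> fi gi; rewrite /mean RintegralB. Qed.

Lemma meanZ c f : integrable_nat f -> mean (fun k => c * f k) = c * mean f.
Proof. by move=> fi; rewrite /mean RintegralZl. Qed.

Lemma mean_cst c : mean (fun=> c) = c.
Proof.
by rewrite /mean Rintegral_cst //= probability_setT mulr1.
Qed.

Lemma mean_ext f g : f =1 g -> mean f = mean g.
Proof. by move=> e; apply: eq_Rintegral => k _; rewrite e. Qed.

Lemma mean_le f g : integrable_nat f -> integrable_nat g ->
  (forall k, f k <= g k) -> mean f <= mean g.
Proof. by move=> fi gi fg; apply: le_Rintegral. Qed.

Lemma mean_ge0 f : (forall k, 0 <= f k) -> 0 <= mean f.
Proof. by move=> f0; apply: Rintegral_ge0. Qed.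

Lemma norm_mean_le f g : integrable_nat g -> (forall k, `|f k| <= g k) ->
  `|mean f| <= mean g.
Proof.
move=> gi fg; have fi := integrable_nat_le gi fg.
apply: le_trans (le_normr_Rintegral _ fi) _ => //.
apply: le_Rintegral => //.
apply: integrable_nat_le gi _ => k; by rewrite normr_id.
Qed.

Lemma mean_truncE f N :
  mean (fun k => if (k < N)%N then f k else 0) = \sum_(k < N) p k * f k.
Proof.
have bnd N' : integrable_nat (fun k => if (k < N')%N then f k else 0).
  apply: (@integrable_bounded _ (\sum_(k < N') `|f k|)) => k.
  case: ifP => kN; last by rewrite normr0 sumr_ge0.
  by rewrite (bigD1 (Ordinal kN)) //= lerDl sumr_ge0.
elim: N => [|N IH]; first by rewrite big_ord0 mean_cst.
rewrite big_ord_recr /= -IH.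
transitivity (mean (fun k => (if (k < N)%N then f k else 0) + f N * \1_[set N] k)).
  apply: mean_ext => k; rewrite indicE ltnS leq_eqVlt.
  case: (eqVneq k N) => [->|kN] /=; first by rewrite ltnn mem_set // mulr1 add0r.
  by rewrite memNset ?mulr0 ?addr0 // => /= /eqP; rewrite (negbTE kN).
have ii : integrable_nat (\1_[set N]).
  by apply: (@integrable_bounded _ 1) => k; rewrite indicE; case: (_ \in _); rewrite ?normr1 ?normr0.
rewrite meanD //; last exact: integrable_natZ.
rewrite meanZ // mulrC; congr (_ + _ * _).
by rewrite /mean /Rintegral integral_indic // setIT.
Qed.

Lemma mean_lim f : integrable_nat f -> \sum_(k < N) p k * f k @[N --> \oo] --> mean f.
Proof.
move=> fi; under eq_fun do rewrite -mean_truncE.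
have := @dominated_convergence _ _ _ xi setT measurableT
  (fun N => EFin \o (fun k => if (k < N)%N then f k else 0)) (EFin \o f)
  (fun k => `|f k|%:E).
case.
- by move=> N; apply/measurable_EFinP; exact: nat_measurable.
- by apply/measurable_EFinP; exact: nat_measurable.
- apply: aeW => k _ /=; apply: cvg_near_cst.
  by exists k.+1 => // N /= kN; rewrite ifT.
- apply: (@eq_integrable _ _ _ xi setT measurableT (abse \o (EFin \o f))) => //.
  exact: integrable_abse.
- by apply: aeW => k N _ /=; case: ifP => _; rewrite lee_fin // normr0.
move=> ifi _ cv.
rewrite /mean /Rintegral; apply: fine_cvg.
by rewrite fineK ?integrable_fin_num.
Qed.

Lemma mean_tail f e : integrable_nat f -> (forall k, 0 <= f k) -> 0 < e ->
  exists N, forall M, (N <= M)%N -> mean (fun k => if (k < M)%N then 0 else f k) <= e.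
Proof.
move=> fi f0 e0; have /cvgrPdist_le /(_ e e0) [N _ HN] := mean_lim fi.
exists N => M NM; have := HN M NM; rewrite -mean_truncE -meanB //; last first.
  apply: integrable_nat_le fi _ => k; case: ifP; rewrite ?normr0 // ger0_norm //.
move=> h; apply: le_trans (le_trans (ler_norm _) h).
by rewrite le_eqVlt; apply/orP; left; apply/eqP/mean_ext => k; case: ifP; rewrite ?subrr ?subr0.
Qed.

Lemma mean_supp f : integrable_nat f -> (forall k, p k * f k = 0) -> mean f = 0.
Proof.
move=> fi f0; have /cvg_lim <- // := mean_lim fi.
under eq_fun do rewrite big1 //.
exact: lim_cst.
Qed.


Section Critical.
Variable sigma : R.
Hypothesis crit : critical xi sigma.

Let X (k : nat) : R := k%:R - 1.

Lemma sigma_gt0 : 0 < sigma. Proof. by case: crit. Qed.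

Lemma var_integrable : integrable_nat (fun k => X k ^+ 2).
Proof.
case: crit => E1 _; rewrite /variance unlock E1 /= unlock => V.
apply/integrableP; split; first by apply/measurable_EFinP; exact: nat_measurable.
rewrite (_ : (\int[xi]_x _)%E = (sigma ^+ 2)%:E) ?ltry // -V.
by apply: eq_integral => k _ /=; rewrite ger0_norm ?sqr_ge0 // expr2.
Qed.

Lemma mean_sqr : mean (fun k => X k ^+ 2) = sigma ^+ 2.
Proof.
case: crit => E1 _; rewrite /variance unlock E1 /= unlock => V.
by rewrite /mean /Rintegral -[RHS]/(fine (sigma ^+ 2)%:E) -V.
Qed.

Lemma integrable_dom f c : (forall k, `|f k| <= c * (1 + X k ^+ 2)) -> integrable_nat f.
Proof.
move=> h; apply: integrable_nat_le h.
by apply/integrable_natZ/integrable_natD; [exact: integrable_cst|exact: var_integrable].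
Qed.

Lemma X_integrable : integrable_nat X.
Proof.
apply: (@integrable_dom _ 1) => k; rewrite mul1r -[X in _ + X]real_normK ?num_real //.
by have := sqr_ge0 (`|X k| - 1); rewrite sqrrB1 => h; have := normr_ge0 (X k); lra.
Qed.

Lemma id_integrable : integrable_nat (fun k => k%:R).
Proof.
have := integrable_natD X_integrable (integrable_cst 1).
by apply: eq_integrable => // k _ /=; rewrite subrK.
Qed.

Lemma mean_id : mean (fun k => k%:R) = 1.
Proof. by case: crit => + _; rewrite unlock /mean /Rintegral => ->. Qed.

Lemma mean_X : mean X = 0.
Proof.
by rewrite /X meanB ?mean_id ?mean_cst ?subrr //; [exact: id_integrable|exact: integrable_cst].
Qed.

Lemma offspring0_gt0 : 0 < p 0%N.
Proof.
rewrite lt_def offspring_ge0 andbT; apply/negP => /eqP p00.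
have t0 k : 0 <= p k * X k.
  case: k => [|k]; first by rewrite p00 mul0r.
  by rewrite mulr_ge0 ?offspring_ge0 // /X -natr1 addrK.
have pX k : p k * X k = 0.
  have lim := mean_lim X_integrable; rewrite mean_X in lim.
  apply/eqP; rewrite eq_le t0 andbT.
  have nd : nondecreasing_seq (fun N => \sum_(k < N) p k * X k).
    by apply/nondecreasing_seqP => N; rewrite big_ord_recr /= lerDl.
  have := nondecreasing_cvgn_le nd (cvgP _ lim) k.+1.
  rewrite (cvg_lim _ lim) // big_ord_recr /= => h.
  by apply: le_trans h; rewrite lerDr sumr_ge0.
have := mean_sqr; rewrite mean_supp; last 2 first.
- exact: var_integrable.
- by move=> k; rewrite expr2 mulrA pX mul0r.
by move=> /esym/eqP; rewrite sqrf_eq0 gt_eqF // sigma_gt0.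
Qed.

Lemma offspring_pos : exists2 k, (0 < k)%N & 0 < p k.
Proof.
apply: contrapT => H; have := mean_id; rewrite mean_supp.
- by move=> /eqP; rewrite eq_sym oner_eq0.
- exact: id_integrable.
move=> [|k]; first by rewrite mulr0.
apply/eqP; rewrite mulf_eq0; apply/orP; left.
rewrite eq_le offspring_ge0 andbT leNgt; apply/negP => pk.
by apply: H; exists k.+1.
Qed.

Lemma offspring_le1 k : p k <= 1.
Proof.
have := @mean_truncE (fun j => (j == k)%:R) k.+1.
rewrite big_ord_recr /= eqxx mulr1 big1 ?add0r; last first.
  by move=> i _; rewrite ltn_eqF ?mulr0.
move=> <-; rewrite -[leRHS](mean_cst 1); apply: mean_le.
- by apply: (@integrable_bounded _ 1) => j; case: ifP => _; rewrite ?normr0 //; case: eqP; rewrite ?normr1 ?normr0.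
- exact: integrable_cst.
by move=> j; case: ifP => _ //; case: eqP.
Qed.

(** ** The span *)

Definition defect (t : R) : R := mean (fun k => 1 - cos (k%:R * t)).

Lemma cos_integrable (f : nat -> R) : integrable_nat (fun k => cos (f k)).
Proof. by apply: (@integrable_bounded _ 1) => k; exact: cos_max. Qed.

Lemma sin_integrable (f : nat -> R) : integrable_nat (fun k => sin (f k)).
Proof. by apply: (@integrable_bounded _ 1) => k; exact: sin_max. Qed.

Lemma defect_integrable t : integrable_nat (fun k => 1 - cos (k%:R * t)).
Proof.
apply: integrable_natD; first exact: integrable_cst.
exact/integrable_natN/cos_integrable.
Qed.

Lemma defect_ge0 t : 0 <= defect t.
Proof. by apply: mean_ge0 => k; rewrite subr_ge0 cos_le1. Qed.

(** Near the zeros of [defect] the phase [j t] is close to a multiple of [2 pi]. *)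
Definition controlled (j : nat) :=
  exists2 C, 0 <= C & forall t, 1 - cos (j%:R * t) <= C * defect t.

Lemma one_minus_cosD (a b : R) : 1 - cos (a + b) <= 2 * (1 - cos a) + 2 * (1 - cos b).
Proof.
rewrite cosD; have := sqr_ge0 (sin a - sin b); have := sqr_ge0 (1 - cos a + (1 - cos b)).
have := cos2Dsin2 a; have := cos2Dsin2 b; nra.
Qed.

Lemma controlledD j k : controlled j -> controlled k -> controlled (j + k).
Proof.
move=> [C C0 HC] [D D0 HD]; exists (2 * C + 2 * D) => [|t]; first by lra.
rewrite natrD mulrDl; apply: le_trans (one_minus_cosD _ _) _.
by have := HC t; have := HD t; lra.
Qed.

Lemma controlledB j k : (k <= j)%N -> controlled j -> controlled k -> controlled (j - k).
Proof.
move=> kj [C C0 HC] [D D0 HD]; exists (2 * C + 2 * D) => [|t]; first by lra.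
rewrite natrB // mulrBl; apply: le_trans (one_minus_cosD _ _) _.
by rewrite cosN; have := HC t; have := HD t; lra.
Qed.

Lemma controlled0 : controlled 0.
Proof. by exists 0 => // t; rewrite !mul0r cos0 subrr. Qed.

Lemma controlled_supp k : 0 < p k -> controlled k.
Proof.
move=> pk; exists (p k)^-1 => [|t]; first by rewrite invr_ge0 ltW.
rewrite -ler_pdivrMl ?invr_gt0 // invrK.
have := @mean_truncE (fun j => if j == k then 1 - cos (j%:R * t) else 0) k.+1.
rewrite big_ord_recr /= eqxx big1 ?add0r; last first.
  by move=> i _; rewrite ltn_eqF ?mulr0.
have nn j : 0 <= 1 - cos (j%:R * t) by rewrite subr_ge0 cos_le1.
move=> <-; apply: mean_le; last by move=> j; do 2?case: ifP => //.
  apply: (@integrable_nat_le _ _ (defect_integrable t)) => j.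
  by do 2?case: ifP; rewrite ?normr0 ?ger0_norm.
exact: defect_integrable.
Qed.

(** The span of the support: the least positive element of a set of integers
    closed under differences that contains the support, hence a common divisor
    of the support.  Its own membership in the set bounds [defect] from below
    up to the first zero [2 pi / h]. *)
Lemma span_exists : exists2 h, (0 < h)%N &
  controlled h /\ forall k, ~~ (h %| k)%N -> p k = 0.
Proof.
have ex : exists h, `[< (0 < h)%N /\ controlled h >].
  by have [k k0 pk] := offspring_pos; exists k; apply/asboolP; split => //; exact: controlled_supp.
case: (ex_minnP ex) => h /asboolP[h0 ch] hmin; exists h => //; split => // k hk.
apply/eqP; rewrite eq_le offspring_ge0 andbT leNgt; apply/negP => /controlled_supp ck.
have cq q : controlled (q * h).
  by elim: q => [|q IH]; [exact: controlled0|rewrite mulSn; exact: controlledD].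
have cr : controlled (k %% h).
  have -> : (k %% h = k - k %/ h * h)%N by rewrite {2}(divn_eq k h) addKn.
  by apply: controlledB => //; rewrite leq_trunc_div.
have : (h <= k %% h)%N.
  by apply: hmin; apply/asboolP; split => //; rewrite lt0n; apply: contra hk.
by rewrite leqNgt ltn_pmod.
Qed.

(** ** Bounds on the characteristic function *)

(** The characteristic function of the centred variable [xi - 1]. *)
Definition psi (t : R) : Cplx R :=
  Complex (mean (fun k => cos (X k * t))) (mean (fun k => sin (X k * t))).

Let phi (t : R) : Cplx R :=
  Complex (mean (fun k => cos (k%:R * t))) (mean (fun k => sin (k%:R * t))).

Lemma psi_phi t : psi t = phi t * cis (- t).
Proof.
have cmean a b : mean (fun k => a * cos (k%:R * t) + b * sin (k%:R * t)) =
    a * mean (fun k => cos (k%:R * t)) + b * mean (fun k => sin (k%:R * t)).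
  rewrite meanD ?meanZ //; try exact: cos_integrable; try exact: sin_integrable.
    exact/integrable_natZ/cos_integrable.
  exact/integrable_natZ/sin_integrable.
apply: cplx_eq; rewrite ?cReM ?cImM /= cosN sinN.
  transitivity (cos t * cRe (phi t) + sin t * cIm (phi t)); last by rewrite /=; ring.
  rewrite -cmean; apply: mean_ext => k; rewrite mulrBl mul1r cosB; ring.
transitivity ((- sin t) * cRe (phi t) + cos t * cIm (phi t)); last by rewrite /=; ring.
rewrite -cmean; apply: mean_ext => k; rewrite mulrBl mul1r sinB; ring.
Qed.

(** Isolating the atom at 0, [phi = p_0 + w] with [|w| <= 1 - p_0] and
    [Re w = 1 - p_0 - defect]. *)
Lemma psi_le_defect t : cabs (psi t) ^+ 2 <= 1 - 2 * p 0%N * defect t.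
Proof.
rewrite psi_phi cabsM cabs_cis mulr1 cabs_sqr.
set C := cRe (phi t); set S := cIm (phi t).
have CE : defect t = 1 - C.
  by rewrite /defect meanB ?mean_cst //; [exact: integrable_cst|exact: cos_integrable].
pose a := C - p 0%N.
pose pos k : R := if (k < 1)%N then 0 else 1.
have ipos : integrable_nat pos.
  by apply: (@integrable_bounded _ 1) => k; rewrite /pos; case: ifP; rewrite ?normr0 ?normr1.
have ilt f : integrable_nat (fun k => if (k < 1)%N then f k else 0).
  by apply: (@integrable_bounded _ `|f 0%N|) => -[|k] //=; rewrite normr0.
have mpos : mean pos = 1 - p 0%N.
  have := mean_truncE (fun=> 1) 1; rewrite big_ord1 mulr1 => <-.
  rewrite -{1}(mean_cst 1) -meanB //; last exact: integrable_cst.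
  by apply: mean_ext => k; rewrite /pos; case: ifP; rewrite ?subrr ?subr0.
pose r := Num.sqrt (a ^+ 2 + S ^+ 2).
have r2 : r ^+ 2 = a ^+ 2 + S ^+ 2 by rewrite sqr_sqrtr // addr_ge0 ?sqr_ge0.
have r0 : 0 <= r by exact: sqrtr_ge0.
have ile : r ^+ 2 <= r * (1 - p 0%N).
  rewrite -mpos -meanZ // r2.
  have -> : a ^+ 2 + S ^+ 2 =
      mean (fun k => pos k * (a * cos (k%:R * t) + S * sin (k%:R * t))).
    have -> : a ^+ 2 + S ^+ 2 = a * (C - p 0%N) + S * S by rewrite /a; ring.
    have := mean_truncE (fun k => cos (k%:R * t)) 1; rewrite big_ord1 mul0r cos0 mulr1 => <-.
    rewrite /C /= -meanB //; last exact: cos_integrable.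
    rewrite -!meanZ; [|exact: sin_integrable|]; last first.
      by apply/integrable_natD; [exact: cos_integrable|exact/integrable_natN/ilt].
    rewrite -meanD; last 2 first.
    - apply/integrable_natZ/integrable_natD; [exact: cos_integrable|exact/integrable_natN/ilt].
    - exact/integrable_natZ/sin_integrable.
    apply: mean_ext => k; rewrite /pos; case: ifP => k1; last by rewrite subr0 mul1r.
    have -> : k = 0%N by lia.
    by rewrite !mul0r sin0 cos0 subrr !mulr0 addr0.
  apply: mean_le; [|exact: integrable_natZ|].
    apply: (@integrable_bounded _ (`|a| + `|S|)) => k; rewrite /pos; case: ifP => _.
      by rewrite mul0r normr0 addr_ge0.
    rewrite mul1r; apply: le_trans (ler_normD _ _) _; rewrite !normrM.
    by apply: lerD; rewrite ler_piMr // ?cos_max ?sin_max.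
  move=> k; rewrite /pos; case: ifP => _; first by rewrite mul0r mulr0.
  rewrite mul1r mulr1; set c := cos _; set s := sin _.
  have cs : c ^+ 2 + s ^+ 2 = 1 by exact: cos2Dsin2.
  apply: le_trans (ler_norm _) _; rewrite -sqrtr_sqr ler_sqrt ?addr_ge0 ?sqr_ge0 //.
  by have := sqr_ge0 (a * s - S * c); nra.
have rle : r <= 1 - p 0%N.
  have p01 : 0 <= 1 - p 0%N by rewrite subr_ge0 offspring_le1.
  have [->//|rn] := eqVneq r 0.
  have rp : 0 < r by rewrite lt_def rn.
  by move: ile; rewrite expr2 ler_pM2l.
have : r ^+ 2 <= (1 - p 0%N) ^+ 2 by rewrite ler_sqr ?nnegrE // subr_ge0 offspring_le1.
by rewrite r2 CE /a => h; nra.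
Qed.

Lemma psi_le1 t : cabs (psi t) <= 1.
Proof.
rewrite -ler_sqr ?nnegrE ?cabs_ge0 // expr1n.
apply: le_trans (psi_le_defect t) _.
by rewrite lerBlDr lerDl !mulr_ge0 // ?offspring_ge0 ?defect_ge0.
Qed.

Lemma psi_gauss_bound h : (0 < h)%N -> controlled h ->
  exists2 c, 0 < c & forall t, `|t| <= pi / h%:R -> cabs (psi t) <= expR (- (c * t ^+ 2)).
Proof.
move=> h0 [C C0 HC]; have p0 := offspring0_gt0.
have hR : 0 < h%:R :> R by rewrite ltr0n.
exists (p 0%N * (h%:R ^+ 2 / 6) / (C + 1)).
  by rewrite divr_gt0 ?mulr_gt0 ?exprn_gt0 //; lra.
move=> t tpi; rewrite -ler_sqr ?nnegrE ?cabs_ge0 ?expR_ge0 // -expRM_natl.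
apply: le_trans (psi_le_defect t) _.
have Hc : (h%:R * t) ^+ 2 / 6 <= (C + 1) * defect t.
  have : (h%:R * t) ^+ 2 / 6 <= 1 - cos (h%:R * t).
    apply: cos_quad_upper; rewrite normrM [`|h%:R|]ger0_norm ?ler0n //.
    by rewrite mulrC -ler_pdivlMr.
  by have := HC t; have := defect_ge0 t; lra.
suff H : p 0%N * (h%:R ^+ 2 / 6) / (C + 1) * t ^+ 2 <= p 0%N * defect t.
  by apply: le_trans (expR_ge1Dx (- (2 * p 0%N * defect t))) _; rewrite ?ler_expR; lra.
rewrite (_ : _ * t ^+ 2 = p 0%N / (C + 1) * ((h%:R * t) ^+ 2 / 6)); last by field; lra.
rewrite (_ : _ * defect t = p 0%N / (C + 1) * ((C + 1) * defect t)); last by field; lra.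
by rewrite ler_wpM2l // divr_ge0 //; lra.
Qed.

Lemma psi_taylor t :
  cabs (psi t - ofR (1 - sigma ^+ 2 * t ^+ 2 / 2)) <=
  mean (fun k => `|cos (X k * t) - 1 + (X k * t) ^+ 2 / 2| + `|sin (X k * t) - X k * t|).
Proof.
have iX2 : integrable_nat (fun k => (X k * t) ^+ 2 / 2).
  apply: (@integrable_dom _ (t ^+ 2)) => k; rewrite ger0_norm ?divr_ge0 ?sqr_ge0 // exprMn.
  by have := sqr_ge0 (X k); have := sqr_ge0 t; nra.
have ic : integrable_nat (fun k => cos (X k * t) - 1 + (X k * t) ^+ 2 / 2).
  by apply/integrable_natD => //; apply/integrable_natD; [exact: cos_integrable|exact: integrable_cst].
have iXt : integrable_nat (fun k => X k * t).
  by under eq_fun do rewrite mulrC; exact/integrable_natZ/X_integrable.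
have is' : integrable_nat (fun k => sin (X k * t) - X k * t).
  by apply/integrable_natD; [exact: sin_integrable|exact: integrable_natN].
have ia f : integrable_nat f -> integrable_nat (fun k => `|f k|) by move=> fi; exact: integrable_abse fi.
apply: le_trans (cabs_le_ReIm _) _.
rewrite meanD; try exact: ia; apply: lerD.
  have -> : cRe (psi t - ofR (1 - sigma ^+ 2 * t ^+ 2 / 2)) =
      mean (fun k => cos (X k * t) - 1 + (X k * t) ^+ 2 / 2).
    rewrite cReB cRe_ofR /= meanD //; last first.
      by apply/integrable_natD; [exact: cos_integrable|exact: integrable_cst].
    rewrite meanB ?mean_cst; [|exact: cos_integrable|exact: integrable_cst].
    rewrite (_ : mean (fun k => (X k * t) ^+ 2 / 2) = sigma ^+ 2 * t ^+ 2 / 2); first by ring.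
    rewrite -mean_sqr -mulrA mulrC -meanZ; last exact: var_integrable.
    by apply: mean_ext => k; rewrite exprMn; ring.
  exact: norm_mean_le (ia _ ic) _.
have -> : cIm (psi t - ofR (1 - sigma ^+ 2 * t ^+ 2 / 2)) = mean (fun k => sin (X k * t) - X k * t).
  rewrite cImB cIm_ofR subr0 /= meanB //; last exact: sin_integrable.
  rewrite (_ : mean (fun k => X k * t) = 0) ?subr0 //.
  under [LHS]mean_ext do rewrite mulrC.
  by rewrite meanZ ?mean_X ?mulr0 //; exact: X_integrable.
exact: norm_mean_le (ia _ is') _.
Qed.

Lemma psi_quad t : cabs (psi t - 1) <= 3 * sigma ^+ 2 * t ^+ 2.
Proof.
rewrite (_ : psi t - 1 = (psi t - ofR (1 - sigma ^+ 2 * t ^+ 2 / 2)) - ofR (sigma ^+ 2 * t ^+ 2 / 2)); last first.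
  by rewrite ofRB ofR1; ring.
apply: le_trans (cabsB _ _) _; rewrite cabs_ofR ger0_norm; last by apply: divr_ge0 => //; apply: mulr_ge0; exact: sqr_ge0.
suff : cabs (psi t - ofR (1 - sigma ^+ 2 * t ^+ 2 / 2)) <= 2 * t ^+ 2 * sigma ^+ 2.
  by have : 0 <= sigma ^+ 2 * t ^+ 2 by [apply: mulr_ge0; exact: sqr_ge0]; nra.
apply: le_trans (psi_taylor t) _; rewrite -mean_sqr -meanZ; last exact: var_integrable.
have iq : integrable_nat (fun k => 2 * t ^+ 2 * X k ^+ 2) by exact/integrable_natZ/var_integrable.
have b k : `|cos (X k * t) - 1 + (X k * t) ^+ 2 / 2| + `|sin (X k * t) - X k * t| <=
    2 * t ^+ 2 * X k ^+ 2.
  apply: le_trans (trig_quad _) _.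
  by rewrite (_ : 2 * (X k * t) ^+ 2 = 2 * t ^+ 2 * X k ^+ 2) //; ring.
apply: mean_le => //; apply: integrable_nat_le iq _ => k.
by rewrite ger0_norm ?addr_ge0.
Qed.

(** Only second moments are available: the contribution of large [k] is
    controlled by the tail of the variance. *)
Lemma psi_gauss e : 0 < e -> exists2 C, 0 <= C & forall t, `|t| <= pi ->
  cabs (psi t - ofR (expR (- (sigma ^+ 2 / 2 * t ^+ 2)))) <= e * t ^+ 2 + C * `|t| ^+ 3.
Proof.
move=> e0; have [N HN] := @mean_tail _ (e / 2) var_integrable (fun k => sqr_ge0 _) (divr_gt0 e0 (@ltr0n R 2)).
have s0 := sqr_ge0 sigma.
exists (N.+1%:R * sigma ^+ 2 + sigma ^+ 4 * pi).
  apply: addr_ge0; first by rewrite mulr_ge0.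
  by apply: mulr_ge0; [exact: exprn_even_ge0|exact: pi_ge0].
move=> t tpi.
rewrite (_ : psi t - _ = (psi t - ofR (1 - sigma ^+ 2 * t ^+ 2 / 2)) -
   ofR (expR (- (sigma ^+ 2 / 2 * t ^+ 2)) - 1 + sigma ^+ 2 / 2 * t ^+ 2)); last first.
  rewrite (_ : sigma ^+ 2 * t ^+ 2 / 2 = sigma ^+ 2 / 2 * t ^+ 2); last by ring.
  by move: (_ * t ^+ 2) => y; rewrite ofRD !ofRB ofR1; ring.
apply: le_trans (cabsB _ _) _; rewrite cabs_ofR.
have y0 : 0 <= sigma ^+ 2 / 2 * t ^+ 2 by apply: mulr_ge0; rewrite ?divr_ge0 ?sqr_ge0.
have /andP[g0 g1] := expR_quad y0; rewrite [`|_ + _|]ger0_norm //.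
have t3 : t ^+ 4 <= pi * `|t| ^+ 3.
  rewrite (_ : t ^+ 4 = `|t| * `|t| ^+ 3); last first.
    by rewrite -exprS -[4%N]/(2 * 2)%N !exprM real_normK ?num_real.
  by rewrite ler_wpM2r // exprn_ge0.
have g2 : (sigma ^+ 2 / 2 * t ^+ 2) ^+ 2 <= sigma ^+ 4 * pi * `|t| ^+ 3.
  rewrite (_ : _ ^+ 2 = sigma ^+ 4 * t ^+ 4 / 4); last by field.
  have s4 : 0 <= sigma ^+ 4 by exact: exprn_even_ge0.
  have : sigma ^+ 4 * t ^+ 4 <= sigma ^+ 4 * (pi * `|t| ^+ 3) by rewrite ler_wpM2l.
  have : 0 <= sigma ^+ 4 * t ^+ 4.
    by apply: mulr_ge0 => //; exact: exprn_even_ge0.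
  by rewrite !mulrA; lra.
rewrite mulrDl [leRHS]addrA; apply: lerD; last exact: le_trans g1 g2.
apply: le_trans (psi_taylor t) _.
pose tl k := if (k < N)%N then 0 else X k ^+ 2.
have itl : integrable_nat tl.
  apply: integrable_nat_le var_integrable _ => k; rewrite /tl.
  by case: ifP => _; rewrite ?normr0 ?sqr_ge0 // ger0_norm ?sqr_ge0.
have h : forall k, `|cos (X k * t) - 1 + (X k * t) ^+ 2 / 2| + `|sin (X k * t) - X k * t| <=
    2 * t ^+ 2 * tl k + N.+1%:R * `|t| ^+ 3 * X k ^+ 2.
  move=> k; have X2 := sqr_ge0 (X k); have at3 : 0 <= `|t| ^+ 3 by rewrite exprn_ge0.
  rewrite /tl; case: ifP => kN.
    rewrite mulr0 add0r; apply: le_trans (trig_cubic _) _.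
    rewrite normrM exprMn exprS real_normK ?num_real //.
    have : `|X k| <= N.+1%:R.
      rewrite /X; apply: le_trans (ler_normB _ _) _; rewrite normr1 normr_nat natr1 ler_nat.
      by lia.
    move=> XN; rewrite -mulrA [X in _ * X]mulrC [leRHS](_ : _ = N.+1%:R * (`|t| ^+ 3 * X k ^+ 2)); last by ring.
    by rewrite ler_wpM2r // mulr_ge0.
  apply: le_trans (trig_quad _) _; rewrite exprMn.
  have : 0 <= N.+1%:R * `|t| ^+ 3 * X k ^+ 2 by apply: mulr_ge0 => //; exact: mulr_ge0.
  by lra.
have i1 : integrable_nat (fun k => 2 * t ^+ 2 * tl k) by exact: integrable_natZ.
have i2 : integrable_nat (fun k => N.+1%:R * `|t| ^+ 3 * X k ^+ 2) by exact/integrable_natZ/var_integrable.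
apply: le_trans (mean_le _ (integrable_natD i1 i2) h) _.
  by apply: integrable_nat_le (integrable_natD i1 i2) _ => k; rewrite ger0_norm ?addr_ge0.
rewrite meanD // !meanZ //; last exact: var_integrable.
rewrite mean_sqr; apply: lerD; last by rewrite mulrAC.
have := HN N (leqnn _); rewrite -/tl => H; have := sqr_ge0 t; rewrite -/(mean tl) in H *; nra.
Qed.

End Critical.
End Mean.

(** * Fourier inversion *)

Section FourierTools.
Variable R : realType.
Local Notation mu := (@lebesgue_measure R).
Implicit Types (a c t : R) (g : R -> R).

Definition sym_int a g : R := (\int[mu]_(t in `[(- a)%R, a]) g t)%R.

Definition lipschitz_real g := exists L : R, forall t s, `|g t - g s| <= L * `|t - s|.

Lemma lipschitz_integrable a g : lipschitz_real g ->
  mu.-integrable `[(- a)%R, a] (EFin \o g).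
Proof.
move=> [L HL]; apply: continuous_compact_integrable; first exact: segment_compact.
apply: continuous_subspaceT => t; apply/cvgrPdist_le => e e0.
have L1 : 0 < `|L| + 1 by have := normr_ge0 L; lra.
near=> s.
apply: le_trans (HL _ _) _.
have : `|t - s| <= e / (`|L| + 1).
  by near: s; apply: cvgr_dist_le; [exact: cvg_id|exact: divr_gt0].
rewrite ler_pdivlMr // => h; apply: le_trans h; rewrite mulrC.
by rewrite ler_wpM2l // (le_trans (ler_norm L)) // lerDl.
Unshelve. all: by end_near. Qed.

Lemma lipschitz_cst c : lipschitz_real (fun=> c).
Proof. by exists 0 => t s; rewrite subrr normr0 mul0r. Qed.

Lemma cis_sub1 t : cabs (cis t - 1) <= 2 * `|t|.
Proof.
apply: le_trans (cabs_le_ReIm _) _; rewrite cReB cImB cRe1 cIm1 subr0 /=.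
have h1 := sin_norm_le t; suff : `|cos t - 1| <= `|t| by lra.
have q := cos_quad_ge0 t; have c1 := cos_le1 t; have cN := cos_geN1 t.
rewrite ler0_norm; last by lra.
case: (lerP `|t| 2) => t2; last by lra.
have : `|t| ^+ 2 / 2 <= `|t| by have := normr_ge0 t; nra.
by rewrite real_normK ?num_real //; lra.
Qed.

Lemma cis_lip t s : cabs (cis t - cis s) <= 2 * `|t - s|.
Proof.
rewrite (_ : cis t - cis s = cis s * (cis (t - s) - 1)); last first.
  by rewrite mulrBr mulr1 -cisD; congr (cis _ - _); ring.
by rewrite cabsM cabs_cis mul1r cis_sub1.
Qed.

Lemma cabs_subX (x y : Cplx R) m n : cabs x <= m -> cabs y <= m ->
  cabs (x ^+ n - y ^+ n) <= n%:R * cabs (x - y) * m ^+ n.-1.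
Proof.
move=> xm ym; rewrite subrXX cabsM mulrAC [leLHS]mulrC ler_wpM2r ?cabs_ge0 //.
apply: le_trans (cabs_sum _ _ _) _.
rewrite -[leRHS](_ : \sum_(i < n) m ^+ n.-1 = _); last first.
  by rewrite sumr_const card_ord mulr_natl.
apply: ler_sum => i _; rewrite cabsM !cabsX.
rewrite [leRHS](_ : _ = m ^+ (n.-1 - i) * m ^+ i); last first.
  by rewrite -exprD subnK //; have := ltn_ord i; lia.
by apply: ler_pM; rewrite ?exprn_ge0 ?cabs_ge0 // lerXn2r ?nnegrE ?cabs_ge0 // (le_trans (cabs_ge0 _) xm).
Qed.

Lemma cos_lipschitz c : lipschitz_real (fun t => cos (c * t)).
Proof.
exists (2 * `|c|) => t s.
have := le_trans (cabs_Re _) (cis_lip (c * t) (c * s)).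
by rewrite cReB /= -mulrBr normrM mulrA.
Qed.

Lemma sym_int_bound a g G : lipschitz_real g -> lipschitz_real G ->
  (forall t, `|t| <= a -> `|g t| <= G t) -> `|sym_int a g| <= sym_int a G.
Proof.
move=> lg lG H; have ig := lipschitz_integrable a lg; have iG := lipschitz_integrable a lG.
apply: le_trans (le_normr_Rintegral _ ig) _ => //.
apply: le_Rintegral => //; first exact: integrable_abse ig.
by move=> t; rewrite /= in_itv /= -ler_norml; exact: H.
Qed.

Lemma sym_intB a g G : lipschitz_real g -> lipschitz_real G ->
  sym_int a (fun t => g t - G t) = sym_int a g - sym_int a G.
Proof. by move=> lg lG; rewrite /sym_int RintegralB //; exact: lipschitz_integrable. Qed.

Lemma sym_int_cst a c : 0 <= a -> sym_int a (fun=> c) = c * (2 * a).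
Proof.
rewrite le_eqVlt => /predU1P[<-|a0]; rewrite /sym_int.
  by rewrite oppr0 set_itv1 Rintegral_set1 !mulr0.
rewrite Rintegral_cst //= lebesgue_measure_itv /= lte_fin gtrN //= opprK.
by congr (_ * _); ring.
Qed.

Lemma sin_pi_nat n : sin (n%:R * pi) = 0 :> R.
Proof.
elim: n => [|n IH]; first by rewrite mul0r sin0.
by rewrite -natr1 mulrDl mul1r sinDpi IH oppr0.
Qed.

Lemma sym_int_cos m n : (0 < m)%N -> (0 < n)%N ->
  sym_int (pi / m%:R) (fun t => cos ((n * m)%:R * t)) = 0.
Proof.
move=> m0 n0; set a := pi / m%:R; set d := (n * m)%:R.
have mR : 0 < m%:R :> R by rewrite ltr0n.
have d0 : 0 < d by rewrite /d ltr0n muln_gt0 n0.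
have a0 : 0 < a by rewrite divr_gt0 ?pi_gt0.
have drv (e t : R) : 0 < e -> is_derive t 1 (fun s => sin (e * s) / e) (cos (e * t)).
  move=> e0; by apply: is_derive_eq; rewrite /GRing.scale /=; field; lra.
have {}drv t := drv d t d0.
have cts : continuous (fun s => sin (d * s) / d).
  by move=> t; apply: differentiable_continuous; apply/derivable1_diffP; case: (drv t).
rewrite /sym_int /Rintegral (@continuous_FTC2 _ _ (fun s => sin (d * s) / d)).
- rewrite /= mulrN sinN /d /a natrM -mulrA [m%:R * _]mulrC divfK ?gt_eqF //.
  by rewrite sin_pi_nat oppr0 !mul0r subrr.
- by lra.
- apply: continuous_subspaceT => t; apply: differentiable_continuous.
  by apply/derivable1_diffP; apply: ex_derive.
- split => [t _| |]; first by case: (drv t).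
    by apply: cvg_at_right_filter; exact: cts.
  by apply: cvg_at_left_filter; exact: cts.
by move=> t _; rewrite derive1E; case: (drv t).
Qed.

(** ** Gaussian integrals *)

Lemma gaussE c : 0 < c -> (fun t => expR (- (c * t ^+ 2))) =
  (fun t => Num.sqrt (pi / c) * normal_pdf 0 (Num.sqrt (2 * c)^-1) t).
Proof.
move=> c0; apply/funext => t.
have s0 : 0 < (2 * c)^-1 by rewrite invr_gt0 mulr_gt0.
rewrite normal_pdfE ?gt_eqF ?sqrtr_gt0 // /normal_peak /normal_fun.
rewrite sqr_sqrtr ?ltW // subr0 -[(_ * pi) *+ 2]mulr_natr -[(2 * c)^-1 *+ 2]mulr_natr.
rewrite (_ : (2 * c)^-1 * pi * 2 = pi / c); last by field; lra.
rewrite [RHS]mulrA divff ?gt_eqF ?sqrtr_gt0 ?divr_gt0 ?pi_gt0 // mul1r; congr expR.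
by field; lra.
Qed.

Lemma gauss_integral c : 0 < c ->
  (\int[mu]_t (expR (- (c * t ^+ 2)))%:E)%E = (Num.sqrt (pi / c))%:E.
Proof.
move=> c0; under eq_integral do rewrite -[expR _]/((fun t => expR (- (c * t ^+ 2))) _) gaussE // EFinM.
by rewrite integralZl ?integral_normal_pdf ?mule1 //; exact: integrable_normal_pdf.
Qed.

Lemma gauss_integrable c : 0 < c -> mu.-integrable setT (EFin \o (fun t => expR (- (c * t ^+ 2)))).
Proof.
move=> c0; rewrite gaussE //.
exact: (integrableZl measurableT _ (integrable_normal_pdf _ _)).
Qed.

Lemma gauss_le_itv a c : 0 < c -> sym_int a (fun t => expR (- (c * t ^+ 2))) <= Num.sqrt (pi / c).
Proof.
move=> c0; rewrite -lee_fin -gauss_integral // /sym_int /Rintegral fineK; last first.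
  apply: integrable_fin_num => //; apply: integrableS (gauss_integrable c0) => //.
apply: ge0_subset_integral => //.
  by apply: measurable_int (gauss_integrable c0).
Qed.

Lemma absorb c y : 0 < c -> y * expR (- (c * y)) <= c^-1.
Proof.
move=> c0; rewrite expRN ler_pdivrMr ?expR_gt0 // mulrC ler_pdivlMr // mulrC.
by apply: le_trans (expR_ge1Dx _); lra.
Qed.

(** Outside of [[-a, a]] the Gaussian is at most [(2 / (c a^2)) exp (- c t^2 / 2)]. *)
Lemma gauss_ge_itv a c : 0 < a -> 0 < c ->
  Num.sqrt (pi / c) - 2 / (c * a ^+ 2) * Num.sqrt (pi / (c / 2)) <=
  sym_int a (fun t => expR (- (c * t ^+ 2))).
Proof.
move=> a0 c0; have c20 : 0 < c / 2 by rewrite divr_gt0.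
have ca : 0 < c * a ^+ 2 by rewrite mulr_gt0 // exprn_gt0.
rewrite lerBlDr -lee_fin -gauss_integral // EFinD EFinM -(gauss_integral c20).
rewrite /sym_int /Rintegral fineK; last first.
  by apply: integrable_fin_num => //; apply: integrableS (gauss_integrable c0).
rewrite integral_mkcond -integralZl //; last exact: gauss_integrable.
have i2 := integrableZl measurableT (2 / (c * a ^+ 2)) (gauss_integrable c20).
have i1 : mu.-integrable setT ((fun t => (expR (- (c * t ^+ 2)))%:E) \_ `[(- a)%R, a]).
  have := @integrable_mkcond _ _ _ mu `[(- a)%R, a] (EFin \o (fun t => expR (- (c * t ^+ 2)))).
  by case=> // + _; apply; apply: integrableS (gauss_integrable c0).
rewrite -(integralD measurableT i1 i2) ; apply: ge0_le_integral => //.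
- by apply: measurable_int (gauss_integrable c0).
- by apply: emeasurable_funD; [exact: measurable_int i1|exact: measurable_int i2].
move=> t _; rewrite /= patchE; case: ifPn => [_|].
  by rewrite leeDl // -EFinM lee_fin mulr_ge0 ?expR_ge0 // divr_ge0 // ltW.
rewrite notin_setE /= in_itv /= -ler_norml => /negP; rewrite -ltNge => at'.
rewrite add0e -EFinM lee_fin.
have a2 : a ^+ 2 <= t ^+ 2.
  by rewrite -[t ^+ 2]real_normK ?num_real // ler_sqr ?nnegrE // ltW.
rewrite (_ : expR (- (c * t ^+ 2)) = expR (- (c / 2 * t ^+ 2)) * expR (- (c / 2 * t ^+ 2))); last first.
  by rewrite -expRD; congr expR; field.
rewrite ler_wpM2r ?expR_ge0 //.
apply: (@le_trans _ _ (expR (- (1 / 2 * (c * a ^+ 2))))).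
  rewrite ler_expR lerN2; have : c * a ^+ 2 <= c * t ^+ 2 by rewrite ler_wpM2l // ltW.
  by lra.
rewrite ler_pdivlMr // mulrC; apply: le_trans (absorb _ _) _; first by lra.
by rewrite invf_div divr1.
Qed.

Lemma gauss_lipschitz c : 0 < c -> lipschitz_real (fun t => expR (- (c * t ^+ 2))).
Proof.
move=> c0; pose L := 2 * c * (1 + c^-1).
have L0 : 0 < L by rewrite !mulr_gt0 //; have : 0 < c^-1 by [rewrite invr_gt0]; lra.
have drv t : is_derive t 1 (fun t => expR (- (c * t ^+ 2))) (- (2 * c * t) * expR (- (c * t ^+ 2))).
  by apply: is_derive_eq; rewrite /GRing.scale /=; ring.
have H t s : s <= t -> `|expR (- (c * t ^+ 2)) - expR (- (c * s ^+ 2))| <= L * `|t - s|.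
  move=> st; have [|x _ ->] := @MVT_segment R _ _ s t st (fun x _ => drv x).
    apply: continuous_subspaceT => x.
    by apply: differentiable_continuous; apply/derivable1_diffP; case: (drv x).
  rewrite normrM ler_wpM2r // normrM normrN ger0_norm; last exact: expR_ge0.
  rewrite !normrM [`|c|]gtr0_norm // normr_nat /L -!mulrA !ler_pM2l //.
  have := absorb (x ^+ 2) c0; have e1 : expR (- (c * x ^+ 2)) <= 1.
    by rewrite -expR0 ler_expR oppr_le0 mulr_ge0 ?sqr_ge0 // ltW.
  have e0 := expR_gt0 (- (c * x ^+ 2)).
  have : `|x| <= 1 + x ^+ 2.
    by have := sqr_ge0 (`|x| - 1); rewrite sqrrB1 real_normK ?num_real //; have := normr_ge0 x; lra.
  by move: e0 e1; set E := expR _; nra.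
exists L => t s; case: (leP s t) => st; first exact: H.
by have := H s t (ltW st); rewrite (distrC s t) (distrC (expR _)).
Qed.

End FourierTools.

(** * The local limit theorem *)

Section LocalLimit.
Variables (R : realType) (xi : probability nat R) (sigma : R).
Hypothesis crit : critical xi sigma.
Variable h : nat.
Hypotheses (h0 : (0 < h)%N) (hc : controlled xi h).
Hypothesis hs : forall k, ~~ (h %| k)%N -> offspring xi k = 0.
Local Notation p := (offspring xi).
Local Notation psi := (psi xi).
Let X (k : nat) : R := k%:R - 1.
Let a : R := pi / h%:R.

Let hR : 0 < h%:R :> R. Proof. by rewrite ltr0n. Qed.
Let a0 : 0 < a. Proof. by rewrite divr_gt0 ?pi_gt0. Qed.

Lemma lipschitzD (f g : R -> R) : lipschitz_real f -> lipschitz_real g ->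
  lipschitz_real (fun t => f t + g t).
Proof.
move=> [L HL] [M HM]; exists (L + M) => t s; rewrite opprD addrACA mulrDl.
by apply: le_trans (ler_normD _ _) _; exact: lerD.
Qed.

Lemma lipschitzZ c (f : R -> R) : lipschitz_real f -> lipschitz_real (fun t => c * f t).
Proof.
move=> [L HL]; exists (`|c| * L) => t s; rewrite -mulrBr normrM -mulrA.
by rewrite ler_wpM2l.
Qed.

Lemma lipschitz_cos_sum N (c d : nat -> R) :
  lipschitz_real (fun t => \sum_(i < N) c i * cos (d i * t)).
Proof.
elim: N => [|N IH]; first by exists 0 => t s; rewrite !big_ord0 subrr normr0 mul0r.
under eq_fun do rewrite big_ord_recr /=.
by apply: lipschitzD => //; apply: lipschitzZ; exact: cos_lipschitz.
Qed.

Lemma sym_int_cos_sum b N (c d : nat -> R) :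
  sym_int b (fun t => \sum_(i < N) c i * cos (d i * t)) =
  \sum_(i < N) c i * sym_int b (fun t => cos (d i * t)).
Proof.
elim: N => [|N IH].
  rewrite big_ord0 /sym_int (_ : (fun t => _) = fun=> 0) ?Rintegral_cst ?mul0r //.
  by apply/funext => t; rewrite big_ord0.
rewrite big_ord_recr /= -IH.
under eq_fun do rewrite big_ord_recr /=.
rewrite /sym_int RintegralD //; last 2 first.
- exact/lipschitz_integrable/lipschitz_cos_sum.
- exact/lipschitz_integrable/lipschitzZ/cos_lipschitz.
by rewrite RintegralZl //; exact/lipschitz_integrable/cos_lipschitz.
Qed.

Lemma coef_span (N n i : nat) : ~~ (h %| i)%N -> ((\poly_(j < N) p j) ^+ n)`_i = 0.
Proof.
elim: n i => [|n IH] i hi.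
  by rewrite expr0 coef1; case: i hi => //; rewrite dvdn0.
rewrite exprS coefM big1 // => j _; rewrite coef_poly.
have [hj|hj] := boolP (h %| j)%N; last by rewrite hs // if_same mul0r.
rewrite IH ?mulr0 //; apply: contra hi => hij.
by have ji := ltn_ord j; rewrite -(subnK (_ : j <= i)%N) ?dvdn_add // -ltnS.
Qed.

Lemma walk_span n k : ~~ (h %| k)%N -> walk p n k = 0.
Proof. by move=> hk; rewrite (walk_coef p n (ltnSn k)) coef_span. Qed.

Let tail K := mean xi (fun k => if (k < K)%N then 0 else 1).

Let trunc_int (f : nat -> R) K : (forall k, `|f k| <= 1) ->
  `|mean xi f - \sum_(k < K) p k * f k| <= tail K.
Proof.
move=> f1; have i1 : integrable_nat xi f by exact: integrable_bounded f1.
rewrite -mean_truncE -meanB //; last first.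
  by apply: (@integrable_bounded _ _ _ 1) => k; case: ifP; rewrite ?normr0.
apply: norm_mean_le.
  by apply: (@integrable_bounded _ _ _ 1) => k; case: ifP; rewrite ?normr0 ?normr1.
by move=> k; case: ifP => _; rewrite ?subrr ?normr0 ?subr0.
Qed.

Let psiK K (t : R) : Cplx R := \sum_(k < K) ofR (p k) * cis (X k * t).

Lemma psi_truncation K t : cabs (psi t - psiK K t) <= 2 * tail K.
Proof.
apply: le_trans (cabs_le_ReIm _) _; rewrite cReB cImB mulr_natl mulr2n.
rewrite /psiK cRe_sum (big_morph (@cIm R) (@cImD R) (@cIm0 R)); apply: lerD.
  rewrite (eq_bigr (fun k : 'I_K => p k * cos (X k * t))).
    by apply: trunc_int => k; exact: cos_max.
  by move=> k _; rewrite cReM cIm_ofR mul0r subr0.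
rewrite (eq_bigr (fun k : 'I_K => p k * sin (X k * t))).
  by apply: trunc_int => k; exact: sin_max.
by move=> k _; rewrite cImM cIm_ofR mul0r addr0.
Qed.

Lemma psiK_le1 K t : cabs (psiK K t) <= 1.
Proof.
apply: le_trans (cabs_sum _ _ _) _.
rewrite (eq_bigr (fun k : 'I_K => p k * 1)); last first.
  by move=> k _; rewrite cabsM cabs_cis cabs_ofR ger0_norm ?offspring_ge0.
rewrite -(mean_truncE xi (fun=> 1)) -[leRHS](mean_cst xi 1); apply: mean_le.
- by apply: (@integrable_bounded _ _ _ 1) => k; case: ifP; rewrite ?normr0 ?normr1.
- exact: integrable_cst.
by move=> k; case: ifP.
Qed.

Let wave (f : R -> Cplx R) n x t := cRe (f t ^+ n * cis (x%:R * t)).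

Lemma wave_lipschitz (f : R -> Cplx R) n x L : (forall t, cabs (f t) <= 1) ->
  (forall t s, cabs (f t - f s) <= L * `|t - s|) -> lipschitz_real (wave f n x).
Proof.
move=> f1 fL; exists (n%:R * L + 2 * x%:R) => t s.
rewrite /wave -cReB; apply: le_trans (cabs_Re _) _.
rewrite (_ : _ - _ = (f t ^+ n - f s ^+ n) * cis (x%:R * t) +
   f s ^+ n * (cis (x%:R * t) - cis (x%:R * s))); last by ring.
apply: le_trans (cabsD _ _) _; rewrite !cabsM cabs_cis mulr1 mulrDl; apply: lerD.
  apply: le_trans (cabs_subX n (f1 t) (f1 s)) _; rewrite expr1n mulr1 -mulrA.
  by rewrite ler_wpM2l.
apply: (@le_trans _ _ (1 * cabs (cis (x%:R * t) - cis (x%:R * s)))).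
  by rewrite ler_wpM2r ?cabs_ge0 // cabsX exprn_ile1 ?cabs_ge0.
rewrite mul1r; apply: le_trans (cis_lip _ _) _.
by rewrite -mulrBr normrM normr_nat mulrA.
Qed.

Lemma psi_lipschitz : exists L, forall t s, cabs (psi t - psi s) <= L * `|t - s|.
Proof.
have iX : integrable_nat xi (fun k => `|X k|) by exact: (integrable_abse (X_integrable crit)).
exists (2 * (2 * mean xi (fun k => `|X k|))) => t s.
apply: le_trans (cabs_le_ReIm _) _; rewrite cReB cImB.
have bnd k : cabs (cis (X k * t) - cis (X k * s)) <= 2 * `|t - s| * `|X k|.
  by apply: le_trans (cis_lip _ _) _; rewrite -mulrBr normrM; lra.
have ib := integrable_natZ (2 * `|t - s|) iX.
set M := mean _ _.
have -> : 2 * (2 * M) * `|t - s| = 2 * `|t - s| * M + 2 * `|t - s| * M by ring.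
rewrite -meanZ //; apply: lerD.
  rewrite /= -meanB ?norm_mean_le //; try exact: cos_integrable.
  by move=> k; apply: le_trans (bnd k); apply: le_trans (cabs_Re _); rewrite cReB.
rewrite /= -meanB ?norm_mean_le //; try exact: sin_integrable.
by move=> k; apply: le_trans (bnd k); apply: le_trans (cabs_Im _); rewrite cImB.
Qed.

Lemma psiK_lipschitz K : exists L, forall t s, cabs (psiK K t - psiK K s) <= L * `|t - s|.
Proof.
exists (\sum_(k < K) p k * (2 * `|X k|)) => t s.
rewrite /psiK -sumrB mulr_suml; apply: le_trans (cabs_sum _ _ _) _.
apply: ler_sum => k _; rewrite -mulrBr cabsM cabs_ofR ger0_norm ?offspring_ge0 // -mulrA.
rewrite ler_wpM2l ?offspring_ge0 //; apply: le_trans (cis_lip _ _) _.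
by rewrite -mulrBr normrM mulrA.
Qed.

Let wave_psi_lip n x : lipschitz_real (wave psi n x).
Proof. by have [L HL] := psi_lipschitz; exact: (wave_lipschitz n x (psi_le1 xi) HL). Qed.

Lemma psiK_poly K t : psiK K t =
  (map_poly (real_complex R) (\poly_(k < K) p k)).[cis t] * cis (- t).
Proof.
rewrite (@horner_coef_wide _ K); last by rewrite size_map_poly size_poly.
rewrite mulr_suml; apply: eq_bigr => k _.
rewrite coef_map coef_poly ltn_ord cisX -mulrA -cisD; congr (_ * cis _).
by rewrite /X; ring.
Qed.

Lemma wave_psiK K n x t : (x <= n)%N -> wave (psiK K) n x t =
  \sum_(i < size ((\poly_(k < K) p k) ^+ n)) ((\poly_(k < K) p k) ^+ n)`_i *
     cos ((i%:R - (n - x)%:R) * t).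
Proof.
move=> xn; rewrite /wave psiK_poly exprMn -horner_exp -rmorphXn -mulrA cisX -cisD.
rewrite horner_coef size_map_poly mulr_suml cRe_sum; apply: eq_bigr => i _.
rewrite coef_map cisX -mulrA -cisD cReM cRe_ofR cIm_ofR mul0r subr0; congr (_ * cos _).
by rewrite natrB //; ring.
Qed.

Lemma sym_int_wave_psiK K n x : (x <= n)%N -> (h %| n - x)%N -> (n - x < K)%N ->
  sym_int a (wave (psiK K) n x) = walk p n (n - x) * (2 * a).
Proof.
move=> xn hk kK; set Q := (\poly_(k < K) p k) ^+ n.
rewrite (_ : wave _ _ _ = fun t => \sum_(i < size Q) Q`_i *
     cos ((i%:R - (n - x)%:R) * t)); last by apply/funext => t; exact: wave_psiK.
rewrite (sym_int_cos_sum _ _ (fun i => Q`_i) (fun i => i%:R - (n - x)%:R)).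
rewrite (walk_coef p n kK) -/Q.
have z i : i <> (n - x)%N -> Q`_i * sym_int a (fun t => cos ((i%:R - (n - x)%:R) * t)) = 0.
  move=> ik; have [hi|hi] := boolP (h %| i)%N; last by rewrite coef_span ?mul0r.
  wlog : / exists2 d, (0 < d)%N & forall t, cos ((i%:R - (n - x)%:R) * t) = cos ((d * h)%:R * t) :> R.
    apply; have [/dvdnP[q eq_q] /dvdnP[r eq_r]] := (hk, hi).
    have cE (u v : nat) t : (u <= v)%N -> cos ((u%:R - v%:R) * t) = cos ((v - u)%:R * t) :> R.
      by move=> uv; rewrite natrB // -opprB mulNr cosN.
    case: (ltnP i (n - x)) => [lt|ge].
      exists (q - r)%N => [|t]; last by rewrite cE 1?ltnW // eq_q eq_r mulnBl.
      by rewrite subn_gt0; move: lt; rewrite eq_q eq_r ltn_pmul2r.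
    have {ge}lt : (n - x < i)%N by rewrite ltn_neqAle ge andbT; apply/eqP => e; exact: ik.
    exists (r - q)%N => [|t].
      by rewrite subn_gt0; move: lt; rewrite eq_q eq_r ltn_pmul2r.
    by rewrite -cosN -mulNr opprB cE 1?ltnW // eq_q eq_r mulnBl.
  move=> [d d0 dE]; under [fun t => _]eq_fun do rewrite dE.
  by rewrite sym_int_cos // mulr0.
have [kQ|kQ] := ltnP (n - x) (size Q).
  rewrite (bigD1 (Ordinal kQ)) //= big1 ?addr0; last first.
    by move=> i /eqP ik; apply: z => e; apply: ik; exact: val_inj.
  rewrite subrr (_ : (fun t => _) = fun=> 1) ?sym_int_cst ?mul1r ?ltW //.
  by apply/funext => t; rewrite mul0r cos0.
rewrite nth_default // mul0r big1 // => i _; apply: z => e.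
by have := ltn_ord i; rewrite e ltnNge kQ.
Qed.

(** All steps are multiples of [h], so the integral over one period [2 pi / h]
    suffices; the inversion is elementary for the trigonometric polynomials
    obtained by truncating [psi]. *)
Lemma walk_inversion n x : (x <= n)%N -> (h %| n - x)%N ->
  walk p n (n - x) * (2 * a) = sym_int a (wave psi n x).
Proof.
move=> xn hk; apply/eqP; rewrite -subr_eq0 -normr_le0; apply/ler_addgt0Pr => e e0.
rewrite add0r; pose D := n%:R * 2 * (2 * a) + 1 : R.
have D0 : 0 < D.
  by apply: ltr_wpDl => //; apply: mulr_ge0; apply: mulr_ge0; rewrite // ltW.
have [N HN] := mean_tail (integrable_cst xi 1) (fun k => ler01) (divr_gt0 e0 D0).
pose K := maxn N (n - x).+1.
have tK : tail K <= e / D by apply: HN; rewrite leq_maxl.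
rewrite -(@sym_int_wave_psiK K n x) ?leq_maxr //.
have [L HL] := psiK_lipschitz K.
have lK := wave_lipschitz n x (psiK_le1 K) HL.
rewrite -sym_intB //.
have t0 : 0 <= tail K by apply: mean_ge0 => k; case: ifP.
apply: (@le_trans _ _ (sym_int a (fun=> n%:R * (2 * tail K)))).
  apply: sym_int_bound.
  - have := lipschitzD lK (lipschitzZ (-1) (wave_psi_lip n x)).
    by under eq_fun do rewrite mulN1r.
  - exact: lipschitz_cst.
  move=> t _; rewrite /wave -cReB -mulrBl; apply: le_trans (cabs_Re _) _.
  rewrite cabsM cabs_cis mulr1; apply: le_trans (cabs_subX n (psiK_le1 K t) (psi_le1 xi t)) _.
  by rewrite expr1n mulr1 ler_wpM2l // cabsBC psi_truncation.
rewrite (sym_int_cst _ (ltW a0)); apply: (@le_trans _ _ (tail K * D)).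
  rewrite /D mulrDr mulr1 [leLHS](_ : _ = tail K * (n%:R * 2 * (2 * a))); last by ring.
  by rewrite lerDl.
by rewrite -ler_pdivlMr.
Qed.

(** ** Asymptotics *)

Let wave_gauss_int B c n g : 0 < c -> (0 < n)%N -> 0 <= B -> lipschitz_real g ->
  (forall t, `|t| <= a -> `|g t| <= B * expR (- (c * n%:R * t ^+ 2))) ->
  `|sym_int a g| <= B * Num.sqrt (pi / c) / Num.sqrt n%:R.
Proof.
move=> c0 n0 B0 lg H; have cn : 0 < c * n%:R by rewrite mulr_gt0 ?ltr0n.
have lG := gauss_lipschitz cn.
apply: le_trans (sym_int_bound lg (lipschitzZ B lG) H) _.
rewrite /sym_int RintegralZl //; last exact: lipschitz_integrable.
rewrite -mulrA ler_wpM2l //; apply: le_trans (gauss_le_itv a cn) _.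
by rewrite invfM mulrA sqrtrM ?sqrtrV // divr_ge0 ?pi_ge0 // ltW.
Qed.

Lemma walk_ub : exists2 C, 0 < C & forall n x, (0 < n)%N -> (x <= n)%N ->
  walk p n (n - x) <= C / Num.sqrt n%:R.
Proof.
have [c c0 Hc] := psi_gauss_bound crit h0 hc.
exists ((2 * a)^-1 * Num.sqrt (pi / c)).
  by rewrite mulr_gt0 ?sqrtr_gt0 ?divr_gt0 ?pi_gt0 // invr_gt0 mulr_gt0.
move=> n x n0 xn; have n0R : 0 < n%:R :> R by rewrite ltr0n.
have [hk|hk] := boolP (h %| n - x)%N; last first.
  rewrite walk_span // divr_ge0 ?sqrtr_ge0 // mulr_ge0 ?sqrtr_ge0 // invr_ge0.
  by rewrite mulr_ge0 // ltW.
have := walk_inversion xn hk => E.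
have -> : walk p n (n - x) = (2 * a)^-1 * sym_int a (wave psi n x).
  by rewrite -E mulrC mulfK // mulf_neq0 ?gt_eqF.
rewrite -mulrA; apply: ler_wpM2l; first by rewrite invr_ge0 mulr_ge0 // ltW.
apply: le_trans (ler_norm _) _.
have := @wave_gauss_int 1 c n _ c0 n0 ler01 (wave_psi_lip n x); rewrite mul1r; apply.
move=> t ta; rewrite mul1r; apply: le_trans (cabs_Re _) _.
rewrite cabsM cabs_cis mulr1 cabsX (_ : expR _ = expR (- (c * t ^+ 2)) ^+ n); last first.
  by rewrite -expRM_natl; congr expR; ring.
by rewrite lerXn2r ?nnegrE ?cabs_ge0 ?expR_ge0 // Hc.
Qed.

Let id_le_sqr1 (y : R) : 0 <= y -> Num.sqrt y <= 1 + y.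
Proof.
move=> y0; have := sqr_ge0 (Num.sqrt y - 1); have := sqrtr_ge0 y.
by rewrite sqrrB1 sqr_sqrtr //; lra.
Qed.

Let absorb_t c n (t : R) : 0 < c -> (0 < n)%N ->
  `|t| * expR (- (c * n%:R * t ^+ 2)) <= (1 + c^-1) / Num.sqrt n%:R.
Proof.
move=> c0 n0; have n0R : 0 < n%:R :> R by rewrite ltr0n.
have sn : 0 < Num.sqrt n%:R :> R by rewrite sqrtr_gt0.
rewrite ler_pdivlMr // mulrAC.
have -> : `|t| * Num.sqrt n%:R = Num.sqrt (n%:R * t ^+ 2).
  by rewrite sqrtrM ?sqrtr_sqr 1?mulrC // ltW.
have y0 : 0 <= n%:R * t ^+ 2 by apply: mulr_ge0; rewrite ?sqr_ge0.
rewrite -mulrA; set y := n%:R * t ^+ 2 in y0 *.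
have e1 : expR (- (c * y)) <= 1 by rewrite -expR0 ler_expR oppr_le0 mulr_ge0 // ltW.
apply: (@le_trans _ _ ((1 + y) * expR (- (c * y)))).
  by rewrite ler_wpM2r ?expR_ge0 // id_le_sqr1.
by rewrite mulrDl mul1r lerD // absorb.
Qed.

Let absorb_t2 c n (t : R) : 0 < c ->
  n%:R * t ^+ 2 * expR (- (c * n%:R * t ^+ 2)) <= c^-1.
Proof. by move=> c0; rewrite -[c * _ * _]mulrA absorb. Qed.

(** Two returns whose lengths differ by [d] differ by [d / n^(3/2)], up to the
    shift of the end point, which costs [1 / n]. *)
Lemma walk_diff : exists2 C, 0 < C & forall n d x y, (0 < n)%N ->
  (x <= 1)%N -> (y <= 1)%N -> (h %| n - x)%N -> (h %| n + d - y)%N ->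
  `|walk p n (n - x) - walk p (n + d) (n + d - y)| <=
    C * (d%:R / (n%:R * Num.sqrt n%:R) + n%:R^-1).
Proof.
have [c c0 Hc] := psi_gauss_bound crit h0 hc.
have c20 : 0 < c / 2 by rewrite divr_gt0.
have i0 : 0 < (c / 2)^-1 by rewrite invr_gt0.
pose K1 := 3 * sigma ^+ 2 * (c / 2)^-1; pose K2 := 4 * (1 + (c / 2)^-1).
have s2 : 0 < sigma ^+ 2 by rewrite exprn_gt0 // (sigma_gt0 crit).
have K10 : 0 < K1 by rewrite /K1 mulr_gt0 // mulr_gt0.
have K20 : 0 < K2 by rewrite mulr_gt0 // addr_gt0.
have sp : 0 < Num.sqrt (pi / (c / 2)) by rewrite sqrtr_gt0 divr_gt0 ?pi_gt0.
have a2 : 0 < 2 * a by rewrite mulr_gt0.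
exists ((2 * a)^-1 * Num.sqrt (pi / (c / 2)) * (K1 + K2)).
  by apply: mulr_gt0; [rewrite mulr_gt0 ?invr_gt0|exact: addr_gt0].
move=> n d x y n0 x1 y1 hx hy.
have n0R : 0 < n%:R :> R by rewrite ltr0n.
have sn : 0 < Num.sqrt n%:R :> R by rewrite sqrtr_gt0.
have inv m z : (z <= m)%N -> (h %| m - z)%N ->
    walk p m (m - z) = (2 * a)^-1 * sym_int a (wave psi m z).
  by move=> zm hz; rewrite -(walk_inversion zm hz) mulrC mulfK // gt_eqF.
rewrite (inv n x) ?(inv (n + d)%N y) ?(leq_trans x1) ?(leq_trans y1) ?addn_gt0 ?n0 //.
rewrite -mulrBr normrM ger0_norm; last by rewrite invr_ge0 ltW.
rewrite -!mulrA; apply: ler_wpM2l; first by rewrite invr_ge0 ltW.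
rewrite -sym_intB //.
have lw : lipschitz_real (fun t => wave psi n x t - wave psi (n + d) y t).
  have := lipschitzD (wave_psi_lip n x) (lipschitzZ (-1) (wave_psi_lip (n + d) y)).
  by under eq_fun do rewrite mulN1r.
pose B := K1 * (d%:R / n%:R) + K2 / Num.sqrt n%:R.
have B0 : 0 <= B.
  apply: addr_ge0; first by apply: mulr_ge0; [exact: ltW|exact: divr_ge0].
  by apply: divr_ge0; [exact: ltW|exact: sqrtr_ge0].
apply: le_trans (@wave_gauss_int B (c / 2) n _ c20 n0 B0 lw _) _; last first.
  have ss : Num.sqrt n%:R * Num.sqrt n%:R = n%:R :> R by rewrite -expr2 sqr_sqrtr // ltW.
  rewrite -mulrA mulrCA; apply: ler_wpM2l; first exact: ltW.
  rewrite /B.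
  rewrite mulrDl -[K2 / _ / _]mulrA -invfM ss -mulrA -[d%:R / _ / _]mulrA -invfM.
  rewrite mulrDr !mulrDl.
  have q1 : 0 <= K2 * (d%:R / (n%:R * Num.sqrt n%:R)).
    apply: mulr_ge0; first exact: ltW.
    by apply: divr_ge0 => //; apply: mulr_ge0; exact: ltW.
  have q2 : 0 <= K1 / n%:R by rewrite divr_ge0 // ltW.
  by lra.
move=> t ta; rewrite /wave -cReB; apply: le_trans (cabs_Re _) _.
have -> : psi t ^+ n * cis (x%:R * t) - psi t ^+ (n + d) * cis (y%:R * t) =
   psi t ^+ n * (cis (x%:R * t) * (1 ^+ d - psi t ^+ d) +
      psi t ^+ d * ((cis (x%:R * t) - 1) - (cis (y%:R * t) - 1))).
  by rewrite exprD expr1n; ring.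
have E1 : cabs (psi t ^+ n) <= expR (- (c / 2 * n%:R * t ^+ 2)) * expR (- (c / 2 * n%:R * t ^+ 2)).
  rewrite -expRD (_ : _ + _ = n%:R * - (c * t ^+ 2)); last by field.
  by rewrite expRM_natl cabsX lerXn2r ?nnegrE ?cabs_ge0 ?expR_ge0 // Hc.
have small z : (z <= 1)%N -> cabs (cis (z%:R * t) - 1) <= 2 * `|t|.
  case: z => [|[|//]] _; last by rewrite mul1r cis_sub1.
  by rewrite mul0r cis0 subrr cabs0 mulr_ge0.
have E2 : cabs (cis (x%:R * t) * (1 ^+ d - psi t ^+ d) +
      psi t ^+ d * ((cis (x%:R * t) - 1) - (cis (y%:R * t) - 1))) <=
    d%:R * (3 * sigma ^+ 2 * t ^+ 2) + 4 * `|t|.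
  apply: le_trans (cabsD _ _) _; rewrite !cabsM cabs_cis mul1r; apply: lerD.
    have one1 : cabs (1 : Cplx R) <= 1 by rewrite cabs1.
    apply: le_trans (cabs_subX d one1 (psi_le1 xi t)) _.
    by rewrite expr1n mulr1 ler_wpM2l // cabsBC (psi_quad crit).
  apply: (@le_trans _ _ (1 * cabs ((cis (x%:R * t) - 1) - (cis (y%:R * t) - 1)))).
    by rewrite ler_wpM2r ?cabs_ge0 // cabsX exprn_ile1 ?cabs_ge0 // (psi_le1 xi).
  rewrite mul1r; apply: le_trans (cabsB _ _) _.
  by have := small x x1; have := small y y1; lra.
rewrite cabsM; apply: le_trans (ler_pM (cabs_ge0 _) (cabs_ge0 _) E1 E2) _.
set E := expR _; have E0 : 0 <= E by exact: expR_ge0.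
rewrite mulrAC ler_wpM2r // mulrC mulrDl; apply: lerD.
  rewrite [leLHS](_ : _ = 3 * sigma ^+ 2 * (d%:R / n%:R) * (n%:R * t ^+ 2 * E)); last first.
    by field; lra.
  rewrite [leRHS](_ : _ = 3 * sigma ^+ 2 * (d%:R / n%:R) * (c / 2)^-1); last by rewrite /K1; ring.
  apply: ler_wpM2l; last exact: absorb_t2.
  by apply: mulr_ge0; [apply: mulr_ge0 => //; exact: ltW|exact: divr_ge0].
by rewrite -mulrA /K2 -mulrA ler_wpM2l // absorb_t.
Qed.

Lemma walk_lim e : 0 < e -> exists N, forall n x, (N <= n)%N -> (x <= 1)%N ->
  (h %| n - x)%N ->
  `|Num.sqrt n%:R * walk p n (n - x) - h%:R / (sigma * Num.sqrt (2 * pi))| <= e.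
Proof.
move=> e0; have s0 := sigma_gt0 crit.
have [c c0 Hc0] := psi_gauss_bound crit h0 hc.
pose s2 := sigma ^+ 2 / 2; have s20 : 0 < s2 by rewrite divr_gt0 // exprn_gt0.
pose m := Num.min c s2; have m0 : 0 < m by rewrite lt_min c0.
have Hpsi t : `|t| <= a -> cabs (psi t) <= expR (- (m * t ^+ 2)).
  move=> ta; apply: le_trans (Hc0 t ta) _; rewrite ler_expR lerN2 ler_wpM2r ?sqr_ge0 //.
  by rewrite ge_min lexx.
have HG t : cabs (ofR (expR (- (s2 * t ^+ 2)))) <= expR (- (m * t ^+ 2)).
  rewrite cabs_ofR ger0_norm ?expR_ge0 // ler_expR lerN2 ler_wpM2r ?sqr_ge0 //.
  by rewrite ge_min lexx orbT.
have m80 : 0 < m / 8 by rewrite divr_gt0.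
have m40 : 0 < m / 4 by rewrite divr_gt0.
have i8 : 0 < (m / 8)^-1 by rewrite invr_gt0.
have a2 : 0 < 2 * a by rewrite mulr_gt0.
pose G := Num.sqrt (pi / (m / 4)); have G0 : 0 < G by rewrite sqrtr_gt0 divr_gt0 ?pi_gt0.
pose e1 := e / 3 * (2 * a) / G / (m / 8)^-1.
have e10 : 0 < e1 by rewrite !divr_gt0 // mulr_gt0 // divr_gt0.
have [C C0 HC] := psi_gauss crit e10.
pose K := C * ((m / 8)^-1 * (1 + (m / 8)^-1)) + 2 * (1 + (m / 8)^-1).
have K0 : 0 < K.
  apply: ltr_wpDl; last by rewrite mulr_gt0 // addr_gt0.
  by apply: mulr_ge0 => //; apply: mulr_ge0; apply: ltW => //; exact: addr_gt0.
pose T := 2 / (s2 * a ^+ 2) * Num.sqrt (pi / (s2 / 2)).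
have T0 : 0 < T by rewrite mulr_gt0 ?sqrtr_gt0 ?divr_gt0 ?pi_gt0 // mulr_gt0 ?exprn_gt0.
pose M := (K * G + T) / (2 * a) / (e / 3).
have M0 : 0 < M by rewrite !divr_gt0 // addr_gt0 // mulr_gt0.
have [N MN] : exists N, M ^+ 2 + 2 <= N%:R.
  exists (Num.bound (M ^+ 2 + 2)); apply/ltW.
  by apply: archi_boundP; rewrite addr_ge0 // sqr_ge0.
exists N => n x Nn x1 hx.
have nM : M ^+ 2 + 2 <= n%:R by apply: le_trans MN _; rewrite ler_nat.
have n2 : (2 <= n)%N.
  by rewrite -(ler_nat R); apply: le_trans nM; rewrite lerDr sqr_ge0.
have n0 : (0 < n)%N by exact: leq_trans n2.
have n0R : 0 < n%:R :> R by rewrite ltr0n.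
have sn : 0 < Num.sqrt n%:R :> R by rewrite sqrtr_gt0.
have snM : M <= Num.sqrt n%:R.
  rewrite -[M](ger0_norm (ltW M0)) -sqrtr_sqr ler_sqrt ?(ltW n0R) //.
  by apply: le_trans nM; rewrite lerDl.
have -> : walk p n (n - x) = (2 * a)^-1 * sym_int a (wave psi n x).
  rewrite -(walk_inversion _ hx) 1?mulrC ?mulfK //; first by rewrite gt_eqF.
  by rewrite (leq_trans x1).
have s2n : 0 < s2 * n%:R by rewrite mulr_gt0.
pose gs (t : R) := expR (- (s2 * n%:R * t ^+ 2)).
have lgs : lipschitz_real gs by exact: gauss_lipschitz.
have lw : lipschitz_real (fun t => wave psi n x t - gs t).
  have := lipschitzD (wave_psi_lip n x) (lipschitzZ (-1) lgs).
  by under eq_fun do rewrite mulN1r.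
(* By [psi_gauss] the integrands differ by [n (e1 t^2 + C |t|^3)] times a
   Gaussian; half of its exponent absorbs the powers of [t]. *)
pose B := e1 * (m / 8)^-1 + K / Num.sqrt n%:R.
have B0 : 0 <= B.
  apply: addr_ge0; first by apply: mulr_ge0; exact: ltW.
  by apply: divr_ge0; [exact: ltW|exact: sqrtr_ge0].
have D1 : `|sym_int a (wave psi n x) - sym_int a gs| <= B * G / Num.sqrt n%:R.
  rewrite -sym_intB //; apply: (@wave_gauss_int B (m / 4)) => // t ta.
  set E4 := expR _.
  have tpi : `|t| <= pi.
    apply: le_trans ta _; rewrite /a ler_pdivrMr // ler_peMr ?pi_ge0 //.
    by rewrite (ler_nat R 1 h).
  have E8 : expR (- (m / 2 * n%:R * t ^+ 2)) =
      expR (- (m / 8 * n%:R * t ^+ 2)) * expR (- (m / 8 * n%:R * t ^+ 2)) * E4.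
    by rewrite /E4 -!expRD; congr expR; field.
  set F := expR (- (m / 8 * n%:R * t ^+ 2)) in E8.
  have F0 : 0 <= F by exact: expR_ge0.
  have F1 : F <= 1.
    rewrite -expR0 ler_expR oppr_le0; apply: mulr_ge0; last exact: sqr_ge0.
    by rewrite mulr_ge0 // ltW.
  have E40 : 0 <= E4 by exact: expR_ge0.
  have At2 : n%:R * t ^+ 2 * F <= (m / 8)^-1 by exact: absorb_t2.
  have At : `|t| * F <= (1 + (m / 8)^-1) / Num.sqrt n%:R by exact: absorb_t.
  rewrite (_ : wave psi n x t - gs t =
      cRe (psi t ^+ n * (cis (x%:R * t) - 1) + (psi t ^+ n - ofR (expR (- (s2 * t ^+ 2))) ^+ n))); last first.
    rewrite /wave [in RHS](_ : _ + _ = psi t ^+ n * cis (x%:R * t) - ofR (gs t)); first by rewrite cReB.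
    rewrite (_ : ofR (gs t) = ofR (expR (- (s2 * t ^+ 2))) ^+ n); first by ring.
    rewrite -(rmorphXn (real_complex R)) -expRM_natl; congr (ofR (expR _)); ring.
  apply: le_trans (cabs_Re _) _; apply: le_trans (cabsD _ _) _.
  have W1 : cabs (psi t ^+ n * (cis (x%:R * t) - 1)) <= 2 * (1 + (m / 8)^-1) / Num.sqrt n%:R * E4.
    rewrite cabsM cabsX.
    have P : cabs (psi t) ^+ n <= F * E4.
      apply: (@le_trans _ _ (expR (- (m / 2 * n%:R * t ^+ 2)))).
        apply: (@le_trans _ _ (expR (- (m * t ^+ 2)) ^+ n)).
          by rewrite lerXn2r ?nnegrE ?cabs_ge0 ?expR_ge0 // Hpsi.
        rewrite -expRM_natl ler_expR.
        have : 0 <= m * n%:R * t ^+ 2 by apply: mulr_ge0; rewrite ?sqr_ge0 // mulr_ge0 // ltW.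
        by lra.
      by rewrite E8 ler_wpM2r // ler_piMr.
    have Q : cabs (cis (x%:R * t) - 1) <= 2 * `|t|.
      case: x x1 {hx lw} => [|[|//]] _; last by rewrite mul1r cis_sub1.
      by rewrite mul0r cis0 subrr cabs0 mulr_ge0.
    apply: le_trans (ler_pM _ (cabs_ge0 _) P Q) _; first by rewrite exprn_ge0 ?cabs_ge0.
    rewrite [leLHS](_ : _ = 2 * (`|t| * F) * E4); last by ring.
    by rewrite ler_wpM2r // -mulrA ler_wpM2l.
  have W2 : cabs (psi t ^+ n - ofR (expR (- (s2 * t ^+ 2))) ^+ n) <=
      (e1 * (m / 8)^-1 + C * ((m / 8)^-1 * (1 + (m / 8)^-1)) / Num.sqrt n%:R) * E4.
    apply: le_trans (cabs_subX n (Hpsi t ta) (HG t)) _.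
    have Q : expR (- (m * t ^+ 2)) ^+ n.-1 <= F * F * E4.
      rewrite -E8 -expRM_natl ler_expR -subn1 natrB //.
      have : 0 <= m * t ^+ 2 by apply: mulr_ge0; rewrite ?sqr_ge0 // ltW.
      have : 2 <= n%:R :> R by rewrite (ler_nat R 2).
      by nra.
    have H := HC t tpi; rewrite -/s2 in H.
    apply: (@le_trans _ _ (n%:R * (e1 * t ^+ 2 + C * `|t| ^+ 3) * (F * F * E4))).
      have q0 : 0 <= expR (- (m * t ^+ 2)) ^+ n.-1 by rewrite exprn_ge0 // expR_ge0.
      apply: ler_pM q0 _ Q; first by rewrite mulr_ge0 ?cabs_ge0.
      by rewrite ler_wpM2l.
    rewrite mulrA ler_wpM2r //.
    rewrite (_ : `|t| ^+ 3 = t ^+ 2 * `|t|); last by rewrite exprSr real_normK ?num_real.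
    rewrite [leLHS](_ : _ = e1 * ((n%:R * t ^+ 2 * F) * F) + C * ((n%:R * t ^+ 2 * F) * (`|t| * F))); last by ring.
    have y0 : 0 <= n%:R * t ^+ 2 * F.
      by apply: mulr_ge0 => //; apply: mulr_ge0; rewrite ?sqr_ge0.
    apply: lerD; first by apply: ler_wpM2l; [exact: ltW|rewrite -[leRHS]mulr1 ler_pM].
    rewrite -[leRHS]mulrA; apply: ler_wpM2l => //.
    by rewrite -[leRHS]mulrA; apply: ler_pM => //; apply: mulr_ge0.
  by apply: le_trans (lerD W1 W2) _; rewrite -mulrDl ler_wpM2r // /B /K; lra.
(* The part of the Gaussian outside of the period is of smaller order. *)
have Gs : `|sym_int a gs - Num.sqrt (pi / (s2 * n%:R))| <= T / (n%:R * Num.sqrt n%:R).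
  have h1 := gauss_le_itv a s2n; have h2 := gauss_ge_itv a0 s2n.
  rewrite distrC ger0_norm ?subr_ge0 //.
  have -> : T / (n%:R * Num.sqrt n%:R) =
      2 / (s2 * n%:R * a ^+ 2) * Num.sqrt (pi / (s2 * n%:R / 2)).
    rewrite [pi / (s2 * n%:R / 2)](_ : _ = (pi / (s2 / 2)) / n%:R); last by field; rewrite !gt_eqF.
    rewrite sqrtrM; last by rewrite divr_ge0 ?pi_ge0 // ltW // divr_gt0.
    by rewrite sqrtrV ?ltW // /T; field; rewrite !gt_eqF.
  by rewrite /gs; lra.
have lim : Num.sqrt n%:R * ((2 * a)^-1 * Num.sqrt (pi / (s2 * n%:R))) = h%:R / (sigma * Num.sqrt (2 * pi)).
  have -> : pi / (s2 * n%:R) = (2 * pi) / (sigma ^+ 2) / n%:R.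
    by rewrite /s2; field; rewrite !gt_eqF.
  rewrite sqrtrM; last by rewrite divr_ge0 ?sqr_ge0 // mulr_ge0 ?pi_ge0.
  rewrite [X in X * Num.sqrt _]sqrtrM; last by rewrite mulr_ge0 ?pi_ge0.
  rewrite !sqrtrV ?sqr_ge0 ?(ltW n0R) // sqrtr_sqr (gtr0_norm s0).
  have pp : 0 < 2 * pi :> R by rewrite mulr_gt0 ?pi_gt0.
  have q0 : 0 < Num.sqrt (2 * pi) :> R by rewrite sqrtr_gt0.
  have -> : 2 * a = Num.sqrt (2 * pi) ^+ 2 / h%:R by rewrite sqr_sqrtr ?(ltW pp) // /a mulrA.
  by field; rewrite !gt_eqF.
rewrite -lim -mulrBr -mulrBr normrM (gtr0_norm sn) normrM [`|(2 * a)^-1|]gtr0_norm ?invr_gt0 //.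
apply: (@le_trans _ _ (Num.sqrt n%:R * ((2 * a)^-1 * (B * G / Num.sqrt n%:R + T / (n%:R * Num.sqrt n%:R))))).
  apply: ler_wpM2l; first exact: ltW.
  apply: ler_wpM2l; first by rewrite invr_ge0 ltW.
  by apply: le_trans (lerD D1 Gs); exact: ler_distD.
have -> : Num.sqrt n%:R * ((2 * a)^-1 * (B * G / Num.sqrt n%:R + T / (n%:R * Num.sqrt n%:R))) =
   (2 * a)^-1 * (B * G + T / n%:R) by field; rewrite !gt_eqF.
have Tn : T / n%:R <= T / Num.sqrt n%:R.
  rewrite ler_pM2l // lef_pV2 ?posrE //.
  have : 1 <= Num.sqrt n%:R :> R by rewrite -[leLHS]sqrtr1 ler_sqrt ?(ltW n0R) // (ler_nat R 1).
  have : Num.sqrt n%:R ^+ 2 = n%:R :> R by rewrite sqr_sqrtr // ltW.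
  by nra.
rewrite mulrC ler_pdivrMr //.
have E1 : e1 * (m / 8)^-1 * G = e / 3 * (2 * a).
  by rewrite /e1; field; rewrite !gt_eqF.
have E2 : (K * G + T) / Num.sqrt n%:R <= e / 3 * (2 * a).
  rewrite ler_pdivrMr //; move: snM; rewrite /M ler_pdivrMr ?divr_gt0 // ler_pdivrMr //.
  by move=> hh; apply: le_trans hh _; rewrite le_eqVlt; apply/orP; left; apply/eqP; ring.
rewrite /B mulrDl E1; move: E2; rewrite mulrDl.
have : 0 < e / 3 * (2 * a) by rewrite mulr_gt0 // divr_gt0.
have -> : e * (2 * a) = 3 * (e / 3 * (2 * a)) by field.
have -> : K / Num.sqrt n%:R * G = K * G / Num.sqrt n%:R by ring.
by lra.
Qed.

End LocalLimit.

(** * The central binomial coefficients *)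

Section Wallis.
Variable R : realType.

(** Two fair coin tosses, as an offspring law: its walk returns to [n] with
    probability [binom(2n, n) / 4^n], and the local limit theorem for it is
    Wallis's formula. *)
Definition coin2 : probability nat R := binomial_prob 2 2^-1.

Let half0 : 0 <= 2^-1 :> R. Proof. by rewrite invr_ge0. Qed.
Let half1 : (NngNum half0)%:num <= 1 :> R.
Proof. by rewrite /= invf_le1 // ler1n. Qed.

Lemma coin2_integral (f : nat -> R) : (forall k, 0 <= f k) ->
  (\int[coin2]_k (f k)%:E)%E = (f 0%N / 4 + f 1%N / 2 + f 2%N / 4)%:E.
Proof.
move=> f0; rewrite (integral_binomial _ half1); last by move=> k; rewrite lee_fin.
rewrite !big_ord_recl big_ord0 adde0 -!EFinM -!EFinD; congr EFin.
by rewrite /bin_prob /= !(bin0, bin1, binn) !(expr0, expr1, expr2) /bump /= /unstable.onem; field.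
Qed.

Lemma coin2E k : offspring coin2 k =
  (k == 0%N)%:R / 4 + (k == 1%N)%:R / 2 + (k == 2%N)%:R / 4.
Proof.
rewrite /offspring; have -> : coin2 [set k] = (\int[coin2]_j (\1_[set k] j)%:E)%E.
  by rewrite integral_indic // setIT.
rewrite coin2_integral; last by move=> j; rewrite indicE.
have e j : \1_[set k] j = (k == j)%:R :> R.
  by rewrite indicE; congr ((nat_of_bool _)%:R); apply/idP/idP => [/set_mem /= ->|/eqP ->]; rewrite ?mem_set.
by rewrite /= !e.
Qed.

Lemma coin2_critical : critical coin2 (Num.sqrt 2)^-1.
Proof.
have E1 : expectation coin2 (fun k : nat => k%:R) = 1%:E.
  by rewrite unlock coin2_integral // mul0r; congr EFin; field.
split; [exact: E1|by rewrite invr_gt0 sqrtr_gt0|].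
rewrite /variance unlock E1 /= unlock.
rewrite (_ : (\int[coin2]_x _)%E = (\int[coin2]_x ((x%:R - 1) ^+ 2)%:E)%E); last first.
  by apply: eq_integral => k _ /=; rewrite expr2.
rewrite coin2_integral; last by move=> k; exact: sqr_ge0.
by rewrite exprVn sqr_sqrtr //; congr EFin; field.
Qed.

Definition central (n : nat) : R := \prod_(i < n) ((2^-1 + i%:R) / i.+1%:R).

Lemma central_bin n : central n = 'C(n.*2, n)%:R / 4 ^+ n.
Proof.
rewrite /central; elim: n => [|n IH]; first by rewrite big_ord0 bin0 expr0 divr1.
rewrite big_ord_recr /= IH doubleS.
have e1 : (n.+1 * (n.+1 * 'C(n.*2.+2, n.+1)) = n.*2.+2 * (n.*2.+1 * 'C(n.*2, n)))%N.
  rewrite -mul_bin_diag mulnCA; congr (_ * _)%N.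
  have bs : 'C(n.*2.+1, n) = 'C(n.*2.+1, n.+1).
    by rewrite -(@bin_sub n.*2.+1 n.+1); [congr ('C(_, _))|]; lia.
  by rewrite bs; exact: esym (mul_bin_diag n.*2.+1 n).
have e2 : n.+1%:R * (n.+1%:R * 'C(n.*2.+2, n.+1)%:R) = n.*2.+2%:R * (n.*2.+1%:R * 'C(n.*2, n)%:R) :> R.
  by rewrite -!natrM e1.
have n1 : n.+1%:R != 0 :> R by rewrite pnatr_eq0.
have -> : 'C(n.*2.+2, n.+1)%:R = n.*2.+2%:R * (n.*2.+1%:R * 'C(n.*2, n)%:R) / n.+1%:R / n.+1%:R :> R.
  by rewrite -e2; field.
have q4 : 4 ^+ n != 0 :> R by rewrite expf_neq0 // pnatr_eq0.
have -> : n.*2.+2%:R = 2 * n.+1%:R :> R by rewrite -natrM mul2n.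
have -> : n.*2.+1%:R = 2 * n%:R + 1 :> R by rewrite -natr1 -mul2n natrM.
by rewrite exprS; field; rewrite q4 nat1r.
Qed.

Lemma coef_binomial m k : ((1 + 'X : {poly R}) ^+ m)`_k = 'C(m, k)%:R.
Proof.
rewrite exprDn coef_sum.
under eq_bigr do rewrite expr1n mul1r coefMn coefXn.
have [km|km] := leqP k m.
  rewrite (bigD1 (Ordinal (_ : k < m.+1)%N)) //= eqxx big1 ?addr0 // => i ik.
  rewrite (_ : (k == i) = false) ?mul0rn //.
  by apply/negP => /eqP e; move: ik; rewrite -val_eqE /= e eqxx.
rewrite bin_small // big1 // => i _.
by rewrite (_ : (k == i) = false) ?mul0rn //; apply/negP => /eqP e; have := ltn_ord i; lia.
Qed.

Lemma coin2_walk n : walk (offspring coin2) n n = central n.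
Proof.
rewrite (@walk_coef _ _ _ (n + 3)%N); last by lia.
have -> : \poly_(i < n + 3) offspring coin2 i = 4^-1 *: (1 + 'X) ^+ 2.
  apply/polyP => i; rewrite coef_poly coefZ coef_binomial coin2E.
  case: ifP => [_|].
    by case: i => [|[|[|i]]] /=; rewrite ?(bin0, bin1, binn) ?bin_small //; field.
  by move=> h; rewrite bin_small ?mulr0 //; lia.
rewrite exprZn coefZ -exprM coef_binomial central_bin mul2n mulrC.
by rewrite exprVn.
Qed.

End Wallis.

(** * Limits of complex sequences *)

Section ComplexLimits.
Variable R : realType.
Implicit Types (u v : nat -> Cplx R) (l : Cplx R).

Definition climit u l := forall e : R, 0 < e ->
  exists N, forall n, (N <= n)%N -> cabs (u n - l) <= e.

Lemma Cplx_gt0 (e : Cplx R) : 0 < e -> exists2 r : R, 0 < r & e = ofR r.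
Proof.
case: e => a b; rewrite ltcE /= => /andP[/eqP -> a0]; by exists a.
Qed.

Lemma climitP u l : climit u l <-> u n @[n --> \oo] --> l.
Proof.
split => [H|/cvgrPdist_le H e e0].
  apply/cvgrPdist_le => e /Cplx_gt0 [r r0 ->]; have [N HN] := H r r0.
  by exists N => // n /= Nn; rewrite normr_cabs ofR_le cabsBC HN.
have [|N _ HN] := H (ofR e); first by rewrite -[0]/(ofR 0) ofR_lt.
by exists N => n Nn; have := HN n Nn; rewrite normr_cabs ofR_le cabsBC.
Qed.

Lemma climit_lim u l : climit u l -> lim (u @ \oo) = l.
Proof. by move=> /climitP; apply: cvg_lim; exact: norm_hausdorff. Qed.

Lemma climit_unique u l l' : climit u l -> climit u l' -> l = l'.
Proof. by move=> /climit_lim <- /climit_lim. Qed.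

Lemma cauchy_climit u (K : nat -> R) :
  (forall e, 0 < e -> exists N, forall n, (N <= n)%N -> K n <= e) ->
  (forall j k, (j <= k)%N -> cabs (u k - u j) <= K j) ->
  exists2 l, climit u l & forall j, cabs (u j - l) <= 2 * K j.
Proof.
move=> K0 HK.
have cvgf (f : Cplx R -> R) : (forall z w, f (z - w) = f z - f w) ->
    (forall z, `|f z| <= cabs z) ->
    exists2 l : R, True & forall j, `|f (u j) - l| <= K j.
  move=> fB fabs.
  have fj j k : (j <= k)%N -> `|f (u k) - f (u j)| <= K j.
    by move=> jk; rewrite -fB; apply: le_trans (fabs _) _; exact: HK.
  have cf : cvgn (f \o u).
    apply/cauchy_cvgP; apply/cauchy_exP => e e0.
    have e20 : 0 < e / 2 by rewrite divr_gt0.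
    have [N HN] := K0 _ e20; exists (f (u N)); exists N => // n /= Nn.
    rewrite /ball /= distrC; apply: le_lt_trans (fj N n Nn) _.
    by apply: le_lt_trans (HN N (leqnn _)) _; rewrite ltr_pdivrMr // ltr_pMr // ltr1n.
  exists (limn (f \o u)) => // j; rewrite distrC.
  have cc : `|(f \o u) k - f (u j)| @[k --> \oo] --> `|limn (f \o u) - f (u j)|.
    by apply: cvg_norm; apply: cvgB => //; exact: cvg_cst.
  apply: (closed_cvg (fun x : R => x <= K j) _ _ _ cc); first exact: closed_le.
  by exists j => // k /= jk; exact: fj.
have [a _ Ha] := cvgf (@cRe R) (@cReB R) (@cabs_Re R).
have [b _ Hb] := cvgf (@cIm R) (@cImB R) (@cabs_Im R).
have H j : cabs (u j - Complex a b) <= 2 * K j.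
  apply: le_trans (cabs_le_ReIm _) _; rewrite cReB cImB.
  by have := Ha j; have := Hb j; rewrite /=; lra.
exists (Complex a b) => // e e0.
have [N HN] := K0 _ (divr_gt0 e0 (@ltr0n R 2)).
by exists N => n Nn; have := H n; have := HN n Nn; lra.
Qed.

Lemma climit_le u v l l' (B : R) : climit u l -> climit v l' ->
  (exists N, forall n, (N <= n)%N -> cabs (u n - v n) <= B) -> cabs (l - l') <= B.
Proof.
move=> ul vl [N HN]; apply/ler_addgt0Pr => e e0.
have [N1 H1] := ul _ (divr_gt0 e0 (@ltr0n R 2)).
have [N2 H2] := vl _ (divr_gt0 e0 (@ltr0n R 2)).
pose n := maxn N (maxn N1 N2).
have := HN n (leq_maxl _ _).
have := H1 n (leq_trans (leq_maxl N1 N2) (leq_maxr _ _)).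
have := H2 n (leq_trans (leq_maxr N1 N2) (leq_maxr _ _)).
rewrite (_ : l - l' = - (u n - l) + ((u n - v n) + (v n - l'))); last by ring.
have := cabsD (- (u n - l)) ((u n - v n) + (v n - l')); rewrite cabsN.
by have := cabsD (u n - v n) (v n - l'); lra.
Qed.

Lemma climit_cst l : climit (fun=> l) l.
Proof. by move=> e e0; exists 0%N => n _; rewrite subrr cabs0 ltW. Qed.

Lemma nat_inv_small (e : R) : 0 < e -> exists N : nat, forall n, (N <= n)%N -> n.+1%:R^-1 <= e.
Proof.
move=> e0; exists (Num.bound e^-1) => n Nn.
rewrite -[e]invrK lef_pV2 ?posrE ?invr_gt0 ?ltr0n //.
apply: ltW; apply: lt_le_trans (archi_boundP _) _; first by rewrite invr_ge0 ltW.
by rewrite ler_nat leqW.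
Qed.

Lemma climit_rate u l (K : R) : (forall j, cabs (u j - l) <= K / j.+1%:R) -> climit u l.
Proof.
move=> H e e0; have K1 : 0 < `|K| + 1 by have := normr_ge0 K; lra.
have [N HN] := nat_inv_small (divr_gt0 e0 K1); exists N => n Nn.
apply: le_trans (H n) _; apply: (@le_trans _ _ ((`|K| + 1) / n.+1%:R)).
  by rewrite ler_wpM2r ?invr_ge0 //; have := ler_norm K; lra.
by have := HN n Nn; rewrite ler_pdivlMr // mulrC.
Qed.

(** ** The exponential near the origin *)

Lemma expR_sub1_le (x : R) : `|expR x - 1| <= `|x| * expR `|x|.
Proof.
have H (y : R) : 0 <= y -> expR y - 1 <= y * expR y.
  move=> y0; have := expR_ge1Dx (- y); rewrite expRN => h.
  have e0 := expR_gt0 y.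
  have : expR y * (1 - y) <= 1 by rewrite mulrC -ler_pdivlMr // div1r.
  by lra.
case: (leP 0 x) => x0.
  by rewrite !ger0_norm ?H // subr_ge0 -expR0 ler_expR.
rewrite (ltr0_norm x0) ler0_norm; last by rewrite subr_le0 -[leRHS]expR0 ler_expR ltW.
have := expR_ge1Dx x; have : 1 <= expR (- x) by rewrite -[leLHS]expR0 ler_expR oppr_ge0 ltW.
by nra.
Qed.

Lemma expR_sub1x_le (x : R) : `|expR x - 1 - x| <= x ^+ 2 * expR `|x|.
Proof.
have lo := expR_ge1Dx x; rewrite ger0_norm; last by lra.
case: (leP 0 x) => x0.
  rewrite (ger0_norm x0); have := expR_sub1_le x.
  rewrite (ger0_norm x0) ger0_norm; last by rewrite subr_ge0 -expR0 ler_expR.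
  have := expR_ge1Dx (- x); rewrite expRN => h e1.
  have e0 := expR_gt0 x.
  have : x * (expR x - 1) <= x * (x * expR x) by rewrite ler_wpM2l.
  have : expR x * (1 - x) <= 1 by rewrite mulrC -ler_pdivlMr // div1r.
  by rewrite expr2; lra.
have x0' : 0 <= - x by rewrite oppr_ge0 ltW.
have /andP[_] := expR_quad x0'; rewrite opprK sqrrN => h; apply: le_trans h _.
by rewrite ler_peMr ?sqr_ge0 // -[leLHS]expR0 ler_expR.
Qed.

Lemma cexp_quad (w : Cplx R) : cabs (cexp w - 1 - w) <= 4 * expR (cabs w) * cabs w ^+ 2.
Proof.
case: w => x y; rewrite cexpE /=.
set w := Complex x y; have xw : `|x| <= cabs w := cabs_Re w.
have yw : `|y| <= cabs w := cabs_Im w.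
have w2 : cabs w ^+ 2 = x ^+ 2 + y ^+ 2 := cabs_sqr w.
have ew : expR `|x| <= expR (cabs w) by rewrite ler_expR.
have ex : expR x <= expR `|x| by rewrite ler_expR ler_norm.
set E := expR (cabs w) in ew *; have E0 : 0 <= E by exact: expR_ge0.
apply: le_trans (cabs_le_ReIm _) _.
rewrite !(cReB, cImB, cReM, cImM) /= !(mul0r, subr0, addr0, add0r).
have hc : `|cos y - 1| <= y ^+ 2 / 2.
  have := cos_quad_ge0 y; have := cos_le1 y => h1 h2.
  by rewrite ler0_norm; lra.
have hs := sin_id_quad y; have h1 := expR_sub1_le x; have h2 := expR_sub1x_le x.
have ex0 := expR_gt0 x.
have E1 : `|expR x * cos y - 1 - x| <= E * x ^+ 2 + E * (y ^+ 2 / 2).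
  rewrite (_ : _ - _ - _ = (expR x - 1 - x) + expR x * (cos y - 1)); last by ring.
  apply: le_trans (ler_normD _ _) _; apply: lerD.
    by apply: le_trans h2 _; rewrite mulrC ler_wpM2r ?sqr_ge0.
  rewrite normrM (gtr0_norm ex0); by apply: ler_pM => //; exact: le_trans ex ew.
have E2 : `|expR x * sin y - y| <= E * y ^+ 2 + E * (`|x| * `|y|).
  rewrite (_ : _ - y = expR x * (sin y - y) + (expR x - 1) * y); last by ring.
  apply: le_trans (ler_normD _ _) _; apply: lerD.
    rewrite normrM (gtr0_norm ex0); by apply: ler_pM => //; exact: le_trans ex ew.
  rewrite normrM mulrA; apply: ler_wpM2r => //; apply: le_trans h1 _.
  by rewrite mulrC ler_wpM2r.
have xy : `|x| * `|y| <= x ^+ 2 + y ^+ 2.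
  rewrite -(real_normK (num_real x)) -(real_normK (num_real y)).
  by have := sqr_ge0 (`|x| - `|y|); rewrite sqrrB; nra.
have m1 : E * (`|x| * `|y|) <= E * (x ^+ 2 + y ^+ 2) by rewrite ler_wpM2l.
have m2 : 0 <= E * x ^+ 2 by rewrite mulr_ge0 ?sqr_ge0.
have m3 : 0 <= E * y ^+ 2 by rewrite mulr_ge0 ?sqr_ge0.
by rewrite w2; lra.
Qed.

Lemma cexp_sub1 (w : Cplx R) (M : R) : cabs w <= M ->
  cabs (cexp w - 1) <= (1 + 4 * expR M * M) * cabs w.
Proof.
move=> wM; rewrite (_ : cexp w - 1 = (cexp w - 1 - w) + w); last by ring.
apply: le_trans (cabsD _ _) _; rewrite mulrDl mul1r addrC lerD2l.
apply: le_trans (cexp_quad w) _; rewrite expr2 mulrA; apply: ler_wpM2r; first exact: cabs_ge0.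
apply: ler_pM; rewrite ?cabs_ge0 ?mulr_ge0 ?expR_ge0 //.
by rewrite ler_wpM2l // ler_expR.
Qed.

Lemma ln1D_bound (t : R) : 0 <= t -> `|ln (1 + t) - t| <= t ^+ 2.
Proof.
move=> t0; have hu : ln (1 + t) <= t by apply: le_ln1Dx; lra.
have t1 : 0 < 1 + t by lra.
have hl : t / (1 + t) <= ln (1 + t).
  have : ln (1 + - (t / (1 + t))) <= - (t / (1 + t)).
    by apply: le_ln1Dx; rewrite ltrN2 ltr_pdivrMr // mul1r; lra.
  have -> : 1 - t / (1 + t) = (1 + t)^-1 by field; lra.
  by rewrite lnV ?posrE //; lra.
have : t - t ^+ 2 <= t / (1 + t).
  by rewrite ler_pdivlMr //; have := exprn_ge0 3 t0; nra.
by move=> h; rewrite ler0_norm; lra.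
Qed.

(** The error is summable over [m]: this is what makes [n! n^z / (z ... (z + n))]
    converge. *)
Lemma npow_ratio (M : R) : 0 <= M -> exists2 C, 0 <= C & forall (m : nat) (w : Cplx R),
  (0 < m)%N -> cabs w <= M ->
  cabs (npow m.+1 w / npow m w - 1 - w / m%:R) <= C / m%:R ^+ 2.
Proof.
move=> M0; exists (4 * expR M * M ^+ 2 + M).
  by apply: addr_ge0 => //; apply: mulr_ge0; [rewrite mulr_ge0 ?expR_ge0|exact: sqr_ge0].
move=> m w m0 wM; have mR : 0 < m%:R :> R by rewrite ltr0n.
pose t : R := m%:R^-1; have t0 : 0 < t by rewrite invr_gt0.
have t1 : t <= 1 by rewrite invf_le1 // (ler_nat R 1).
have lnE : ln m.+1%:R - ln m%:R = ln (1 + t).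
  rewrite -ln_div ?posrE ?ltr0n //; congr ln; rewrite -natr1 /t; field; lra.
have -> : npow m.+1 w / npow m w = cexp (w * ofR (ln (1 + t))).
  by rewrite /npow -cexpN -cexpD -lnE ofRB; congr cexp; ring.
have lb := ln1D_bound (ltW t0); set l := ln (1 + t) in lb *.
have l0 : 0 <= l by rewrite /l ln_ge0 //; lra.
have lt : l <= t by rewrite /l; apply: le_ln1Dx; lra.
have wl : cabs (w * ofR l) <= M * t.
  by rewrite cabsM cabs_ofR (ger0_norm l0) ler_pM ?cabs_ge0.
have wl1 : cabs (w * ofR l) <= M by apply: le_trans wl _; rewrite ler_piMr.
rewrite (_ : _ - _ - _ = (cexp (w * ofR l) - 1 - w * ofR l) + w * ofR (l - t)); last first.
  by rewrite ofRB /t ofRV ofR_nat; ring.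
apply: le_trans (cabsD _ _) _; rewrite mulrDl; apply: lerD.
  apply: le_trans (cexp_quad _) _.
  have -> : 4 * expR M * M ^+ 2 / m%:R ^+ 2 = 4 * expR M * (M * t) ^+ 2 by rewrite exprMn /t exprVn !mulrA.
  apply: ler_pM; rewrite ?sqr_ge0 ?mulr_ge0 ?expR_ge0 //.
    by rewrite ler_wpM2l // ler_expR.
  by rewrite lerXn2r ?nnegrE ?cabs_ge0 // mulr_ge0 // ltW.
by rewrite cabsM cabs_ofR -exprVn ler_pM ?cabs_ge0.
Qed.

End ComplexLimits.

Section ClimitAlgebra.
Variable R : realType.
Implicit Types (u v : nat -> Cplx R).

Lemma climitD u v l l' : climit u l -> climit v l' -> climit (fun n => u n + v n) (l + l').
Proof.
move=> ul vl e e0; have e2 : 0 < e / 2 by rewrite divr_gt0.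
have [N HN] := ul _ e2; have [N' HN'] := vl _ e2; exists (maxn N N') => n.
rewrite geq_max => /andP[Nn Nn'].
rewrite (_ : _ - _ = (u n - l) + (v n - l')); last by ring.
by rewrite [e]splitr; apply: le_trans (cabsD _ _) _; apply: lerD; [exact: HN|exact: HN'].
Qed.

Lemma climitMl c u l : climit u l -> climit (fun n => c * u n) (c * l).
Proof.
move=> ul e e0; have c1 : 0 < cabs c + 1 by rewrite ltr_wpDl ?cabs_ge0.
have [N HN] := ul _ (divr_gt0 e0 c1); exists N => n Nn.
rewrite -mulrBr cabsM; apply: (@le_trans _ _ ((cabs c + 1) * (e / (cabs c + 1)))).
  by apply: ler_pM; rewrite ?cabs_ge0 ?HN // lerDl ler01.
by rewrite mulrC divfK ?gt_eqF.
Qed.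

Lemma climitB u v l l' : climit u l -> climit v l' -> climit (fun n => u n - v n) (l - l').
Proof.
move=> ul vl; have := climitD ul (climitMl (-1) vl); rewrite mulN1r => H e e0.
by have [N HN] := H e e0; exists N => n Nn; have := HN n Nn; rewrite mulN1r.
Qed.

End ClimitAlgebra.


(** * Rising factorials and the Gamma function *)

Section RisingGamma.
Variable R : realType.
Implicit Types (z w : Cplx R).

(** The coefficients of [(1 - x)^(-z)]. *)
Definition rising z (j : nat) : Cplx R := \prod_(i < j) ((z + i%:R) / i.+1%:R).

Lemma rising0 z : rising z 0 = 1. Proof. exact: big_ord0. Qed.

Lemma risingS z j : rising z j.+1 = rising z j * ((z + j%:R) / j.+1%:R).
Proof. exact: big_ord_recr. Qed.

Let nat_neq0 n : n.+1%:R != 0 :> Cplx R. Proof. by rewrite pnatr_eq0. Qed.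

Lemma risingSl z j : j.+1%:R * rising z j.+1 = (z + j%:R) * rising z j.
Proof. by rewrite risingS; field; rewrite nat1r nat_neq0. Qed.

(** Chu-Vandermonde: [(1 - x)^(-z) (1 - x)^(-w) = (1 - x)^(-(z + w))]. *)
Lemma rising_conv z w J :
  \sum_(j < J.+1) rising z j * rising w (J - j) = rising (z + w) J.
Proof.
elim: J => [|J IH]; first by rewrite big_ord1 !rising0 mulr1.
apply: (mulfI (nat_neq0 J)); rewrite risingSl -IH mulr_sumr.
transitivity (\sum_(j < J.+2) (j%:R * rising z j * rising w (J.+1 - j) +
   rising z j * ((J.+1 - j)%:R * rising w (J.+1 - j)))).
  apply: eq_bigr => j _; have jJ := ltn_ord j.
  by rewrite natrB; [ring|rewrite -ltnS].
rewrite big_split /= big_ord_recl /= mul0r mul0r add0r addrC big_ord_recr /= subnn mul0r mulr0 addr0.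
rewrite mulr_sumr -big_split; apply: eq_bigr => j _.
have jJ : (j <= J)%N by rewrite -ltnS.
rewrite /bump /= add1n subSS risingSl subSn // risingSl natrB //=; ring.
Qed.

Lemma rising1 j : rising 1 j = 1.
Proof.
elim: j => [|j IH]; first by rewrite rising0.
by rewrite risingS IH mul1r nat1r divff.
Qed.

Lemma rising_sum z J : \sum_(j < J.+1) rising z j = rising (z + 1) J.
Proof. by rewrite -rising_conv; apply: eq_bigr => j _; rewrite rising1 mulr1. Qed.

Lemma rising_half j : rising (chalf R) j = ofR (central R j).
Proof.
rewrite /rising /central -[RHS]/(real_complex R _) rmorph_prod; apply: eq_bigr => i _.
by rewrite -[RHS]/(ofR _) ofRM ofRD (ofRV i.+1%:R) !ofR_nat.
Qed.

(** The linear growth in [j] holds on every compact set without poles of Gamma,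
    and makes the estimates below uniform in [z]. *)
Definition away (M d : R) z := cabs z <= M /\ forall j : nat, d * j.+1%:R <= cabs (z + j%:R).

Lemma away_neq0 M d z j : 0 < d -> away M d z -> z + j%:R != 0.
Proof.
move=> d0 [_ /(_ j) h]; rewrite -cabs_gt0; apply: lt_le_trans h.
by rewrite mulr_gt0.
Qed.

Lemma rising_neq0 M d z j : 0 < d -> away M d z -> rising z j != 0.
Proof.
move=> d0 az; elim: j => [|j IH]; first by rewrite rising0 oner_neq0.
by rewrite risingS !mulf_neq0 ?invr_eq0 // (away_neq0 _ d0 az).
Qed.

(** [rising z j] is asymptotic to [j^(z-1) / Gamma z]. *)
Definition gseq z j : Cplx R := rising z j * npow j.+1 (1 - z).

Lemma gseq0 z : gseq z 0 = 1.
Proof. by rewrite /gseq rising0 npow1n mulr1. Qed.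

Definition gratio z (j : nat) : Cplx R :=
  (1 - (1 - z) / j.+1%:R) * (npow j.+2 (1 - z) / npow j.+1 (1 - z)).

Lemma gseqS z j : gseq z j.+1 = gseq z j * gratio z j.
Proof.
rewrite /gseq /gratio risingS.
have -> : 1 - (1 - z) / j.+1%:R = (z + j%:R) / j.+1%:R.
  by rewrite -nat1r; field; rewrite nat1r nat_neq0.
by field; rewrite nat1r nat_neq0 npow_neq0.
Qed.

Lemma gratio_bound M : 0 <= M -> exists2 C, 0 <= C & forall z j, cabs z <= M ->
  cabs (gratio z j - 1) <= C / j.+1%:R ^+ 2.
Proof.
move=> M0; have M1 : 0 <= M + 1 by lra.
have [C C0 HC] := npow_ratio M1.
exists ((M + 1) ^+ 2 + (M + 2) * C).
  by apply: addr_ge0; [exact: sqr_ge0|apply: mulr_ge0 => //; lra].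
move=> z j zM; set w := 1 - z.
have wM : cabs w <= M + 1 by apply: le_trans (cabsB _ _) _; rewrite cabs1; lra.
have := HC j.+1 w isT wM; set r := _ / npow j.+1 w => Hr.
have nn : 0 < j.+1%:R :> R by rewrite ltr0n.
rewrite (_ : gratio z j - 1 = - (w / j.+1%:R) ^+ 2 + (1 - w / j.+1%:R) * (r - 1 - w / j.+1%:R)); last first.
  by rewrite /gratio -/w -/r; ring.
have wn : cabs (w / j.+1%:R) <= (M + 1) / j.+1%:R.
  by rewrite cabsM cabsV cabs_nat ler_wpM2r // invr_ge0.
apply: le_trans (cabsD _ _) _; rewrite cabsN cabsX [cabs (_ * (r - _ - _))]cabsM [leRHS]mulrDl; apply: lerD.
  by rewrite -expr_div_n lerXn2r ?nnegrE ?cabs_ge0 // divr_ge0.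
rewrite -mulrA; apply: ler_pM; rewrite ?cabs_ge0 //.
apply: le_trans (cabsB _ _) _; rewrite cabs1.
rewrite (_ : M + 2 = 1 + (M + 1)) ?lerD2l; last by ring.
apply: le_trans wn _.
by rewrite ler_pdivrMr // ler_peMr // (ler_nat R 1).
Qed.

Lemma gratio_lb M d : 0 <= M -> 0 < d -> exists2 c, 0 < c & forall z j, away M d z ->
  c <= cabs (gratio z j).
Proof.
move=> M0 d0; exists (d * expR (- (M + 1))); first by rewrite mulr_gt0 ?expR_gt0.
move=> z j [zM za]; rewrite /gratio cabsM; set w := 1 - z.
have nn : 0 < j.+1%:R :> R by rewrite ltr0n.
have wM : cabs w <= M + 1 by apply: le_trans (cabsB _ _) _; rewrite cabs1; lra.
apply: ler_pM; [exact: ltW|exact: expR_ge0| |].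
  have -> : 1 - w / j.+1%:R = (z + j%:R) / j.+1%:R.
    by rewrite /w -nat1r; field; rewrite nat1r nat_neq0.
  by rewrite cabsM cabsV cabs_nat ler_pdivlMr.
rewrite cabsM cabsV /npow !cabs_cexp -expRN -expRD ler_expR.
rewrite !cReM !cRe_ofR !cIm_ofR !mulr0 !subr0 -mulrBr.
have l0 : 0 <= ln j.+2%:R - ln j.+1%:R :> R.
  by rewrite subr_ge0 ler_ln ?posrE ?ltr0n // ler_nat.
have l1 : ln j.+2%:R - ln j.+1%:R <= 1 :> R.
  have -> : j.+2%:R = j.+1%:R * (1 + j.+1%:R^-1) :> R.
    by rewrite mulrDr mulr1 divff ?gt_eqF // -natr1.
  have i0 : 0 < j.+1%:R^-1 :> R by rewrite invr_gt0.
  rewrite lnM ?posrE ?addr_gt0 // addrAC subrr add0r.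
  apply: le_trans (_ : j.+1%:R^-1 <= 1); first by apply: le_ln1Dx; apply: lt_trans i0; exact: ltrN10.
  by rewrite invf_le1 // (ler_nat R 1).
have := le_trans (cabs_Re w) wM; rewrite ler_norml => /andP[h1 h2].
move: l0 l1; move: (ln _ - ln _) (cRe w) h1 => l x h1 l0 l1.
have : 0 <= (x + (M + 1)) * l by apply: mulr_ge0 => //; lra.
by have : 0 <= (M + 1) * (1 - l) by [apply: mulr_ge0; lra]; lra.
Qed.

Lemma slow_sequence C : 0 <= C -> exists2 K, 0 < K & forall c : nat -> Cplx R, c 0%N = 1 ->
  (forall j, cabs (c j.+1 - c j) <= C / j.+1%:R ^+ 2 * cabs (c j)) ->
  (forall j, cabs (c j) <= K) /\
  exists2 l, climit c l & forall j, cabs (c j - l) <= K / j.+1%:R.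
Proof.
move=> C0; pose E := expR (2 * C); have E0 : 0 < E by exact: expR_gt0.
have K0 : 0 < E * (1 + 4 * C) by rewrite mulr_gt0 //; lra.
exists (E * (1 + 4 * C)) => // c c0 step.
have tel j : j.+1%:R ^- 2 <= 2 * (j.+1%:R^-1 - j.+2%:R^-1) :> R.
  have p1 : 0 < j.+1%:R :> R by rewrite ltr0n.
  have -> : 2 * (j.+1%:R^-1 - j.+2%:R^-1) = 2 / (j.+1%:R * j.+2%:R) :> R.
    rewrite -[j.+2%:R]natr1; field; rewrite gt_eqF //= gt_eqF //; lra.
  rewrite ler_pdivlMr ?mulr_gt0 // mulrC ler_pdivrMr ?exprn_gt0 // expr2 mulrCA ler_pM2l //.
  by rewrite -[j.+2%:R]natr1; have : 1 <= j.+1%:R :> R by [rewrite (ler_nat R 1)]; lra.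
have bE j : cabs (c j) <= expR (C * (2 - 2 / j.+1%:R)).
  elim: j => [|j IH]; first by rewrite c0 cabs1 divr1 subrr mulr0 expR0.
  rewrite (_ : c j.+1 = c j + (c j.+1 - c j)); last by ring.
  apply: le_trans (cabsD _ _) _; apply: le_trans (lerD (lexx _) (step j)) _.
  rewrite -[X in X + _]mul1r -mulrDl.
  apply: (@le_trans _ _ (expR (C / j.+1%:R ^+ 2) * expR (C * (2 - 2 / j.+1%:R)))).
    by apply: ler_pM; rewrite ?cabs_ge0 ?expR_ge1Dx // addr_ge0 // divr_ge0 // exprn_ge0.
  rewrite -expRD ler_expR -mulrDr; apply: ler_wpM2l => //.
  by move: (tel j); move: (_ ^- 2) (j.+1%:R^-1) (j.+2%:R^-1) => u v w; lra.
have bK j : cabs (c j) <= E.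
  apply: le_trans (bE j) _; rewrite ler_expR mulrC ler_wpM2r //.
  by rewrite lerBlDr lerDl divr_ge0.
split=> [j|]; first by apply: le_trans (bK j) _; apply: ler_peMr; [exact: ltW|lra].
have cau j k : (j <= k)%N -> cabs (c k - c j) <= C * E * 2 * (j.+1%:R^-1 - k.+1%:R^-1).
  move=> jk; rewrite -(subnK jk) addnC; elim: (k - j)%N => [|m IH].
    by rewrite addn0 !subrr cabs0 mulr0.
  apply: le_trans (cabs_distD (c (j + m)%N) _ _) _; rewrite addnS.
  apply: le_trans (lerD (step _) IH) _.
  have h1 : C / (j + m).+1%:R ^+ 2 * cabs (c (j + m)%N) <= C * (2 * ((j + m).+1%:R^-1 - (j + m).+2%:R^-1)) * E.
    by apply: ler_pM; rewrite ?cabs_ge0 ?ler_wpM2l ?divr_ge0 // exprn_ge0.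
  by move: h1; move: (_ * cabs _) ((j + m).+1%:R^-1) ((j + m).+2%:R^-1) (j.+1%:R^-1) => u v w x; lra.
have CE : 0 <= C * E * 2 by rewrite !mulr_ge0 // ltW.
have [| |l cl Hl] := @cauchy_climit _ c (fun j => C * E * 2 / j.+1%:R).
- move=> e e0; have D0 : 0 < C * E * 2 + 1 by lra.
  have [N HN] := nat_inv_small (divr_gt0 e0 D0); exists N => n Nn.
  apply: (@le_trans _ _ ((C * E * 2 + 1) / n.+1%:R)).
    by rewrite ler_wpM2r ?invr_ge0 // lerDl.
  by have := HN n Nn; rewrite ler_pdivlMr // mulrC.
- move=> j k jk; apply: le_trans (cau j k jk) _; apply: ler_wpM2l => //.
  by rewrite lerBlDr lerDl invr_ge0.
exists l => // j; apply: le_trans (Hl j) _; rewrite mulrA ler_wpM2r ?invr_ge0 //.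
by have := ltW E0; lra.
Qed.

Lemma cGamma_climit M d z l : 0 <= M -> 0 < d -> away M d z ->
  climit (fun j => (gseq z j)^-1) l -> cGamma z = l.
Proof.
move=> M0 d0 az gl; have [zM za] := az.
have [C C0 HC] := npow_ratio M0.
apply: climit_lim.
have [N HN] := gl 1 ltr01.
pose B := cabs l + 1; have B0 : 0 < B by rewrite ltr_wpDl // cabs_ge0.
pose D := B * ((M + 1) / d * (1 + 2 * (M + C)) + 2 * (M + C)).
have D0 : 0 <= D.
  have MC : 0 <= 2 * (M + C) by rewrite mulr_ge0 // addr_ge0.
  apply: mulr_ge0; first exact: ltW.
  apply: addr_ge0 => //; apply: mulr_ge0; last by lra.
  by apply: divr_ge0; [lra|exact: ltW].
have close n : (maxn N 1 <= n)%N ->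
    cabs ((n`!)%:R * npow n z / \prod_(k < n.+1) (z + k%:R) - (gseq z n)^-1) <= D / n.+1%:R.
  rewrite geq_max => /andP[Nn n0].
  have n0R : 0 < n%:R :> R by rewrite ltr0n.
  have n1R : 0 < n.+1%:R :> R by rewrite ltr0n.
  pose a := (1 - z) / (z + n%:R); pose b := npow n.+1 (- z) / npow n (- z).
  have zn := away_neq0 n d0 az.
  have rn := rising_neq0 n d0 az.
  have prodE : \prod_(k < n.+1) (z + k%:R) = (n`!)%:R * rising z n * (z + n%:R).
    rewrite big_ord_recr /=; congr (_ * _).
    elim: n {Nn n0 n0R n1R a b zn rn} => [|n IH]; first by rewrite big_ord0 rising0 mulr1.
    by rewrite big_ord_recr /= IH risingS factS natrM; field; rewrite nat1r nat_neq0.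
  have fn : (n`!)%:R != 0 :> Cplx R by rewrite pnatr_eq0 -lt0n fact_gt0.
  have -> : (n`!)%:R * npow n z / \prod_(k < n.+1) (z + k%:R) =
      (gseq z n)^-1 * ((1 + a) * b).
    rewrite prodE /gseq /a /b !npowN npowD npow1 // npowN -[n.+1%:R]natr1.
    by field; rewrite natr1 fn rn zn nat_neq0 !npow_neq0.
  rewrite -[X in _ - X]mulr1 -mulrBr cabsM.
  have gB : cabs (gseq z n)^-1 <= B.
    rewrite (_ : (gseq z n)^-1 = ((gseq z n)^-1 - l) + l); last by ring.
    by apply: le_trans (cabsD _ _) _; have := HN n Nn; rewrite /B; lra.
  have aB : cabs a <= (M + 1) / d / n.+1%:R.
    rewrite /a cabsM cabsV -mulrA -invfM; apply: ler_pM; rewrite ?cabs_ge0 ?invr_ge0 ?cabs_ge0 //.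
      by apply: le_trans (cabsB _ _) _; rewrite cabs1; lra.
    by rewrite lef_pV2 ?posrE ?mulr_gt0 // cabs_gt0.
  have zNM : cabs (- z) <= M by rewrite cabsN.
  have n2 : n%:R^-1 <= 2 / n.+1%:R :> R.
    rewrite ler_pdivlMr // mulrC ler_pdivrMr // -natr1.
    by have : 1 <= n%:R :> R by [rewrite (ler_nat R 1)]; lra.
  have n3 : n%:R ^- 2 <= n%:R^-1 :> R.
    by rewrite lef_pV2 ?posrE ?exprn_gt0 // expr2; apply: ler_peMr; [exact: ltW|rewrite (ler_nat R 1)].
  have b1 : cabs (b - 1) <= 2 * (M + C) / n.+1%:R.
    rewrite (_ : b - 1 = (b - 1 - - z / n%:R) + - z / n%:R); last by ring.
    apply: le_trans (cabsD _ _) _; apply: le_trans (lerD (HC n _ n0 zNM) (lexx _)) _.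
    rewrite cabsM cabsV cabs_nat.
    have h1 : C / n%:R ^+ 2 <= C / n%:R by rewrite ler_wpM2l.
    have h2 : cabs (- z) / n%:R <= M / n%:R by rewrite ler_wpM2r ?invr_ge0 // ltW.
    have h3 : (M + C) / n%:R <= (M + C) * (2 / n.+1%:R) by rewrite ler_wpM2l // addr_ge0.
    apply: le_trans (lerD h1 h2) _; rewrite -mulrDl [C + M]addrC; apply: le_trans h3 _.
    by rewrite mulrA [_ * 2]mulrC.
  have b2 : cabs b <= 1 + 2 * (M + C).
    rewrite (_ : b = 1 + (b - 1)); last by ring.
    apply: le_trans (cabsD _ _) _; rewrite cabs1 lerD2l; apply: le_trans b1 _.
    rewrite ler_pdivrMr // ler_peMr ?(ler_nat R 1) //.
    by rewrite mulr_ge0 // addr_ge0.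
  rewrite /D -mulrA; apply: ler_pM; rewrite ?cabs_ge0 //.
  rewrite (_ : (1 + a) * b - 1 = a * b + (b - 1)); last by ring.
  apply: le_trans (cabsD _ _) _; rewrite mulrDl; apply: lerD => //.
  by rewrite cabsM mulrAC; apply: ler_pM; rewrite ?cabs_ge0.
move=> e e0; have e20 : 0 < e / 2 by rewrite divr_gt0.
have [N1 H1] := gl _ e20.
have D1 : 0 < D + 1 by lra.
have [N2 H2] := nat_inv_small (divr_gt0 e20 D1).
exists (maxn (maxn N 1) (maxn N1 N2)) => n; rewrite geq_max => /andP[n1].
rewrite geq_max => /andP[n2 n3].
apply: le_trans (cabs_distD (gseq z n)^-1 _ _) _.
have h1 : D / n.+1%:R <= e / 2.
  have := H2 n n3; rewrite ler_pdivlMr // => h; apply: le_trans h.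
  by rewrite mulrC ler_wpM2l ?invr_ge0 // lerDl.
rewrite [leRHS]splitr; apply: lerD; first exact: le_trans (close n n1) h1.
exact: H1.
Qed.

(** Consecutive ratios of [gseq z] are [1 + O(j^-2)], with a constant that
    depends on [M] and [d] only; hence the rate [1 / j]. *)
Lemma gamma_uniform M d : 0 <= M -> 0 < d -> exists2 K, 0 < K &
  forall z, away M d z ->
  [/\ cGamma z != 0, cabs (cGamma z) <= K, forall j, cabs (gseq z j) <= K,
      forall j, cabs (cGamma z * gseq z j - 1) <= K / j.+1%:R &
      forall j, cabs (gseq z j - (cGamma z)^-1) <= K / j.+1%:R].
Proof.
move=> M0 d0; have [C C0 HC] := gratio_bound M0; have [c c0 Hc] := gratio_lb M0 d0.
have [K1 K10 H1] := slow_sequence C0.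
have C20 : 0 <= C / c by rewrite divr_ge0 // ltW.
have [K2 K20 H2] := slow_sequence C20.
exists (K1 + K2 + K2 * K1); first by rewrite !addr_gt0 // mulr_gt0.
have p12 : 0 < K2 * K1 by rewrite mulr_gt0.
move=> z az; have [zM za] := az.
have gn0 j : gseq z j != 0 by rewrite mulf_neq0 ?npow_neq0 // (rising_neq0 _ d0 az).
have [] := H1 (gseq z) (gseq0 z).
  move=> j; rewrite gseqS -[X in _ - X]mulr1 -mulrBr cabsM mulrC.
  by apply: ler_wpM2r; rewrite ?cabs_ge0 // HC.
move=> gK [l gl gr].
have [] := H2 (fun j => (gseq z j)^-1).
- by rewrite gseq0 invr1.
- move=> j; have f0 : gratio z j != 0 by rewrite -cabs_gt0 (lt_le_trans c0) // Hc.
  rewrite gseqS invfM -[X in _ - X]mulr1 -mulrBr cabsM mulrC.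
  apply: ler_wpM2r; first exact: cabs_ge0.
  have -> : (gratio z j)^-1 - 1 = - ((gratio z j - 1) / gratio z j) by field.
  rewrite cabsN cabsM cabsV mulrAC; apply: ler_pM; rewrite ?invr_ge0 ?cabs_ge0 ?HC //.
  by rewrite lef_pV2 ?posrE ?Hc // (lt_le_trans c0) // Hc.
move=> iK [l' il ir].
have GE := cGamma_climit M0 d0 az il; rewrite GE.
have bnd u v (B : R) : climit u v -> (forall j, cabs (u j) <= B) -> cabs v <= B.
  move=> uv uB; rewrite -[v]subr0; apply: (climit_le uv (climit_cst 0)).
  by exists 0%N => n _; rewrite subr0.
have lK := bnd _ _ _ gl gK; have lK' := bnd _ _ _ il iK.
have ll : l * l' = 1.
  apply: (@climit_unique _ (fun=> 1) _ _ _ (climit_cst 1)).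
  apply: (@climit_rate _ _ _ (K1 * K2 + K2 * K1)) => j.
  rewrite -(divff (gn0 j)).
  rewrite (_ : _ - _ = (gseq z j - l) * (gseq z j)^-1 + l * ((gseq z j)^-1 - l')); last by ring.
  apply: le_trans (cabsD _ _) _; rewrite !cabsM mulrDl; apply: lerD.
    by rewrite mulrAC; apply: ler_pM; rewrite ?cabs_ge0.
  by rewrite [K2 * K1]mulrC -mulrA; apply: ler_pM; rewrite ?cabs_ge0.
have l'0 : l' != 0 by apply/eqP => e; move/eqP: ll; rewrite e mulr0 eq_sym oner_eq0.
have l'l : l'^-1 = l by rewrite -[LHS]mul1r -ll mulfK.
have big (x y : R) n : 0 <= x -> y <= x -> y / n.+1%:R <= x / n.+1%:R.
  by move=> x0 yx; rewrite ler_wpM2r ?invr_ge0.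
split => //.
- by apply: le_trans lK' _; lra.
- by move=> j; apply: le_trans (gK j) _; lra.
- move=> j; rewrite -[X in cabs (_ - X)]ll [l * l']mulrC -mulrBr cabsM.
  apply: le_trans (big _ (K2 * K1) _ _ _); [|lra|lra].
  by rewrite -mulrA; apply: ler_pM; rewrite ?cabs_ge0.
move=> j; rewrite l'l; apply: le_trans (gr j) _; apply: big; lra.
Qed.

End RisingGamma.

(** * Sums of powers *)

Section PowerSums.
Variable R : realType.
Implicit Types (x y : R).

Definition spow (j : nat) x : R := j.+1%:R `^ x.

Lemma succ_gt0 j : 0 < j.+1%:R :> R. Proof. by rewrite ltr0n. Qed.

Lemma spowE j x : spow j x = expR (x * ln j.+1%:R).
Proof. by rewrite /spow /powR gt_eqF ?succ_gt0. Qed.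

Lemma spow_gt0 j x : 0 < spow j x. Proof. by rewrite spowE expR_gt0. Qed.
Lemma spow_ge0 j x : 0 <= spow j x. Proof. exact/ltW/spow_gt0. Qed.
Lemma spowD j x y : spow j (x + y) = spow j x * spow j y.
Proof. by rewrite !spowE mulrDl expRD. Qed.
Lemma spowN j x : spow j (- x) = (spow j x)^-1.
Proof. by rewrite !spowE mulNr expRN. Qed.
Lemma spow1 j : spow j 1 = j.+1%:R.
Proof. by rewrite spowE mul1r lnK // posrE succ_gt0. Qed.
Lemma spowB1 j x : spow j (x - 1) = spow j x / j.+1%:R.
Proof. by rewrite spowD spowN spow1. Qed.

Lemma spow_half j : spow j 2^-1 = Num.sqrt j.+1%:R.
Proof. by rewrite /spow powR12_sqrt. Qed.

Lemma spow_step x j : spow j.+1 x = spow j x * expR (x * ln (j.+2%:R / j.+1%:R)).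
Proof.
rewrite !spowE -expRD ln_div ?posrE ?succ_gt0 //; congr expR; ring.
Qed.

(** [ln ((j + 2) / (j + 1)) = - ln (1 - 1 / (j + 2)) >= 1 / (j + 2)]. *)
Lemma ln_ratio_lb j : j.+2%:R^-1 <= ln (j.+2%:R / j.+1%:R) :> R.
Proof.
have i0 : 0 < j.+2%:R^-1 :> R by rewrite invr_gt0 succ_gt0.
have i1 : j.+2%:R^-1 < 1 :> R by rewrite invf_lt1 ?succ_gt0 // (ltr_nat R 1).
have -> : j.+2%:R / j.+1%:R = (1 + - j.+2%:R^-1)^-1 :> R.
  rewrite -[j.+2%:R]natr1; move: (j.+1%:R) (succ_gt0 j) => a a0.
  have -> : 1 + - (a + 1)^-1 = a / (a + 1) by field; lra.
  by rewrite invf_div.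
have h : ln (1 + - j.+2%:R^-1) <= - j.+2%:R^-1 :> R by apply: le_ln1Dx; rewrite ltrN2.
by rewrite lnV ?posrE; [rewrite lerNr|rewrite subr_gt0].
Qed.

(** Telescoping: [(j + 1)^(y-1)] is at most a constant times the increment of
    [j^y], uniformly for [y] bounded away from 0. *)
Lemma sum_spow_le y0 : 0 < y0 -> exists2 C, 0 < C & forall y m, y0 <= y ->
  \sum_(j < m.+1) spow j (y - 1) <= C * spow m y.
Proof.
move=> y00; have iy : 0 < 2 / y0 by rewrite divr_gt0.
exists (1 + 2 / y0) => [|y m yy]; first by lra.
elim: m => [|m IH].
  by rewrite big_ord1 /spow !powR1 mulr1; lra.
rewrite big_ord_recr /=; apply: le_trans (lerD IH (lexx _)) _.
rewrite -lerBrDl -mulrBr spowB1.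
set a := spow m.+1 y; have a0 : 0 < a by exact: spow_gt0.
set u : R := m.+2%:R^-1.
have u0 : 0 < u by rewrite invr_gt0 succ_gt0.
have u2 : u <= 2^-1 by rewrite lef_pV2 ?posrE ?succ_gt0 // (ler_nat R 2).
have y1 : 0 < y by exact: lt_le_trans yy.
have yu : 0 < y * u by rewrite mulr_gt0.
have le1 : spow m y <= a / (1 + y * u).
  rewrite ler_pdivlMr; last by lra.
  rewrite /a spow_step ler_wpM2l ?spow_ge0 //.
  apply: le_trans (expR_ge1Dx _) _; rewrite ler_expR ler_pM2l //; exact: ln_ratio_lb.
have h : u <= (1 + 2 / y0) * (1 - (1 + y * u)^-1).
  have -> : 1 - (1 + y * u)^-1 = y * u / (1 + y * u) by field; lra.
  rewrite mulrA ler_pdivlMr; last by lra.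
  have h1 : y0 * u <= y * u by rewrite ler_wpM2r // ltW.
  have h2 : u <= 2 / y0 * (y * u).
    apply: (@le_trans _ _ (2 / y0 * (y0 * u))); last by rewrite ler_wpM2l // ltW.
    by rewrite mulrA divfK ?gt_eqF //; lra.
  have h3 : u * (y * u) <= y * u by rewrite ler_piMl //; lra.
  by rewrite mulrDl mul1r mulrDr mulr1; lra.
apply: (@le_trans _ _ (a * ((1 + 2 / y0) * (1 - (1 + y * u)^-1)))).
  by rewrite ler_wpM2l // ltW.
rewrite mulrCA ler_wpM2l //; first by lra.
by rewrite mulrBr mulr1; lra.
Qed.

Lemma tail_spow_le d x J N : 0 < d -> x <= - d ->
  \sum_(J.+1 <= j < N) spow j (x - 1) <= d^-1 * spow J x.
Proof.
move=> d0 xd; have id : 0 < d^-1 by rewrite invr_gt0.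
suff : forall n, (J.+1 <= n)%N -> \sum_(J.+1 <= j < n) spow j (x - 1) <= d^-1 * (spow J x - spow n.-1 x).
  move=> H; have [JN|NJ] := leqP J.+1 N.
    by apply: le_trans (H _ JN) _; rewrite ler_pM2l // gerBl spow_ge0.
  by rewrite big_geq ?(ltnW NJ) // mulr_ge0 ?spow_ge0 // ltW.
elim=> // n IH; rewrite ltnS leq_eqVlt => /predU1P[<-|Jn].
  by rewrite big_geq // subrr mulr0.
rewrite big_nat_recr //=; apply: le_trans (lerD (IH Jn) (lexx _)) _.
rewrite -lerBrDl -mulrBr (_ : _ - _ - (_ - _) = spow n.-1 x - spow n x); last by ring.
case: n Jn {IH} => // n _ /=; rewrite spowB1.
set a := spow n.+1 x; have a0 : 0 < a by exact: spow_gt0.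
have u0 : 0 < n.+2%:R^-1 :> R by rewrite invr_gt0 succ_gt0.
have : a * (1 + d * n.+2%:R^-1) <= spow n x.
  have -> : spow n x = a * expR (- x * ln (n.+2%:R / n.+1%:R)).
    by rewrite /a spow_step -mulrA -expRD mulNr subrr expR0 mulr1.
  rewrite ler_pM2l //; apply: le_trans (expR_ge1Dx _); rewrite lerD2l.
  apply: ler_pM; [exact: ltW|exact: ltW|by rewrite lerNr|exact: ln_ratio_lb].
move: (_^-1) u0 => u u0 h; rewrite -(ler_pM2l d0) [leRHS]mulrA divff ?gt_eqF // mul1r.
by lra.
Qed.

Lemma sum_invsqrt m : \sum_(j < m) (Num.sqrt j.+1%:R)^-1 <= 2 * Num.sqrt m%:R :> R.
Proof.
elim: m => [|m IH]; first by rewrite big_ord0 mulr_ge0 ?sqrtr_ge0.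
rewrite big_ord_recr /=; apply: le_trans (lerD IH (lexx _)) _.
set s := Num.sqrt m%:R; set t := Num.sqrt m.+1%:R.
have s0 : 0 <= s by exact: sqrtr_ge0.
have t0 : 0 < t by rewrite sqrtr_gt0 succ_gt0.
have ts : t ^+ 2 = s ^+ 2 + 1 by rewrite !sqr_sqrtr ?ler0n // natr1.
rewrite -(ler_pM2l t0) mulrDr divff ?gt_eqF //.
by have := sqr_ge0 (t - s); nra.
Qed.

(** * Kernels built from sequences of order [1 / sqrt n] *)

(** [Q] and [p] have the same asymptotics [c / sqrt n], with the increments that
    a local limit theorem gives. *)
Record local_seq (Q p : nat -> R) (c C : R) : Prop := LocalSeq {
  ls_c : 0 < c;
  ls_C : 0 <= C;
  ls_ge0 : forall i, 0 <= Q i;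
  ls_ub : forall i, Q i <= C / Num.sqrt i.+1%:R;
  ls_Q : forall e, 0 < e -> exists N, forall i, (N <= i)%N -> `|Num.sqrt i.+1%:R * Q i - c| <= e;
  ls_p : forall e, 0 < e -> exists N, forall i, (N <= i)%N -> `|Num.sqrt i.+1%:R * p i - c| <= e;
  ls_diff : forall J j, (0 < J)%N -> (2 * j <= J)%N ->
    `|Q (J - j)%N - p J| <= C * (j.+1%:R / (J.+1%:R * Num.sqrt J.+1%:R) + J.+1%:R^-1) }.

Section LocalKernel.
Variables (Q p : nat -> R) (c C : R).
Hypothesis hQ : local_seq Q p c C.

Definition kernel (b : bool) (J j : nat) : R :=
  if (j <= J)%N then Q (J - j)%N / p J - b%:R else - b%:R.

Let C0 := ls_C hQ.
Let c0 := ls_c hQ.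

Lemma ls_p_lb : exists J0, forall J, (J0 <= J)%N -> c / 2 / Num.sqrt J.+1%:R <= p J.
Proof.
have [N HN] := ls_p hQ (divr_gt0 c0 (@ltr0n R 2)); exists N => J NJ.
have s0 : 0 < Num.sqrt J.+1%:R :> R by rewrite sqrtr_gt0 succ_gt0.
by rewrite ler_pdivrMr // mulrC; have := HN J NJ; rewrite ler_norml => /andP[h _]; lra.
Qed.

Let half_ratio J j : (2 * j <= J)%N -> J.+1%:R <= 2 * (J - j).+1%:R :> R.
Proof. by move=> jJ; rewrite -natrM ler_nat; lia. Qed.

(** The gain [sqrt (j / J)] for small [j] in the centred case is what makes the
    sum over small [j] negligible. *)
Lemma kernel_small (b : bool) : exists2 D, 0 < D & exists J0, forall J j, (J0 <= J)%N ->
  (2 * j <= J)%N -> `|kernel b J j| <= D * (j.+1%:R / J.+1%:R) `^ (b%:R / 2).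
Proof.
have [J0 HJ] := ls_p_lb.
have D0 : 0 < 4 * C / c + 1 by apply: ltr_wpDl => //; rewrite divr_ge0 ?mulr_ge0 // ltW.
exists (4 * C / c + 1) => //; exists (maxn J0 1) => J j; rewrite geq_max => /andP[JJ J1] jJ.
have jJ' : (j <= J)%N by lia.
have sJ : 0 < Num.sqrt J.+1%:R :> R by rewrite sqrtr_gt0 succ_gt0.
have pl := HJ J JJ.
have pc : 0 < c / 2 / Num.sqrt J.+1%:R by rewrite !divr_gt0.
have p0 : 0 < p J by exact: lt_le_trans pl.
have ip : (p J)^-1 <= 2 / c * Num.sqrt J.+1%:R.
  have W0 : 0 < 2 / c * Num.sqrt J.+1%:R by rewrite mulr_gt0 // divr_gt0.
  by rewrite -[leRHS]invrK lef_pV2 ?posrE ?invr_gt0 // invfM invf_div.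
rewrite /kernel jJ'; case: b; last first.
  rewrite subr0 mul0r powRr0 mulr1 normrM ger0_norm ?(ls_ge0 hQ) // gtr0_norm ?invr_gt0 //.
  have sj : 0 < Num.sqrt (J - j).+1%:R :> R by rewrite sqrtr_gt0 succ_gt0.
  have rr : Num.sqrt J.+1%:R <= 2 * Num.sqrt (J - j).+1%:R :> R.
    rewrite -ler_sqr ?nnegrE ?mulr_ge0 ?sqrtr_ge0 // exprMn !sqr_sqrtr ?ler0n //.
    by apply: le_trans (half_ratio jJ) _; rewrite ler_wpM2r ?ler0n //; lra.
  apply: (@le_trans _ _ (C / Num.sqrt (J - j).+1%:R * (2 / c * Num.sqrt J.+1%:R))).
    by apply: ler_pM (ls_ge0 hQ _) _ (ls_ub hQ _) ip; rewrite invr_ge0 ltW.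
  rewrite (_ : _ * _ = 2 * C / c * (Num.sqrt J.+1%:R / Num.sqrt (J - j).+1%:R)); last by ring.
  have : Num.sqrt J.+1%:R / Num.sqrt (J - j).+1%:R <= 2 :> R by rewrite ler_pdivrMr.
  have : 0 <= 2 * C / c by rewrite divr_ge0 ?mulr_ge0 // ltW.
  have -> : 4 * C / c = 2 * (2 * C / c) by ring.
  by move: (_ / Num.sqrt _) (2 * C / c) => x y h1 h2; nra.
rewrite mul1r powR12_sqrt ?divr_ge0 ?ler0n //.
have -> : Q (J - j)%N / p J - 1 = (Q (J - j)%N - p J) / p J by field; rewrite gt_eqF.
rewrite normrM [`|_^-1|]gtr0_norm ?invr_gt0 //.
apply: le_trans (ler_pM (normr_ge0 _) _ (ls_diff hQ J1 jJ) ip) _; first by rewrite invr_ge0 ltW.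
have rt1 : (j.+1%:R / J.+1%:R : R) <= 1 by rewrite ler_pdivrMr ?succ_gt0 // mul1r ler_nat.
have rt0 : 0 < (j.+1%:R / J.+1%:R : R) by rewrite divr_gt0 ?succ_gt0.
set rt := j.+1%:R / J.+1%:R in rt0 rt1 *.
have q0 : 0 < Num.sqrt rt by rewrite sqrtr_gt0.
have q1 : Num.sqrt rt <= 1 by rewrite -[leRHS]sqrtr1 ler_sqrt.
have qq : rt <= Num.sqrt rt.
  by rewrite -[leLHS](sqr_sqrtr (ltW rt0)) expr2 ler_piMl // ltW.
have qJ : (Num.sqrt J.+1%:R)^-1 <= Num.sqrt rt :> R.
  rewrite -sqrtrV ?ler0n //; apply: ler_wsqrtr.
  by rewrite /rt; apply: ler_peMl; rewrite ?invr_ge0 // (ler_nat R 1).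
rewrite [leLHS](_ : _ = 2 * C / c * (rt + (Num.sqrt J.+1%:R)^-1)); last first.
  have sJJ : J.+1%:R = Num.sqrt J.+1%:R * Num.sqrt J.+1%:R :> R by rewrite -expr2 sqr_sqrtr ?ler0n.
  rewrite /rt; move: sJ sJJ; move: (Num.sqrt J.+1%:R) => s s0 ->.
  by field; rewrite !gt_eqF.
have y0 : 0 <= 2 * C / c by rewrite divr_ge0 ?mulr_ge0 // ltW.
have -> : 4 * C / c = 2 * (2 * C / c) by ring.
move: (2 * C / c) y0 => y y0; move: (_^-1) qJ => v qJ.
have : y * (rt + v) <= y * (2 * Num.sqrt rt) by rewrite ler_wpM2l //; lra.
by lra.
Qed.

(** The approximation fails for [j] close to [J], but these indices contribute
    little, since [sum_(i < m) i^(-1/2)] is only of order [sqrt m]. *)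
Lemma kernel_mean e : 0 < e -> exists J0, forall J, (J0 <= J)%N ->
  \sum_(j < J.+1) `|Q (J - j)%N / p J - Num.sqrt J.+1%:R / Num.sqrt (J - j).+1%:R| <= e * J.+1%:R.
Proof.
move=> e0; have [J1 HJ1] := ls_p_lb.
pose d := e * c / 16; have d0 : 0 < d by rewrite divr_gt0 // mulr_gt0.
have [N1 H1] := ls_Q hQ d0; have [N2 H2] := ls_p hQ d0.
have B0 : 0 <= (C + c) * N1%:R by rewrite mulr_ge0 // addr_ge0 // ltW.
pose B := (C + c) * N1%:R / d.
have [N3 H3] : exists N, forall J, (N <= J)%N -> B <= Num.sqrt J.+1%:R.
  exists (Num.bound (B ^+ 2)) => J NJ.
  have B1 : 0 <= B by rewrite divr_ge0 // ltW.
  rewrite -[B](ger0_norm B1) -sqrtr_sqr ler_sqrt ?ler0n //.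
  apply/ltW; apply: lt_le_trans (archi_boundP (sqr_ge0 _)) _.
  by rewrite ler_nat leqW.
exists (maxn J1 (maxn N2 N3)) => J; rewrite !geq_max => /andP[JJ1 /andP[JN2 JN3]].
have s0 : 0 < Num.sqrt J.+1%:R :> R by rewrite sqrtr_gt0 succ_gt0.
have pl := HJ1 J JJ1.
have pc : 0 < c / 2 / Num.sqrt J.+1%:R by rewrite !divr_gt0.
have p0 : 0 < p J by exact: lt_le_trans pl.
pose P := Num.sqrt J.+1%:R * p J.
have Pc : c / 2 <= P by move: pl; rewrite ler_pdivrMr // [p J * _]mulrC.
have P0 : 0 < P by apply: lt_le_trans Pc; rewrite divr_gt0.
rewrite (reindex_inj rev_ord_inj) /=.
have term i : (i <= J)%N -> `|Q i / p J - Num.sqrt J.+1%:R / Num.sqrt i.+1%:R| <=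
    2 / c * Num.sqrt J.+1%:R * (d * 2 * (Num.sqrt i.+1%:R)^-1 + (if (i < N1)%N then C + c else 0)).
  move=> iJ; have si : 0 < Num.sqrt i.+1%:R :> R by rewrite sqrtr_gt0 succ_gt0.
  have -> : Q i / p J - Num.sqrt J.+1%:R / Num.sqrt i.+1%:R =
    (Num.sqrt J.+1%:R / P) * ((Num.sqrt i.+1%:R * Q i - P) / Num.sqrt i.+1%:R).
    by rewrite /P; field; rewrite !gt_eqF.
  rewrite normrM gtr0_norm ?divr_gt0 //; apply: ler_pM => //.
    by rewrite divr_ge0 // ltW.
    rewrite mulrC ler_pM2r //.
    have c2 : 0 < 2 / c by rewrite divr_gt0.
    by rewrite -[leRHS]invrK lef_pV2 ?posrE ?invr_gt0 // invf_div.
  rewrite normrM [`|_^-1|]gtr0_norm ?invr_gt0 // -lerBlDl.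
  have hP := H2 J JN2; rewrite -/P in hP.
  have tri : `|Num.sqrt i.+1%:R * Q i - P| <= `|Num.sqrt i.+1%:R * Q i - c| + d.
    by apply: le_trans (ler_distD c _ _) _; rewrite lerD2l distrC.
  have is0 : 0 < (Num.sqrt i.+1%:R)^-1 :> R by rewrite invr_gt0.
  case: ltnP => iN; last first.
    have hQi := H1 i iN; rewrite subr_le0 ler_pM2r //.
    by apply: le_trans tri _; lra.
  have is1 : (Num.sqrt i.+1%:R)^-1 <= 1 :> R.
    by rewrite invf_le1 // -[leLHS]sqrtr1 ler_sqrt ?ler0n // (ler_nat R 1).
  have hQi : `|Num.sqrt i.+1%:R * Q i - c| <= C + c.
    have u := ls_ub hQ i; rewrite ler_pdivlMr // mulrC in u.
    have l : 0 <= Num.sqrt i.+1%:R * Q i by rewrite mulr_ge0 ?(ls_ge0 hQ) // ltW.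
    by apply: le_trans (ler_normB _ _) _; rewrite !ger0_norm ?(ltW c0) // lerD2r.
  have Cc : 0 <= C + c by rewrite addr_ge0 // ltW.
  move: is0 is1 tri hQi; move: (_^-1) => v; move: (`|_ - P|) (`|_ - c|) => x y; nra.
apply: le_trans (ler_sum _ (G := fun i : 'I_J.+1 => 2 / c * Num.sqrt J.+1%:R *
   (d * 2 * (Num.sqrt i.+1%:R)^-1 + (if (i < N1)%N then C + c else 0))) _) _.
  move=> i _; have iJ : (i <= J)%N by rewrite -ltnS.
  by rewrite subSS subKn //; exact: term.
rewrite -mulr_sumr big_split /= -mulr_sumr.
have S1 := sum_invsqrt J.+1.
have S2 : \sum_(i < J.+1) (if (i < N1)%N then C + c else 0) <= (C + c) * N1%:R.
  have E m : \sum_(i < m) (if (i < N1)%N then C + c else 0) = (C + c) * (minn m N1)%:R.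
    elim: m => [|m IHm]; first by rewrite big_ord0 min0n mulr0.
    rewrite big_ord_recr /= IHm; case: ltnP => mN.
      by rewrite (minn_idPl mN) -natr1 mulrDr mulr1.
    by rewrite (minn_idPr (leqW mN)) addr0.
  by rewrite E; apply: ler_wpM2l; [rewrite addr_ge0 // ltW|rewrite ler_nat geq_minr].
have sJ : Num.sqrt J.+1%:R * Num.sqrt J.+1%:R = J.+1%:R :> R by rewrite -expr2 sqr_sqrtr ?ler0n.
have S3 : (C + c) * N1%:R <= d * Num.sqrt J.+1%:R by have := H3 J JN3; rewrite /B ler_pdivrMr // [_ * d]mulrC.
rewrite -[X in _ <= e * X]sJ; set s := Num.sqrt J.+1%:R in s0 S1 S3 *.
apply: (@le_trans _ _ (2 / c * s * (d * 2 * (2 * s) + d * s))).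
  apply: ler_wpM2l; first by rewrite mulr_ge0 ?divr_ge0 // ltW.
  by apply: lerD; [rewrite ler_wpM2l ?mulr_ge0 // ltW|exact: le_trans S2 S3].
rewrite [leLHS](_ : _ = 10 / 16 * e * (s * s)); last by rewrite /d; field; rewrite gt_eqF.
by apply: ler_wpM2r; [rewrite mulr_ge0 // ltW|lra].
Qed.

End LocalKernel.
End PowerSums.

(** * The walk as a local sequence *)

Section WalkLocal.
Variables (R : realType) (xi : probability nat R) (sigma : R).
Hypothesis crit : critical xi sigma.
Variable h : nat.
Hypotheses (h0 : (0 < h)%N) (hc : controlled xi h).
Hypothesis hs : forall k, ~~ (h %| k)%N -> offspring xi k = 0.
Local Notation p := (offspring xi).

Definition local_const : R := h%:R / (sigma * Num.sqrt (2 * pi)) / Num.sqrt h%:R.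

Lemma local_const_gt0 : 0 < local_const.
Proof.
rewrite !divr_gt0 ?sqrtr_gt0 ?ltr0n // mulr_gt0 ?sqrtr_gt0 ?(sigma_gt0 crit) //.
by rewrite mulr_gt0 // pi_gt0.
Qed.

Let sqrt_sub_le (a b : R) : 0 <= b -> b <= a -> Num.sqrt a - Num.sqrt b <= Num.sqrt (a - b).
Proof.
move=> b0 ba; rewrite lerBlDr -ler_sqr ?nnegrE ?addr_ge0 ?sqrtr_ge0 //.
rewrite sqrrD !sqr_sqrtr ?subr_ge0 ?(le_trans b0 ba) //.
by have : 0 <= Num.sqrt (a - b) * Num.sqrt b by [rewrite mulr_ge0 ?sqrtr_ge0]; lra.
Qed.

Let sq_pos n : (0 < n)%N -> 0 < Num.sqrt n%:R :> R.
Proof. by move=> n0; rewrite sqrtr_gt0 ltr0n. Qed.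

Let walk_ub_succ : exists2 C, 0 < C & forall s J, (s <= 1)%N ->
  walk p (s + h * J) (h * J) <= C / Num.sqrt J.+1%:R.
Proof.
have [C C0 HC] := walk_ub crit h0 hc hs; exists (2 * C + 1); first by lra.
move=> s J s1; have sJ := sq_pos (ltn0Sn J).
have [n0|n0] := posnP (s + h * J).
  have J0 : J = 0%N by move: n0 h0; nia.
  have s0 : s = 0%N by lia.
  by rewrite J0 s0 muln0 /= sqrtr1 divr1; lra.
rewrite [X in walk p _ X](_ : _ = (s + h * J - s)%N); last by rewrite addKn.
apply: le_trans (HC _ _ n0 (leq_addr _ _)) _.
have sn := sq_pos n0.
have : Num.sqrt J.+1%:R <= 2 * Num.sqrt (s + h * J)%:R :> R.
  rewrite -ler_sqr ?nnegrE ?mulr_ge0 ?sqrtr_ge0 // exprMn !sqr_sqrtr ?ler0n //.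
  rewrite (_ : 2 ^+ 2 = 4%:R :> R); last by ring.
  by rewrite -natrM ler_nat; move: n0 h0; nia.
move=> le; rewrite ler_pdivrMr // mulrAC ler_pdivlMr //.
have : C * Num.sqrt J.+1%:R <= C * (2 * Num.sqrt (s + h * J)%:R) by rewrite ler_pM2l.
by lra.
Qed.

Let walk_succ_lim s e : (s <= 1)%N -> 0 < e -> exists N, forall J, (N <= J)%N ->
  `|Num.sqrt J.+1%:R * walk p (s + h * J) (h * J) - local_const| <= e.
Proof.
move=> s1 e0; have sh := sq_pos h0.
have [C C0 HC] := walk_ub_succ.
have d0 : 0 < e / 2 * Num.sqrt h%:R by rewrite mulr_gt0 // divr_gt0.
have [N HN] := walk_lim crit h0 hc hs d0.
pose B := 2 * C / e.
exists (maxn N (Num.bound (B ^+ 2))) => J; rewrite geq_max => /andP[NJ BJ].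
have B0 : 0 < B by rewrite divr_gt0 // mulr_gt0.
have sJ := sq_pos (ltn0Sn J).
have JB : B <= Num.sqrt J.+1%:R.
  rewrite -[B](ger0_norm (ltW B0)) -sqrtr_sqr; apply: ler_wsqrtr.
  apply/ltW; apply: lt_le_trans (archi_boundP (sqr_ge0 _)) _.
  by rewrite ler_nat leqW.
pose n := (s + h * J)%N; pose w := walk p n (h * J).
have w0 : 0 <= w by apply: walk_ge0; exact: offspring_ge0.
have wC : w <= C / Num.sqrt J.+1%:R by exact: HC.
have := HN n s; rewrite (_ : (n - s = h * J)%N); last by rewrite /n addKn.
rewrite dvdn_mulr // -/w => /(_ _ s1 isT) Hn.
have {}Hn : `|Num.sqrt n%:R * w - h%:R / (sigma * Num.sqrt (2 * pi))| <= e / 2 * Num.sqrt h%:R.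
  by apply: Hn; apply: leq_trans NJ _; rewrite /n; move: h0; nia.
rewrite -/n -/w /local_const.
have nh : (n <= h * J.+1)%N by rewrite /n; move: h0; nia.
have E : Num.sqrt J.+1%:R * Num.sqrt h%:R = Num.sqrt (h * J.+1)%:R :> R.
  by rewrite natrM sqrtrM ?ler0n // mulrC.
have D : Num.sqrt (h * J.+1)%:R - Num.sqrt n%:R <= Num.sqrt h%:R :> R.
  apply: le_trans (sqrt_sub_le _ _) _; rewrite ?ler0n ?ler_nat //.
  by apply: ler_wsqrtr; rewrite -natrB // ler_nat /n; nia.
have D0 : 0 <= Num.sqrt (h * J.+1)%:R - Num.sqrt n%:R :> R.
  by rewrite subr_ge0; apply: ler_wsqrtr; rewrite ler_nat.
set cc := h%:R / (sigma * _) in Hn *.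
have -> : Num.sqrt J.+1%:R * w - cc / Num.sqrt h%:R =
    (Num.sqrt (h * J.+1)%:R * w - cc) / Num.sqrt h%:R.
  by rewrite -E; field; rewrite gt_eqF.
rewrite normrM [`|_^-1|]gtr0_norm ?invr_gt0 // ler_pdivrMr //.
have -> : Num.sqrt (h * J.+1)%:R * w - cc = (Num.sqrt n%:R * w - cc) +
   (Num.sqrt (h * J.+1)%:R - Num.sqrt n%:R) * w by ring.
apply: le_trans (ler_normD _ _) _.
have -> : e * Num.sqrt h%:R = e / 2 * Num.sqrt h%:R + Num.sqrt h%:R * (e / 2) by field.
apply: lerD => //; rewrite ger0_norm ?mulr_ge0 //; apply: ler_pM => //.
apply: le_trans wC _; rewrite ler_pdivrMr // mulrC.
by move: JB; rewrite /B ler_pdivrMr //; lra.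
Qed.

Lemma walk_local_seq s : (s <= 1)%N -> exists C,
  local_seq (fun i => walk p (h * i) (h * i)) (fun J => walk p (s + h * J) (h * J)) local_const C.
Proof.
move=> s1; have [C C0 HC] := walk_ub_succ.
have [D D0 HD] := walk_diff crit h0 hc hs.
exists (C + 8 * D); split.
- exact: local_const_gt0.
- by lra.
- by move=> i; apply: walk_ge0; exact: offspring_ge0.
- move=> i; apply: le_trans (HC 0%N i isT) _.
  by rewrite ler_wpM2r ?invr_ge0 ?sqrtr_ge0 //; lra.
- by move=> e e0; exact: (@walk_succ_lim 0%N).
- by move=> e e0; exact: walk_succ_lim.
move=> J j J0 jJ; pose n := (h * (J - j))%N; pose d := (s + h * j)%N.
have n0 : (0 < n)%N by rewrite muln_gt0 h0; lia.
have nd : (n + d = s + h * J)%N.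
  by rewrite /n /d addnCA -mulnDr subnK //; lia.
have := HD n d 0%N s n0 isT s1; rewrite subn0 nd (_ : (s + h * J - s = h * J)%N) ?addKn //.
rewrite !dvdn_mulr // => /(_ isT isT) H; apply: le_trans H _.
have nR : 0 < n%:R :> R by rewrite ltr0n.
have sn := sq_pos n0; have sJ := sq_pos (ltn0Sn J).
have JR := @succ_gt0 R J.
have hR : 0 < h%:R :> R by rewrite ltr0n.
have n4 : h%:R * J.+1%:R <= 4 * n%:R :> R.
  by rewrite -!natrM ler_nat /n; move: h0; nia.
have n41 : J.+1%:R <= 4 * n%:R :> R.
  by rewrite -!natrM ler_nat /n; move: h0; nia.
have s4 : Num.sqrt J.+1%:R <= 2 * Num.sqrt n%:R :> R.
  rewrite -ler_sqr ?nnegrE ?mulr_ge0 ?sqrtr_ge0 // exprMn !sqr_sqrtr ?ler0n //.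
  by rewrite (_ : 2 ^+ 2 = 4%:R :> R) //; ring.
have dd : d%:R <= h%:R * j.+1%:R :> R by rewrite -natrM ler_nat /d; move: h0; nia.
have t1 : d%:R / (n%:R * Num.sqrt n%:R) <= 8 * (j.+1%:R / (J.+1%:R * Num.sqrt J.+1%:R)) :> R.
  rewrite mulrA ler_pdivrMr ?mulr_gt0 // mulrAC ler_pdivlMr ?mulr_gt0 //.
  apply: (@le_trans _ _ (h%:R * j.+1%:R * (J.+1%:R * Num.sqrt J.+1%:R))).
    by rewrite ler_wpM2r // mulr_ge0 // sqrtr_ge0.
  rewrite (_ : _ * _ = j.+1%:R * ((h%:R * J.+1%:R) * Num.sqrt J.+1%:R)); last by ring.
  rewrite [leRHS](_ : _ = j.+1%:R * ((4 * n%:R) * (2 * Num.sqrt n%:R))); last by ring.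
  by rewrite ler_wpM2l ?ler0n //; apply: ler_pM; rewrite ?mulr_ge0 ?ler0n ?sqrtr_ge0.
have t2 : n%:R^-1 <= 8 * J.+1%:R^-1 :> R.
  rewrite -[leLHS]mul1r ler_pdivrMr // mulrAC ler_pdivlMr // mul1r.
  by lra.
have u0 : 0 <= j.+1%:R / (J.+1%:R * Num.sqrt J.+1%:R) + J.+1%:R^-1 :> R.
  by rewrite addr_ge0 ?invr_ge0 // divr_ge0 // mulr_ge0 // sqrtr_ge0.
apply: (@le_trans _ _ (D * (8 * (j.+1%:R / (J.+1%:R * Num.sqrt J.+1%:R) + J.+1%:R^-1)))).
  by rewrite ler_pM2l // mulrDr lerD.
by rewrite mulrA ler_wpM2r // [D * 8]mulrC lerDr ltW.
Qed.

End WalkLocal.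

(** Wallis's formula, from the local limit theorem for [coin2]: the span is 1
    and the variance is [1 / 2]. *)
Lemma central_local_seq (R : realType) : exists C,
  local_seq (central R) (central R) (Num.sqrt pi)^-1 C.
Proof.
have [h h0 [hc hs]] := span_exists (coin2_critical R).
have h1 : h = 1%N.
  apply/eqP; rewrite -dvdn1; apply: contraT => /hs; rewrite coin2E /= mul0r add0r addr0 => /eqP.
  by rewrite mulf_eq0 oner_eq0 invr_eq0 pnatr_eq0.
have [C HC] := walk_local_seq (coin2_critical R) h0 hc hs (leq0n 1).
exists C; move: HC; rewrite h1.
have -> : (fun i => walk (offspring (coin2 R)) (1 * i) (1 * i)) = central R.
  by apply/funext => i; rewrite mul1n coin2_walk.
rewrite (_ : local_const _ _ = (Num.sqrt pi)^-1) //.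
have p0 : 0 < pi :> R by exact: pi_gt0.
rewrite /local_const sqrtr1 divr1 div1r sqrtrM //; congr (_^-1).
by rewrite mulrA mulVf ?mul1r // gt_eqF // sqrtr_gt0.
Qed.

(** * Replacing sequences and kernels by equivalent ones *)

Section Replacement.
Variables (R : realType) (Q p A pA : nat -> R) (c C cA CA : R).
Hypotheses (hQ : local_seq Q p c C) (hA : local_seq A pA cA CA).

Lemma powR_large (B y : R) : 0 < y -> exists q : nat, (2 <= q)%N /\ B <= q%:R `^ y.
Proof.
move=> y0; pose D := `|B| `^ y^-1.
exists (maxn 2 (Num.bound D)); split; first exact: leq_maxl.
apply: (@le_trans _ _ (D `^ y)).
  by rewrite /D -powRrM mulVf ?gt_eqF // powRr1 // ler_norm.
apply: ge0_ler_powR; rewrite ?nnegrE ?powR_ge0 ?ler0n //; first exact: ltW.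
apply: le_trans (ltW (archi_boundP (powR_ge0 _ _))) _.
by rewrite ler_nat leq_maxr.
Qed.

Lemma ratio_powR j J (r : R) : (j.+1%:R / J.+1%:R) `^ r = spow j r * spow J (- r).
Proof.
rewrite powRM ?invr_ge0 ?ler0n //; congr (_ * _).
by rewrite -powR_inv1 ?ler0n // -powRrM mulN1r.
Qed.

Let small_pow (y0 : R) q J (y : R) : 0 < y0 -> y0 <= y -> (2 <= q)%N -> (0 < J.+1 %/ q)%N ->
  spow (J.+1 %/ q).-1 y <= spow J y / q%:R `^ y0.
Proof.
move=> y00 yy q2 m0; set m := (J.+1 %/ q)%N in m0 *.
have q0 : 0 < q%:R :> R by rewrite ltr0n; lia.
rewrite ler_pdivlMr ?powR_gt0 // /spow prednK //.
apply: (@le_trans _ _ (m%:R `^ y * q%:R `^ y)).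
  by rewrite ler_wpM2l ?powR_ge0 // ler_powR // (ler_nat R 1); lia.
rewrite -powRM ?ler0n //; apply: ge0_ler_powR; rewrite ?nnegrE ?mulr_ge0 ?ler0n //.
  by apply: ltW; apply: lt_le_trans yy.
by rewrite -natrM ler_nat leq_trunc_div.
Qed.

Let mid_pow q J j (x X1 : R) : (2 <= q)%N -> (J.+1 < q * j.+1)%N -> (j <= J)%N -> `|x| <= X1 ->
  spow j (x - 1) <= spow J (x - 1) * q%:R `^ (X1 + 1).
Proof.
move=> q2 Jq jJ xX.
have q0 : 0 < q%:R :> R by rewrite ltr0n; lia.
have jp := @succ_gt0 R j; have Jp := @succ_gt0 R J.
have lq : ln J.+1%:R - ln j.+1%:R <= ln q%:R :> R.
  rewrite lerBlDr -lnM ?posrE // ler_ln ?posrE ?mulr_gt0 //.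
  by rewrite -natrM ler_nat ltnW.
have lj : 0 <= ln J.+1%:R - ln j.+1%:R :> R by rewrite subr_ge0 ler_ln ?posrE // ler_nat.
rewrite !spowE {1}/powR gt_eqF // -expRD ler_expR.
have x1 : `|x - 1| <= X1 + 1 by apply: le_trans (ler_normB _ _) _; rewrite normr1; lra.
move: x1; rewrite ler_norml => /andP[xl xu].
move: lq lj; move: (ln J.+1%:R) (ln j.+1%:R) (ln q%:R) => u v w lq lj.
have : (1 - x) * (u - v) <= (X1 + 1) * (u - v) by rewrite ler_wpM2r //; lra.
have : (X1 + 1) * (u - v) <= (X1 + 1) * w by rewrite ler_wpM2l //; lra.
by lra.
Qed.

Let kernel_diff b (e : R) : 0 < e -> exists J0, forall J, (J0 <= J)%N ->
  \sum_(j < J.+1) `|kernel Q p b J j - kernel A pA b J j| <= e * J.+1%:R.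
Proof.
move=> e0; have e20 : 0 < e / 2 by rewrite divr_gt0.
have [J1 H1] := kernel_mean hQ e20; have [J2 H2] := kernel_mean hA e20.
exists (maxn J1 J2) => J; rewrite geq_max => /andP[JJ1 JJ2].
rewrite [e]splitr mulrDl; apply: le_trans (lerD (H1 J JJ1) (H2 J JJ2)).
rewrite -big_split; apply: ler_sum => j _ /=; rewrite /kernel -ltnS ltn_ord.
set i := Num.sqrt _ / _; rewrite [X in `|X|](_ : _ = (Q (J - j)%N / p J - i) - (A (J - j)%N / pA J - i)); last by ring.
exact: ler_normB.
Qed.

Let kernel_l1 b : exists J0, forall J, (J0 <= J)%N ->
  \sum_(j < J.+1) `|kernel A pA b J j| <= 4 * J.+1%:R.
Proof.
have [J0 H0] := kernel_mean hA ltr01.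
exists J0 => J JJ; have {}H0 := H0 J JJ; rewrite mul1r in H0.
have -> : 4 * J.+1%:R = J.+1%:R + 2 * J.+1%:R + J.+1%:R :> R by ring.
have S1 : \sum_(j < J.+1) Num.sqrt J.+1%:R / Num.sqrt (J - j).+1%:R <= 2 * J.+1%:R :> R.
  rewrite (reindex_inj rev_ord_inj) /= -mulr_sumr.
  rewrite (eq_bigr (fun i : 'I_J.+1 => (Num.sqrt i.+1%:R)^-1)); last first.
    by move=> i _; have iJ : (i <= J)%N; [rewrite -ltnS|rewrite subSS subKn].
  apply: le_trans (ler_wpM2l (sqrtr_ge0 _) (sum_invsqrt R J.+1)) _.
  by rewrite mulrCA -expr2 sqr_sqrtr // ler0n.
have S2 : \sum_(j < J.+1) 1 = J.+1%:R :> R by rewrite sumr_const card_ord.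
rewrite -[X in _ <= _ + X]S2; apply: le_trans (lerD (lerD H0 S1) (lexx _)).
rewrite -!big_split; apply: ler_sum => j _ /=; rewrite /kernel -ltnS ltn_ord.
have i0 : 0 <= Num.sqrt J.+1%:R / Num.sqrt (J - j).+1%:R :> R by rewrite divr_ge0 ?sqrtr_ge0.
set i := Num.sqrt _ / _ in i0 *; set k := A _ / _.
rewrite (_ : k - b%:R = (k - i) + i - b%:R); last by ring.
apply: le_trans (ler_normB _ _) _; apply: lerD; last by rewrite normr_nat lern1 leq_b1.
by apply: le_trans (ler_normD _ _) _; rewrite (ger0_norm i0).
Qed.

(** Only indices [j] of order [J] matter: for [j <= J / q] both kernels are
    bounded by [(j / J)^(b/2)], which makes the sum a convergent one of order
    [q^(-y0)]; on the rest the weights are comparable to [J^(x-1)] and the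
    kernels are close in mean; beyond [J] the kernels agree. *)
Lemma kernel_replacement (b : bool) (y0 X1 Cv : R) (eps : nat -> R) (eta : R) :
  0 < y0 -> 0 <= X1 -> 0 <= Cv -> (forall j, 0 <= eps j) ->
  (forall e, 0 < e -> exists N, forall j, (N <= j)%N -> eps j <= e) -> 0 < eta ->
  exists J1, forall J N x (v v' : nat -> Cplx R), (J1 <= J)%N -> (J < N)%N ->
    `|x| <= X1 -> y0 <= x + b%:R / 2 -> (b -> x <= - y0) ->
    (forall j, cabs (v j) <= Cv * spow j (x - 1)) ->
    (forall j, cabs (v' j) <= Cv * spow j (x - 1)) ->
    (forall j, cabs (v j - v' j) <= eps j * spow j (x - 1)) ->
    cabs (\sum_(j < N) (v j * ofR (kernel Q p b J j) - v' j * ofR (kernel A pA b J j)))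
      <= eta * spow J x.
Proof.
move=> y00 X10 Cv0 eps0 epsl eta0.
have [D1 D10 [K1 HK1]] := kernel_small hQ b; have [D2 D20 [K2 HK2]] := kernel_small hA b.
have [Cy Cy0 HCy] := sum_spow_le y00.
pose D := D1 + D2; have D0 : 0 < D by rewrite addr_gt0.
have eta3 : 0 < eta / 3 by rewrite divr_gt0.
have eta6 : 0 < eta / 6 by rewrite divr_gt0.
have [q [q2 Hq]] := powR_large (Cv * D * Cy / (eta / 3)) y00.
have q0 : 0 < q%:R :> R by rewrite ltr0n; apply: leq_trans q2.
pose W := q%:R `^ (X1 + 1); have W0 : 0 < W by rewrite powR_gt0.
pose e' := eta / 6 / (W * (Cv + 1)).
have Cv1 : 0 < Cv + 1 by rewrite ltr_wpDl.
have e'0 : 0 < e' by rewrite divr_gt0 // mulr_gt0.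
pose ep := Num.min (eta / 6 / (W * 4)) (eta / 3 * y0).
have ep0 : 0 < ep by rewrite lt_min !divr_gt0 ?mulr_gt0.
have [Ne HNe] := epsl ep ep0.
have [K3 HK3] := kernel_diff b e'0; have [K4 HK4] := kernel_l1 b.
exists (maxn (maxn K1 K2) (maxn (maxn K3 K4) (q * Ne.+1))) => J N x v v'.
rewrite !geq_max => /andP[/andP[JK1 JK2] /andP[/andP[JK3 JK4] JN]] JltN xX1 yx bx hv hv' hvv.
pose y := x + b%:R / 2; pose K := kernel Q p b J; pose K' := kernel A pA b J.
pose t j := v j * ofR (K j) - v' j * ofR (K' j).
have tE j : t j = v j * ofR (K j - K' j) + (v j - v' j) * ofR (K' j).
  by rewrite /t ofRB; ring.
have t2 j : cabs (t j) <= Cv * spow j (x - 1) * `|K j - K' j| + eps j * spow j (x - 1) * `|K' j|.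
  rewrite tE; apply: le_trans (cabsD _ _) _; rewrite !cabsM !cabs_ofR.
  by apply: lerD; rewrite ler_wpM2r.
rewrite -/t -(big_mkord xpredT t) (big_cat_nat (n := J.+1)) //=.
have sJ0 := spow_ge0 J x.
pose sb j := if (q * j.+1 <= J.+1)%N then Cv * D * spow J (- (b%:R / 2)) * spow j (y - 1) else 0.
pose mb j := spow J (x - 1) * W * (Cv * `|K j - K' j| + ep * `|K' j|).
have sb0 j : 0 <= sb j.
  rewrite /sb; case: ifP => // _; apply: mulr_ge0; last exact: spow_ge0.
  by rewrite mulr_ge0 ?spow_ge0 // mulr_ge0 // ltW.
have mb0 j : 0 <= mb j.
  apply: mulr_ge0; first by rewrite mulr_ge0 ?spow_ge0 // ltW.
  by rewrite addr_ge0 // mulr_ge0 // ltW.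
have tb j : (j < J.+1)%N -> cabs (t j) <= sb j + mb j.
  rewrite ltnS => jJ; case: (leqP (q * j.+1) J.+1) => qj.
    apply: ler_wpDr => //; rewrite /sb qj.
    have jJ2 : (2 * j <= J)%N.
      rewrite -ltnS; apply: leq_trans qj; apply: (@leq_trans (2 * j.+1)).
        by rewrite ltn_pmul2l.
      by rewrite leq_mul2r q2 orbT.
    apply: le_trans (cabsB _ _) _; rewrite !cabsM !cabs_ofR.
    have := HK1 J j JK1 jJ2; have := HK2 J j JK2 jJ2; rewrite ratio_powR.
    rewrite -/K -/K'; set P := spow j _ * spow J _ => h2 h1.
    have P0 : 0 <= P by rewrite mulr_ge0 ?spow_ge0.
    have -> : Cv * D * spow J (- (b%:R / 2)) * spow j (y - 1) = Cv * spow j (x - 1) * (D1 * P) + Cv * spow j (x - 1) * (D2 * P).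
      by rewrite (_ : y - 1 = (x - 1) + b%:R / 2) ?spowD /P /D /y; ring.
    by apply: lerD; apply: ler_pM; rewrite ?cabs_ge0.
  rewrite /sb leqNgt qj /= add0r; apply: le_trans (t2 j) _.
  have mp := mid_pow q2 qj jJ xX1; rewrite -/W in mp.
  have ej : eps j <= ep.
    apply: HNe; rewrite -ltnS -(@ltn_pmul2l q); last by apply: leq_trans q2.
    apply: leq_ltn_trans qj; apply: leq_trans (leqnSn _); apply: leq_trans JN.
    by rewrite leq_mul2l leqnSn orbT.
  rewrite /mb mulrDr; apply: lerD.
    rewrite mulrCA mulrA; apply: ler_wpM2r => //; apply: ler_wpM2l => //.
  rewrite mulrCA mulrA; apply: ler_wpM2r => //; apply: ler_pM => //; exact: spow_ge0.
have sumsb : \sum_(0 <= j < J.+1) sb j <= eta / 3 * spow J x.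
  have -> : \sum_(0 <= j < J.+1) sb j = \sum_(0 <= j < J.+1 %/ q) Cv * D * spow J (- (b%:R / 2)) * spow j (y - 1).
    have mJ : (J.+1 %/ q <= J.+1)%N by exact: leq_div.
    rewrite (big_cat_nat (n := (J.+1 %/ q)%N)) //= [X in _ + X]big_nat [X in _ + X]big1 ?addr0; last first.
      move=> j /andP[mj _].
      by rewrite /sb mulnC -leq_divRL ?(leq_trans _ q2) // ltnNge mj.
    rewrite !big_nat; apply: eq_bigr => j /andP[_ jm].
    by rewrite /sb mulnC -leq_divRL ?(leq_trans _ q2) // jm.
  rewrite -mulr_sumr.
  have [m0|m0] := posnP (J.+1 %/ q); first by rewrite m0 big_geq // mulr0 mulr_ge0 // ltW.
  rewrite -{1}(prednK m0) big_mkord.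
  have Z0 : 0 <= Cv * D * spow J (- (b%:R / 2)).
    by rewrite mulr_ge0 ?spow_ge0 // mulr_ge0 // ltW.
  apply: le_trans (ler_wpM2l Z0 (HCy y _ yx)) _.
  apply: le_trans (ler_wpM2l Z0 (ler_wpM2l (ltW Cy0) (small_pow y00 yx q2 m0))) _.
  have -> : spow J y = spow J x * spow J (b%:R / 2) by rewrite -spowD.
  rewrite spowN [leLHS](_ : _ = Cv * D * Cy / q%:R `^ y0 * spow J x); last first.
    by field; rewrite !gt_eqF ?spow_gt0 ?powR_gt0.
  apply: ler_wpM2r => //; rewrite ler_pdivrMr ?powR_gt0 //.
  by move: Hq; rewrite ler_pdivrMr // [_ * (eta / 3)]mulrC.
have summb : \sum_(0 <= j < J.+1) mb j <= eta / 3 * spow J x.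
  rewrite -mulr_sumr big_split /= -!mulr_sumr !big_mkord.
  have h3 : Cv * \sum_(i < J.+1) `|K i - K' i| <= Cv * (e' * J.+1%:R) by rewrite ler_wpM2l // HK3.
  have h4 : ep * \sum_(i < J.+1) `|K' i| <= ep * (4 * J.+1%:R) by rewrite ler_wpM2l ?HK4 // ltW.
  have Z0 : 0 <= spow J (x - 1) * W by rewrite mulr_ge0 ?spow_ge0 // ltW.
  apply: le_trans (ler_wpM2l Z0 (lerD h3 h4)) _.
  rewrite spowB1 [leLHS](_ : _ = W * (Cv * e' + ep * 4) * spow J x); last first.
    by field; rewrite gt_eqF ?succ_gt0.
  apply: ler_wpM2r => //; rewrite mulrDr.
  have u1 : W * (Cv * e') <= eta / 6.
    rewrite /e' [leLHS](_ : _ = eta / 6 * (Cv / (Cv + 1))); last by field; rewrite !gt_eqF.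
    by rewrite ler_piMr ?(ltW eta6) // ler_pdivrMr // mul1r lerDl.
  have u2 : W * (ep * 4) <= eta / 6.
    have : ep <= eta / 6 / (W * 4) by rewrite ge_min lexx.
    by rewrite ler_pdivlMr ?mulr_gt0 // mulrCA.
  by lra.
have tail : cabs (\sum_(J.+1 <= j < N) t j) <= eta / 3 * spow J x.
  apply: le_trans (cabs_sum _ _ _) _.
  have tt j : (J < j)%N -> t j = (v j - v' j) * ofR (- b%:R).
    by move=> Jj; rewrite /t /K /K' /kernel leqNgt Jj /= mulrBl.
  have [bT|/negbTE bF] := boolP b; last first.
    rewrite big_nat big1; first by apply: mulr_ge0 => //; exact: ltW.
    by move=> j /andP[Jj _]; rewrite tt // bF oppr0 ofR0 mulr0 cabs0.
  apply: (@le_trans _ _ (\sum_(J.+1 <= j < N) ep * spow j (x - 1))).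
    rewrite !big_nat; apply: ler_sum => j /andP[Jj _].
    rewrite tt // bT cabsM cabs_ofR normrN normr1 mulr1.
    apply: le_trans (hvv j) _; apply: ler_wpM2r; first exact: spow_ge0.
    apply: HNe; apply: leq_trans (ltnW Jj); apply: leq_trans JN.
    by apply: leq_trans (leqnSn _) _; apply: leq_pmull; apply: leq_trans q2.
  rewrite -mulr_sumr; apply: le_trans (ler_wpM2l (ltW ep0) (tail_spow_le J N y00 (bx bT))) _.
  rewrite mulrA ler_wpM2r // ler_pdivrMr // ge_min lexx orbT //.
rewrite (_ : eta * _ = eta / 3 * spow J x + eta / 3 * spow J x + eta / 3 * spow J x); last by field.
apply: le_trans (cabsD _ _) _; apply: lerD => //.
apply: le_trans (cabs_sum _ _ _) _; apply: le_trans (lerD sumsb summb).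
rewrite -big_split /= !big_nat; apply: ler_sum => j /andP[_ jJ]; exact: tb.
Qed.

End Replacement.

(** * The mean of [X_n(alpha)] *)

Section MeanAsymptotics.
Variables (R : realType) (xi : probability nat R) (sigma : R).
Hypothesis crit : critical xi sigma.
Variable h : nat.
Hypotheses (h0 : (0 < h)%N) (hc : controlled xi h).
Hypothesis hs : forall k, ~~ (h %| k)%N -> offspring xi k = 0.
Local Notation p := (offspring xi).

(** With [n = 1 + h J], these are [P(S_(h i) = h i)] and [P(S_n = n - 1)]. *)
Definition ret (i : nat) : R := walk p (h * i) (h * i).
Definition hit (J : nat) : R := walk p (1 + h * J) (h * J).

Lemma hitE J : hit J = (1 + h * J)%:R * size_prob xi (1 + h * J).
Proof. by rewrite /hit add1n size_prob_walk. Qed.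

Lemma size_prob_span m : (0 < m)%N -> ~~ (h %| m.-1)%N -> size_prob xi m = 0.
Proof.
case: m => // m _ /= hm; apply: (@mulfI _ m.+1%:R); first by rewrite pnatr_eq0.
by rewrite size_prob_walk mulr0 (walk_span hs).
Qed.

Lemma sum_span (V : zmodType) (f : nat -> V) J :
  (forall m, (0 < m)%N -> ~~ (h %| m.-1)%N -> f m = 0) ->
  \sum_(1 <= m < (1 + h * J).+1) f m = \sum_(j < J.+1) f (1 + h * j)%N.
Proof.
move=> f0; elim: J => [|J IH]; first by rewrite muln0 big_nat1 big_ord1 muln0.
rewrite (big_cat_nat (n := (1 + h * J).+1)) //=; last by rewrite ltnS leq_add2l leq_mul2l leqnSn orbT.
rewrite IH [RHS]big_ord_recr /=; congr (_ + _).
have JJ : (h * J < h * J.+1)%N by rewrite ltn_mul2l h0 ltnSn.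
rewrite big_nat_recr /=; last by rewrite ltn_add2l.
rewrite big_nat big1 ?add0r // => m /andP[m1 m2]; apply: f0; first exact: leq_trans m1.
apply/negP => /dvdnP[k km]; rewrite mulnC in km.
have [m3 m4] : (h * J < m.-1)%N /\ (m.-1 < h * J.+1)%N by case: m m1 m2 km => //.
by move: m3 m4; rewrite km !ltn_pmul2l // ltnS => /leq_trans kJ /kJ; rewrite ltnn.
Qed.

Definition fringe_term (alpha : Cplx R) (j : nat) : Cplx R :=
  npow (1 + h * j) alpha * ofR (size_prob xi (1 + h * j)).

Lemma cgw_mean_walk J (alpha : Cplx R) : 0 < hit J ->
  cgw_cmean xi (1 + h * J) (fun u => treeX u alpha) =
  (1 + h * J)%:R * \sum_(j < J.+1) fringe_term alpha j * ofR (ret (J - j) / hit J).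
Proof.
move=> hJ; have n0 : (1 + h * J)%:R != 0 :> R by rewrite pnatr_eq0.
rewrite cgw_cmean_treeX sum_span; last first.
  by move=> m m0 hm; rewrite size_prob_span // !mul0r ofR0 mulr0.
rewrite mulr_sumr; apply: eq_bigr => j _.
have jJ : (j <= J)%N by rewrite -ltnS.
rewrite /fringe_term -[_ * _ * ofR (ret _ / _)]mulrA [RHS]mulrCA; congr (_ * _); rewrite -ofR_nat -!ofRM; congr ofR.
rewrite (_ : (1 + h * J - (1 + h * j) = h * (J - j))%N); last by rewrite subnDl mulnBr.
rewrite -/(ret _) (_ : size_prob xi (1 + h * J) = hit J / (1 + h * J)%:R); last first.
  by rewrite hitE mulrC mulKf.
move: n0; move: (1 + h * J)%:R => N n0; field.
by rewrite n0 gt_eqF.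
Qed.

Lemma size_prob_ub : exists2 C, 0 < C & forall m, size_prob xi m.+1 <= C / (m.+1%:R * Num.sqrt m.+1%:R).
Proof.
have [C C0 HC] := walk_ub crit h0 hc hs; exists C => // m.
have := HC m.+1 1%N isT isT; rewrite subSS subn0 -size_prob_walk mulrC.
by rewrite -ler_pdivlMr ?succ_gt0 // -mulrA -invfM [Num.sqrt _ * _]mulrC.
Qed.

Lemma spow_small (d e : R) : 0 < d -> 0 < e -> exists N, forall j x, (N <= j)%N -> x <= - d ->
  spow j x <= e.
Proof.
move=> d0 e0; have [q [_ Hq]] := powR_large e^-1 d0; exists q => j x qj xd.
apply: (@le_trans _ _ (spow j (- d))); first by rewrite /spow ler_powR // (ler_nat R 1).
rewrite spowN -[leRHS]invrK lef_pV2 ?posrE ?spow_gt0 ?invr_gt0 //.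
apply: le_trans Hq _; apply: ge0_ler_powR; rewrite ?nnegrE ?ler0n //; first exact: ltW.
by rewrite ler_nat leqW.
Qed.

(** The terms are of order [m^(Re alpha - 3/2)]. *)
Lemma mu_climit (alpha : Cplx R) : cRe alpha < 2^-1 ->
  climit (fun J => \sum_(j < J.+1) fringe_term alpha j) (mu xi alpha).
Proof.
move=> ha; pose d := 2^-1 - cRe alpha; have d0 : 0 < d by rewrite subr_gt0.
have [C C0 HC] := size_prob_ub.
pose S N := \sum_(1 <= n < N.+2) npow n alpha * ofR (size_prob xi n).
have Cd : 0 < C * d^-1 by rewrite mulr_gt0 // invr_gt0.
have [||l Sl _] := @cauchy_climit R S (fun N => C * (d^-1 * spow N (- d))).
- move=> e e0; have [N HN] := spow_small d0 (divr_gt0 e0 Cd).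
  exists N => j Nj; have := HN j (- d) Nj (lexx _).
  by rewrite ler_pdivlMr // mulrC mulrA.
- move=> j k jk; rewrite /S (@big_cat_nat _ _ _ j.+2 1 k.+2) //= addrAC subrr add0r.
  apply: le_trans (cabs_sum _ _ _) _.
  apply: le_trans (ler_wpM2l (ltW C0) (tail_spow_le j k.+1 d0 (lexx _))).
  rewrite mulr_sumr big_add1 /=; apply: ler_sum => m _; rewrite cabsM cabs_npow // cabs_ofR ger0_norm ?size_prob_ge0 //.
  apply: le_trans (ler_wpM2l (powR_ge0 _ _) (HC m)) _.
  have -> : m.+1%:R `^ cRe alpha = spow m (- d) * spow m 2^-1.
    by rewrite -spowD /spow /d; congr (_ `^ _); ring.
  rewrite spow_half spowB1 [leLHS](_ : _ = C * (spow m (- d) / m.+1%:R)) //.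
  by field; rewrite !gt_eqF ?sqrtr_gt0 ?succ_gt0.
have -> : mu xi alpha = l.
  apply: climit_lim => e e0; have [N HN] := Sl e e0.
  exists N.+2 => n Nn; have := HN (n - 2)%N; rewrite /S.
  by rewrite (_ : (n - 2).+2 = n) ?subn2; [apply; lia|lia].
move=> e e0; have [N HN] := Sl e e0; exists N => J NJ.
have := HN (h * J)%N; rewrite /S -[(h * J).+2]/((1 + h * J).+1) sum_span; last first.
  by move=> m m0 hm; rewrite size_prob_span // ofR0 mulr0.
by apply; apply: leq_trans NJ _; rewrite leq_pmull.
Qed.

(** ** Comparison with the rising factorials *)

Let c1 := local_const sigma h.

(** By [gamma_uniform], [cGamma z * rising z j] has the order [j^(z-1)], and the
    constant is that of the local limit theorem. *)
Definition model_term (z : Cplx R) (j : nat) : Cplx R :=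
  npow h (z - chalf R) * ofR c1 * cGamma z * rising z j.

Let lnr j : R := ln ((1 + h * j)%:R / (h * j.+1)%:R).
Let rr j (w : Cplx R) : Cplx R := cexp (w * ofR (lnr j)).

Let npow_rr j w : npow (1 + h * j) w = npow h w * npow j.+1 w * rr j w.
Proof.
rewrite -npowMn // /rr /npow -cexpD; congr cexp.
rewrite /lnr ln_div ?posrE ?ltr0n ?muln_gt0 ?h0 // ofRB; ring.
Qed.

Let lnr_bound j : `|lnr j| <= h%:R / j.+1%:R.
Proof.
have a0 : 0 < (1 + h * j)%:R :> R by rewrite ltr0n.
have b0 : 0 < (h * j.+1)%:R :> R by rewrite ltr0n muln_gt0 h0.
have ab : (1 + h * j <= h * j.+1)%N by rewrite mulnS leq_add2r.
rewrite ler0_norm; last first.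
  by rewrite /lnr ln_le0 // ler_pdivrMr // mul1r ler_nat.
rewrite /lnr -lnV ?posrE ?divr_gt0 // invf_div.
have x1 : -1 < (h * j.+1)%:R / (1 + h * j)%:R - 1 :> R.
  by rewrite ltrBrDr addNr divr_gt0.
have := le_ln1Dx x1; rewrite addrC subrK => le; apply: le_trans le _.
have -> : (h * j.+1)%:R / (1 + h * j)%:R - 1 = (h.-1)%:R / (1 + h * j)%:R :> R.
  apply: (mulIf (lt0r_neq0 a0)); rewrite mulrBl !divfK ?lt0r_neq0 // mul1r -natrB //.
  by rewrite mulnS subnDr subn1.
apply: ler_pM; rewrite ?invr_ge0 ?ler0n ?ler_nat ?leq_pred //.
by rewrite lef_pV2 ?posrE ?succ_gt0 // ler_nat add1n ltnS leq_pmull.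
Qed.

Let rr_bound M : 0 <= M -> exists2 B, 0 <= B & forall j w, cabs w <= M ->
  cabs (rr j w - 1) <= B / j.+1%:R.
Proof.
move=> M0; pose L := M * h%:R; have L0 : 0 <= L by rewrite mulr_ge0.
have E0 : 0 <= 1 + 4 * expR L * L by rewrite addr_ge0 // mulr_ge0 // mulr_ge0 // expR_ge0.
exists ((1 + 4 * expR L * L) * L); first by rewrite mulr_ge0.
move=> j w wM; have b : cabs (w * ofR (lnr j)) <= L / j.+1%:R.
  rewrite cabsM cabs_ofR /L -mulrA; apply: ler_pM; rewrite ?cabs_ge0 ?normr_ge0 //.
have bL : cabs (w * ofR (lnr j)) <= L.
  by apply: le_trans b _; rewrite ler_pdivrMr ?succ_gt0 // ler_peMr // (ler_nat R 1).
apply: le_trans (cexp_sub1 bL) _; rewrite -[leRHS]mulrA; exact: (ler_wpM2l E0 b).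
Qed.

Let F (z : Cplx R) j : Cplx R := npow h (z - chalf R) * npow j.+1 (z - 1).

Let half_half : chalf R + chalf R = 1.
Proof. by rewrite /chalf -ofRD -ofR1; congr ofR; field. Qed.

Let npow_half j : npow j.+1 (chalf R) = ofR (Num.sqrt j.+1%:R).
Proof. by rewrite /chalf npow_ofR // powR12_sqrt. Qed.

Let termE z j : fringe_term (z + chalf R) j =
  F z j * (rr j (z - chalf R) * ofR (Num.sqrt j.+1%:R * hit j)).
Proof.
rewrite /fringe_term /F (_ : z + chalf R = (z - chalf R) + 1); last first.
  by rewrite -half_half; ring.
rewrite npowD npow1 // hitE !ofRM ofR_nat npow_rr.
rewrite [npow j.+1 (z - chalf R)](_ : _ = npow j.+1 (z - 1) * npow j.+1 (chalf R)); last first.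
  by rewrite -npowD; congr npow; rewrite -half_half; ring.
by rewrite npow_half; ring.
Qed.

Let modelE z j : model_term z j = F z j * (ofR c1 * (cGamma z * gseq z j)).
Proof.
rewrite /model_term /F /gseq -[1 - z]opprB npowN; field.
by rewrite npow_neq0.
Qed.

Let H M : R := expR ((M + 1) * ln h%:R).

Let lnh : 0 <= ln h%:R :> R. Proof. by rewrite ln_ge0 // (ler_nat R 1). Qed.

Let chalf_abs : cabs (chalf R) <= 1.
Proof. by rewrite cabs_ofR ger0_norm ?invr_ge0 // invf_le1 // (ler_nat R 1). Qed.

Let npowh_bound M w : cabs w <= M + 1 -> cabs (npow h w) <= H M.
Proof.
move=> wM; rewrite /npow cabs_cexp ler_expR cReM cRe_ofR cIm_ofR mulr0 subr0.
by rewrite ler_wpM2r // (le_trans (ler_norm _)) // (le_trans (cabs_Re w)).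
Qed.

Let F_bound M z j : cabs z <= M -> cabs (F z j) <= H M * spow j (cRe z - 1).
Proof.
move=> zM; rewrite /F cabsM [cabs (npow j.+1 _)]cabs_npow // cReB cRe1; apply: ler_wpM2r; first exact: powR_ge0.
by apply: npowh_bound; apply: le_trans (cabsB _ _) _; apply: lerD => //; exact: chalf_abs.
Qed.

Let hit_ub : exists2 C, 0 < C & forall j, Num.sqrt j.+1%:R * hit j <= C.
Proof.
have [C C0 HC] := walk_ub crit h0 hc hs; exists C => // j.
have := HC (1 + h * j)%N 1%N isT isT; rewrite addKn -/(hit j) => le.
have s0 : 0 < Num.sqrt j.+1%:R :> R by rewrite sqrtr_gt0 succ_gt0.
rewrite mulrC -ler_pdivlMr //; apply: le_trans le _; rewrite ler_wpM2l ?(ltW C0) //.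
rewrite lef_pV2 ?posrE ?sqrtr_gt0 ?ltr0n //; apply: ler_wsqrtr.
by rewrite ler_nat add1n ltnS leq_pmull.
Qed.

Let hit_ge0 j : 0 <= hit j.
Proof. by apply: walk_ge0; exact: offspring_ge0. Qed.

(** The values [z = alpha - 1/2] in a compact part of the domain; [b] tells
    whether the sum is centred. *)
Record zone (b : bool) (M d y0 : R) (z : Cplx R) : Prop := Zone {
  zone_away : away M d z;
  zone_half : away (M + 1) d (z + chalf R);
  zone_lb : y0 <= cRe z + b%:R / 2;
  zone_ub : b -> cRe z <= - y0 }.

Let term_replacement (b : bool) M d y0 eta : 0 <= M -> 0 < d -> 0 < y0 -> 0 < eta ->
  exists J1, forall J N z, (J1 <= J)%N -> (J < N)%N -> zone b M d y0 z ->
    cabs (\sum_(j < N) (fringe_term (z + chalf R) j * ofR (kernel ret hit b J j) -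
       model_term z j * ofR (kernel (central R) (central R) b J j))) <= eta * spow J (cRe z).
Proof.
move=> M0 d0 y00 eta0.
have [C hQ] := walk_local_seq crit h0 hc hs (leqnn 1).
have [CA hA] := central_local_seq R.
have M1 : 0 <= M + 1 by rewrite addr_ge0.
have [B B0 HB] := rr_bound M1; have [K K0 HK] := gamma_uniform M0 d0.
have [P P0 HP] := hit_ub.
have H0 : 0 < H M by exact: expR_gt0.
have c10 : 0 < c1 by exact: (local_const_gt0 crit h0).
pose pi_ j := Num.sqrt j.+1%:R * hit j.
have pi0 j : 0 <= pi_ j by rewrite mulr_ge0 ?sqrtr_ge0 ?hit_ge0.
pose G := B * P + c1 * K.
have G0 : 0 <= G by apply: addr_ge0; apply: mulr_ge0 => //; exact: ltW.
pose eps j := H M * (G / j.+1%:R + `|pi_ j - c1|).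
have eps0 j : 0 <= eps j.
  by apply: mulr_ge0; [exact: ltW|apply: addr_ge0 => //; rewrite divr_ge0].
have epsl e : 0 < e -> exists N, forall j, (N <= j)%N -> eps j <= e.
  move=> e0; have e1 : 0 < e / 2 / H M by rewrite !divr_gt0.
  have [N1 HN1] := ls_p hQ e1.
  have G1 : 0 < G + 1 by rewrite ltr_wpDl.
  have [N2 HN2] := nat_inv_small (divr_gt0 e1 G1).
  exists (maxn N1 N2) => j; rewrite geq_max => /andP[jN1 jN2].
  have h1 := HN1 j jN1.
  have h2 : G / j.+1%:R <= e / 2 / H M.
    apply: (@le_trans _ _ ((G + 1) / j.+1%:R)); first by rewrite ler_wpM2r ?invr_ge0 // lerDl.
    by have := HN2 j jN2; rewrite ler_pdivlMr // mulrC.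
  rewrite /eps mulrC -ler_pdivlMr // [e]splitr.
  by rewrite [leRHS]mulrDl; apply: lerD.
pose Cv := H M * ((1 + B) * P + c1 * (1 + K)).
have Cv0 : 0 <= Cv.
  apply: mulr_ge0; first exact: ltW.
  by apply: addr_ge0; apply: mulr_ge0; rewrite ?addr_ge0 ?(ltW P0) ?(ltW c10) ?(ltW K0).
have [J1 HJ1] := kernel_replacement hQ hA b y00 M0 Cv0 eps0 epsl eta0.
exists J1 => J N z JJ JN [az _ zl zu].
have [zM za] := az; have [_ _ _ HG _] := HK z az.
have wM : cabs (z - chalf R) <= M + 1.
  by apply: le_trans (cabsB _ _) _; apply: lerD => //; exact: chalf_abs.
have Fb j := F_bound j zM.
have inv1 j (x : R) : 0 <= x -> x / j.+1%:R <= x.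
  by move=> x0; rewrite ler_pdivrMr ?succ_gt0 // ler_peMr // (ler_nat R 1).
have sp j : 0 <= H M * spow j (cRe z - 1) by rewrite mulr_ge0 ?spow_ge0 // ltW.
have cpi j : cabs (ofR (pi_ j)) = pi_ j by rewrite cabs_ofR ger0_norm.
have cc1 : cabs (ofR c1) = c1 by rewrite cabs_ofR gtr0_norm.
have rb j : cabs (rr j (z - chalf R)) <= 1 + B.
  rewrite (_ : rr j _ = 1 + (rr j (z - chalf R) - 1)); last by ring.
  apply: le_trans (cabsD _ _) _; rewrite cabs1 lerD2l.
  by apply: le_trans (HB j _ wM) _; exact: inv1.
have gb j : cabs (cGamma z * gseq z j) <= 1 + K.
  rewrite (_ : _ * _ = 1 + (cGamma z * gseq z j - 1)); last by ring.
  apply: le_trans (cabsD _ _) _; rewrite cabs1 lerD2l.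
  by apply: le_trans (HG j) _; apply: inv1; exact: ltW.
apply: HJ1 => //.
- exact: le_trans (cabs_Re z) zM.
- move=> j; rewrite termE cabsM.
  rewrite [leRHS](_ : _ = H M * spow j (cRe z - 1) * ((1 + B) * P + c1 * (1 + K))); last by rewrite /Cv; ring.
  apply: ler_pM; rewrite ?cabs_ge0 //.
  rewrite cabsM cpi; apply: ler_wpDr; last by apply: ler_pM; rewrite ?cabs_ge0 ?pi0 ?HP.
  by apply: mulr_ge0; rewrite ?addr_ge0 ?(ltW c10) ?(ltW K0).
- move=> j; rewrite modelE cabsM.
  rewrite [leRHS](_ : _ = H M * spow j (cRe z - 1) * ((1 + B) * P + c1 * (1 + K))); last by rewrite /Cv; ring.
  apply: ler_pM; rewrite ?cabs_ge0 //.
  rewrite cabsM cc1; apply: ler_wpDl; last by apply: ler_wpM2l => //; exact: ltW.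
  by apply: mulr_ge0; rewrite ?addr_ge0 ?(ltW P0).
move=> j; rewrite termE modelE -mulrBr cabsM.
rewrite [leRHS](_ : _ = H M * spow j (cRe z - 1) * (G / j.+1%:R + `|pi_ j - c1|)); last by rewrite /eps; ring.
apply: ler_pM; rewrite ?cabs_ge0 //.
rewrite -/(pi_ j) (_ : _ - _ = (rr j (z - chalf R) - 1) * ofR (pi_ j) + (ofR (pi_ j - c1) +
   - (ofR c1 * (cGamma z * gseq z j - 1)))); last by rewrite ofRB; ring.
apply: le_trans (cabsD _ _) _.
apply: le_trans (lerD (lexx _) (cabsD _ _)) _.
rewrite cabsN !cabsM cpi cc1 cabs_ofR.
rewrite [leRHS](_ : _ = B / j.+1%:R * P + (`|pi_ j - c1| + c1 * (K / j.+1%:R))); last by rewrite /G; ring.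
apply: lerD; first by apply: ler_pM; rewrite ?cabs_ge0 ?HB ?HP.
by apply: lerD => //; apply: ler_wpM2l; [exact: ltW|exact: HG].
Qed.

Definition mean_limit (alpha : Cplx R) : Cplx R :=
  ofR (sigma^-1) * (ofR (Num.sqrt 2)^-1 * (cGamma (alpha - chalf R) / cGamma alpha)).

Let const_lim : c1 * Num.sqrt pi / Num.sqrt h%:R = sigma^-1 * (Num.sqrt 2)^-1.
Proof.
have s0 := sigma_gt0 crit.
have p0 : 0 < Num.sqrt pi :> R by rewrite sqrtr_gt0 pi_gt0.
have t0 : 0 < Num.sqrt 2 :> R by rewrite sqrtr_gt0.
have q0 : 0 < Num.sqrt h%:R :> R by rewrite sqrtr_gt0 ltr0n.
have hh : h%:R = Num.sqrt h%:R * Num.sqrt h%:R :> R by rewrite -expr2 sqr_sqrtr ?ler0n.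
rewrite /c1 /local_const sqrtrM //; move: hh q0; move: (Num.sqrt h%:R) => q -> q0.
by field; rewrite !gt_eqF.
Qed.

Let main_term J z : npow (1 + h * J) (- z) * (npow h (z - chalf R) * ofR c1 * cGamma z *
    (rising (z + chalf R) J / ofR (central R J))) =
  rr J (- z) * ofR (c1 / Num.sqrt h%:R) * cGamma z *
    (gseq (z + chalf R) J / ofR (Num.sqrt J.+1%:R * central R J)).
Proof.
rewrite npow_rr /gseq.
rewrite [npow J.+1 (1 - _)](_ : _ = (npow J.+1 (z - chalf R))^-1); last first.
  by rewrite -npowN; congr npow; rewrite -half_half; ring.
rewrite !npowD !npowN npow_half [npow h (chalf R)](_ : _ = ofR (Num.sqrt h%:R)); last first.
  by rewrite /chalf npow_ofR // powR12_sqrt.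
have sJ : Num.sqrt J.+1%:R != 0 :> R by rewrite gt_eqF // sqrtr_gt0 succ_gt0.
have sh : Num.sqrt h%:R != 0 :> R by rewrite gt_eqF // sqrtr_gt0 ltr0n.
have e1 := npow_neq0 h z; have e2 := npow_neq0 J.+1 z.
have cJ : ofR (Num.sqrt J.+1%:R) != 0 :> Cplx R by rewrite -cabs_gt0 cabs_ofR normr_gt0.
have ch : ofR (Num.sqrt h%:R) != 0 :> Cplx R by rewrite -cabs_gt0 cabs_ofR normr_gt0.
rewrite [ofR (c1 / _)]ofRM [ofR (_ * central R J)]ofRM ofRV.
move: (npow h z) (npow J.+1 z) e1 e2 (ofR c1) => u v e1 e2 c; rewrite !invfM !invrK.
move: (ofR (central R J))^-1 => w.
by field; rewrite e1 e2 cJ ch.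
Qed.

Let main_limit (b : bool) M d y0 eta : 0 <= M -> 0 < d -> 0 < eta ->
  exists J1, forall J z, (J1 <= J)%N -> zone b M d y0 z ->
    cabs (npow (1 + h * J) (- z) * (npow h (z - chalf R) * ofR c1 * cGamma z *
      (rising (z + chalf R) J / ofR (central R J))) - mean_limit (z + chalf R)) <= eta.
Proof.
move=> M0 d0 eta0; have [B B0 HB] := rr_bound M0.
have M1 : 0 <= M + 1 by rewrite addr_ge0.
have [K K0 HK] := gamma_uniform M0 d0; have [L L0 HL] := gamma_uniform M1 d0.
have [CA hA] := central_local_seq R.
have c10 : 0 < c1 by exact: (local_const_gt0 crit h0).
have sh : 0 < Num.sqrt h%:R :> R by rewrite sqrtr_gt0 ltr0n.
have sp : 0 < Num.sqrt pi :> R by rewrite sqrtr_gt0 pi_gt0.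
have [k kE k0] : exists2 k, k = c1 / Num.sqrt h%:R & 0 < k by exists (c1 / Num.sqrt h%:R); rewrite // divr_gt0.
have kK : 0 <= k * K by rewrite mulr_ge0 // ltW.
have L2 : 0 <= L * (2 * Num.sqrt pi) by rewrite mulr_ge0 ?mulr_ge0 ?(ltW L0) ?(ltW sp).
pose T := k * K * (B * (L * (2 * Num.sqrt pi)) + L * (2 * Num.sqrt pi)).
pose S := k * K * (L * (2 * Num.sqrt pi) * (2 * Num.sqrt pi)).
have S0 : 0 <= S by apply: mulr_ge0 => //; rewrite mulr_ge0 // mulr_ge0 // ltW.
have T0 : 0 <= T by apply: mulr_ge0 => //; rewrite addr_ge0 // mulr_ge0.
have T1 : 0 < 2 * (T + 1) by rewrite mulr_gt0 // ltr_wpDl.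
have S1 : 0 < 2 * (S + 1) by rewrite mulr_gt0 // ltr_wpDl.
have [N1 HN1] := nat_inv_small (divr_gt0 eta0 T1).
have [N2 HN2] := ls_p hA (divr_gt0 eta0 S1).
have sp2 : 0 < (Num.sqrt pi)^-1 / 2 :> R by rewrite divr_gt0 // invr_gt0.
have [N3 HN3] := ls_p hA sp2.
exists (maxn N1 (maxn N2 N3)) => J z; rewrite !geq_max => /andP[JN1 /andP[JN2 JN3]] [az azh _ _].
have [zM _] := az.
have [Gz GK _ _ _] := HK z az; have [Gh _ gL _ gr] := HL _ azh.
rewrite main_term -kE; set q := Num.sqrt J.+1%:R * central R J.
have qb : (Num.sqrt pi)^-1 / 2 <= q by have := HN3 J JN3; rewrite -/q ler_norml => /andP[h1 _]; lra.
have q0 : 0 < q by exact: lt_le_trans qb.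
have iq : q^-1 <= 2 * Num.sqrt pi.
  have e : (Num.sqrt pi)^-1 / 2 * (2 * Num.sqrt pi) = 1 :> R by field; rewrite !gt_eqF.
  by rewrite -(ler_pM2l q0) divff ?gt_eqF // -[leLHS]e; apply: ler_wpM2r qb; rewrite mulr_ge0 // ltW.
have qd : `|q^-1 - Num.sqrt pi| <= 2 * Num.sqrt pi * Num.sqrt pi * `|q - (Num.sqrt pi)^-1|.
  rewrite (_ : q^-1 - Num.sqrt pi = - (q^-1 * Num.sqrt pi * (q - (Num.sqrt pi)^-1))); last first.
    by field; rewrite !gt_eqF.
  rewrite normrN normrM; apply: ler_wpM2r => //.
  rewrite gtr0_norm ?mulr_gt0 ?invr_gt0 //; apply: ler_wpM2r => //; exact: ltW.
have -> : mean_limit (z + chalf R) = ofR k * cGamma z * ((cGamma (z + chalf R))^-1 * ofR (Num.sqrt pi)).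
  rewrite /mean_limit addrK [RHS](_ : _ = ofR (k * Num.sqrt pi) * (cGamma z / cGamma (z + chalf R))); last first.
    by rewrite ofRM; ring.
  rewrite mulrA -ofRM; congr (ofR _ * _).
  by rewrite -const_lim kE; ring.
set G := cGamma z in Gz GK *; set iG := (cGamma (z + chalf R))^-1 in gr *.
set g := gseq (z + chalf R) J; set r := rr J (- z).
have ginf : cabs iG <= 2 * L.
  rewrite (_ : iG = g - (g - iG)); last by ring.
  apply: le_trans (cabsB _ _) _; have := gL J; have := gr J; rewrite -/g => h1 h2.
  have h3 : L / J.+1%:R <= L by rewrite ler_pdivrMr ?succ_gt0 // ler_peMr ?(ltW L0) // (ler_nat R 1).
  by rewrite mulr_natl mulr2n; exact: lerD h2 (le_trans h1 h3).
rewrite (_ : _ - _ = ofR k * G * ((r - 1) * (g * ofR q^-1) + ((g - iG) * ofR q^-1 + iG * ofR (q^-1 - Num.sqrt pi)))); last first.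
  by rewrite ofRB ofRV; ring.
have gJ := gL J; rewrite -/g in gJ; have grJ := gr J; rewrite -/g in grJ.
have rJ : cabs (r - 1) <= B / J.+1%:R by apply: HB; rewrite cabsN.
have cq : cabs (ofR q^-1) <= 2 * Num.sqrt pi by rewrite cabs_ofR gtr0_norm ?invr_gt0.
have hq := HN2 J JN2; rewrite -/q in hq.
have X : cabs ((r - 1) * (g * ofR q^-1) + ((g - iG) * ofR q^-1 + iG * ofR (q^-1 - Num.sqrt pi))) <=
   B / J.+1%:R * (L * (2 * Num.sqrt pi)) + (L / J.+1%:R * (2 * Num.sqrt pi) +
      2 * L * (2 * Num.sqrt pi * Num.sqrt pi * (eta / (2 * (S + 1))))).
  apply: le_trans (cabsD _ _) _; apply: lerD.
    rewrite cabsM [cabs (g * _)]cabsM; exact: ler_pM (cabs_ge0 _) (mulr_ge0 (cabs_ge0 _) (cabs_ge0 _)) rJ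
      (ler_pM (cabs_ge0 _) (cabs_ge0 _) gJ cq).
  apply: le_trans (cabsD _ _) _; rewrite [cabs ((g - iG) * _)]cabsM [cabs (iG * _)]cabsM; apply: lerD.
    exact: ler_pM (cabs_ge0 _) (cabs_ge0 _) grJ cq.
  rewrite [cabs (ofR (_ - _))]cabs_ofR; apply: ler_pM (cabs_ge0 _) (normr_ge0 _) ginf _.
  apply: le_trans qd _; apply: ler_wpM2l hq; first by rewrite mulr_ge0 ?mulr_ge0 // ltW.
rewrite [cabs (ofR k * G * _)]cabsM [cabs (ofR k * G)]cabsM [cabs (ofR k)]cabs_ofR gtr0_norm //.
apply: le_trans (ler_pM _ (cabs_ge0 _) (ler_wpM2l (ltW k0) GK) X) _; first by rewrite mulr_ge0 ?cabs_ge0 // ltW.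
rewrite [leLHS](_ : _ = T * J.+1%:R^-1 + S * (eta / (2 * (S + 1)))); last first.
  by rewrite /T /S; move: (J.+1%:R^-1) (eta / _) => u v; ring.
rewrite [eta in leRHS]splitr; apply: lerD.
  apply: (@le_trans _ _ ((T + 1) / J.+1%:R)); first by apply: ler_wpM2r; rewrite ?invr_ge0 // lerDl ler01.
  have := HN1 J JN1; rewrite ler_pdivlMr // => HT.
  by rewrite ler_pdivlMr //; apply: le_trans HT; rewrite mulrC mulrA [leLHS]mulrC.
have -> : S * (eta / (2 * (S + 1))) = eta / 2 * (S / (S + 1)) by rewrite invfM; ring.
apply: ler_piMr; first by rewrite divr_ge0 // ltW.
by rewrite ler_pdivrMr ?ltr_wpDl // mul1r lerDl.
Qed.

Let kernel_sum (Q q : nat -> R) (b : bool) J N (f : nat -> Cplx R) : (J < N)%N ->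
  \sum_(j < N) f j * ofR (kernel Q q b J j) =
  \sum_(j < J.+1) f j * ofR (Q (J - j)%N / q J) - b%:R * \sum_(j < N) f j.
Proof.
move=> JN; rewrite (big_ord_widen N (fun j => f j * ofR (Q (J - j)%N / q J)) JN).
rewrite [X in _ = X - _]big_mkcond /= mulr_sumr -sumrB; apply: eq_bigr => j _; rewrite /kernel ltnS.
by case: ifP => _; rewrite ?ofRB ?ofRN ofR_nat; ring.
Qed.

(** The series [sum_j rising z j] is the binomial series of [(1 - x)^(-z)] at
    [x = 1], which vanishes for [Re z < 0]; hence the correction by [n mu] leaves
    the main term unchanged. *)
Let rising_small M d y0 e : 0 <= M -> 0 < d -> 0 < y0 -> 0 < e -> exists N0, forall N (z : Cplx R),
  (N0 <= N)%N -> away M d z -> cRe z <= - y0 -> cabs (\sum_(j < N.+1) rising z j) <= e.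
Proof.
move=> M0 d0 y00 e0; have M1 : 0 <= M + 1 by rewrite addr_ge0.
have [K K0 HK] := gamma_uniform M1 d0.
have [N0 HN0] := spow_small y00 (divr_gt0 e0 K0).
exists N0 => N z NN [zM za] zy; rewrite rising_sum.
have az : away (M + 1) d (z + 1).
  split; first by apply: le_trans (cabsD _ _) _; rewrite cabs1 lerD2r.
  move=> j; rewrite -addrA nat1r; apply: le_trans (za j.+1).
  by apply: ler_wpM2l; [exact: ltW|rewrite ler_nat].
have [_ _ gK _ _] := HK _ az.
have -> : rising (z + 1) N = gseq (z + 1) N * npow N.+1 z.
  rewrite /gseq -mulrA -npowD (_ : 1 - (z + 1) + z = 0); last by ring.
  by rewrite npow0 mulr1.
rewrite cabsM cabs_npow // -[_ `^ _]/(spow N (cRe z)) [e](_ : _ = K * (e / K)); last first.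
  by rewrite mulrC divfK ?gt_eqF.
by apply: ler_pM; rewrite ?cabs_ge0 ?spow_ge0 // HN0.
Qed.

(** The second-order shape of the mean, uniformly over a zone: the two kernels
    may be exchanged, and for the binomial offspring law the sum is explicit. *)
Lemma mean_asymp (b : bool) M d y0 eta : 0 <= M -> 0 < d -> 0 < y0 -> 0 < eta ->
  exists J1, forall J n alpha, n = (1 + h * J)%N -> (J1 <= J)%N ->
    zone b M d y0 (alpha - chalf R) -> 0 < hit J ->
    cabs (npow n (- alpha - chalf R) * (cgw_cmean xi n (fun u => treeX u alpha) -
      b%:R * (n%:R * mu xi alpha)) - mean_limit alpha) <= eta.
Proof.
move=> M0 d0 y00 eta0; have [B B0 HB] := rr_bound M0.
have G0 : 0 < H M * (1 + B) by rewrite mulr_gt0 ?expR_gt0 // ltr_wpDr.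
have e2 : 0 < eta / 2 by rewrite divr_gt0.
have [J1 HJ1] := term_replacement b M0 d0 y00 (divr_gt0 e2 G0).
have [J2 HJ2] := main_limit b y0 M0 d0 e2.
exists (maxn J1 J2) => J n alpha nE; rewrite geq_max => /andP[JJ1 JJ2].
set z := alpha - chalf R => zz hJ; have aE : alpha = z + chalf R by rewrite subrK.
have [az azh zl zu] := zz; have [zM _] := (az).
set A := \sum_(j < J.+1) fringe_term (z + chalf R) j * ofR (ret (J - j)%N / hit J).
pose kz := npow h (z - chalf R) * ofR c1 * cGamma z.
set V := rising (z + chalf R) J / ofR (central R J).
have n0 : (0 < n)%N by rewrite nE.
have pn : npow n (- alpha - chalf R) * n%:R = npow n (- z).
  rewrite -[n%:R](npow1 R n0) -npowD; congr npow.
  by rewrite -half_half aE; ring.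
have -> : npow n (- alpha - chalf R) * (cgw_cmean xi n (fun u => treeX u alpha) -
      b%:R * (n%:R * mu xi alpha)) = npow n (- z) * (A - b%:R * mu xi alpha).
  have -> : cgw_cmean xi n (fun u => treeX u alpha) = n%:R * A by rewrite /A nE aE cgw_mean_walk.
  by rewrite -pn; ring.
have cn : cabs (npow n (- z)) <= H M * (1 + B) * spow J (- cRe z).
  rewrite nE npow_rr cabsM [cabs (npow h _ * _)]cabsM [cabs (npow J.+1 _)]cabs_npow // cReN mulrAC; apply: ler_wpM2r.
    exact: powR_ge0.
  apply: ler_pM; rewrite ?cabs_ge0 //.
    by apply: npowh_bound; rewrite cabsN; apply: le_trans zM _; rewrite lerDl.
  rewrite (_ : rr J (- z) = 1 + (rr J (- z) - 1)); last by ring.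
  apply: le_trans (cabsD _ _) _; rewrite cabs1 lerD2l.
  apply: le_trans (HB J _ _) _; first by rewrite cabsN.
  by rewrite ler_pdivrMr ?succ_gt0 // ler_peMr // (ler_nat R 1).
suff step : cabs (A - b%:R * mu xi alpha - kz * V) <= eta / 2 / (H M * (1 + B)) * spow J (cRe z).
  rewrite (_ : _ - _ = npow n (- z) * (A - b%:R * mu xi alpha - kz * V) +
     (npow n (- z) * (kz * V) - mean_limit alpha)); last by ring.
  apply: le_trans (cabsD _ _) _; rewrite [eta]splitr; apply: lerD; last by rewrite nE aE; exact: HJ2 zz.
  rewrite cabsM; apply: le_trans (ler_pM (cabs_ge0 _) (cabs_ge0 _) cn step) _.
  rewrite mulrACA -spowD addNr /spow powRr0 mulr1 mulrC divfK //.
  by rewrite gt_eqF.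
pose u N := A - b%:R * (\sum_(j < (J + N).+1) fringe_term (z + chalf R) j) -
   kz * (V - b%:R * \sum_(j < (J + N).+1) rising z j).
have ub N : cabs (u N - 0) <= eta / 2 / (H M * (1 + B)) * spow J (cRe z).
  have := HJ1 J (J + N).+1 z JJ1 (leq_addr N J) zz.
  rewrite sumrB !kernel_sum ?ltnS ?leq_addr // subr0 /u.
  rewrite -/A (_ : \sum_(j < J.+1) model_term z j * _ = kz * V); last first.
    rewrite /V -rising_conv mulr_suml mulr_sumr; apply: eq_bigr => j _.
    by rewrite rising_half ofRM ofRV /model_term -/kz; ring.
  by rewrite /model_term -/kz -mulr_sumr; congr (cabs _ <= _); ring.
have ul : climit u (A - b%:R * mu xi alpha - kz * V).
  rewrite -[V]subr0 -(mulr0 b%:R).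
  case: b zl zu zz HJ1 HJ2 @u ub => zl zu zz HJ1 HJ2 u ub; last first.
    by move=> e e0; exists 0%N => N _; rewrite /u !mul0r subrr cabs0 ltW.
  have yz := zu isT.
  rewrite !mul1r /u; apply: climitB; last apply: climitMl.
  - apply: climitB; [exact: climit_cst|].
    have : climit (fun K => \sum_(j < K.+1) fringe_term (z + chalf R) j) (mu xi alpha).
      by rewrite -aE; apply: mu_climit; rewrite aE cReD cRe_ofR; lra.
    move=> + e e0 => /(_ e e0) [N HN]; exists N => k Nk; rewrite mul1r.
    by apply: HN; apply: leq_trans Nk (leq_addl _ _).
  - apply: climitB; [exact: climit_cst|].
    move=> e e0; have [N HN] := rising_small M0 d0 y00 e0.
    by exists N => k Nk; rewrite mul1r subr0; apply: HN yz => //; apply: leq_trans Nk (leq_addl _ _).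
have := climit_le ul (climit_cst 0); rewrite subr0; apply.
by exists 0%N => N _.
Qed.

End MeanAsymptotics.

(** * Analyticity *)

Section Derivability.
Variable R : realType.
Implicit Types (f g : Cplx R -> Cplx R) (z c h : Cplx R).

Lemma cplx_derivableM f g z : derivable f z 1 -> derivable g z 1 ->
  derivable (fun x => f x * g x) z 1.
Proof. by move=> fz gz; exact: derivableM. Qed.

Lemma cplx_derivableD f g z : derivable f z 1 -> derivable g z 1 ->
  derivable (fun x => f x + g x) z 1.
Proof. by move=> fz gz; exact: derivableD. Qed.

(** If the difference quotients [q h] satisfy [|q h - q h'| <= C (|h| + |h'|)],
    they converge.  Unlike differentiability itself, this condition passes to
    pointwise limits of functions. *)
Lemma lim_derivable (f_ : nat -> Cplx R -> Cplx R) f z (r C : R) : 0 < r -> 0 <= C ->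
  (forall h, cabs h <= r -> climit (fun m => f_ m (z + h)) (f (z + h))) ->
  (forall m, exists a, forall h, cabs h <= r ->
     cabs (f_ m (z + h) - f_ m z - a * h) <= C * cabs h ^+ 2) ->
  derivable f z 1.
Proof.
move=> r0 C0 fl fq; pose q (g : Cplx R -> Cplx R) h := (g (z + h) - g z) / h.
have fz : climit (fun m => f_ m z) (f z).
  by have := fl 0; rewrite cabs0 addr0; apply; exact: ltW.
have qlim h : cabs h <= r -> climit (fun m => q (f_ m) h) (q f h).
  move=> hr; have := climitMl h^-1 (climitB (fl h hr) fz).
  by move=> H e e0; have [N HN] := H e e0; exists N => n Nn; rewrite /q ![_ / h]mulrC HN.
have qC h h' : h != 0 -> h' != 0 -> cabs h <= r -> cabs h' <= r ->
    cabs (q f h - q f h') <= C * (cabs h + cabs h').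
  move=> h0 h'0 hr h'r; apply: (climit_le (qlim h hr) (qlim h' h'r)).
  exists 0%N => m _; have [a Ha] := fq m.
  have qa k : k != 0 -> cabs k <= r -> cabs (q (f_ m) k - a) <= C * cabs k.
    move=> k0 kr; have k1 : 0 < cabs k by rewrite cabs_gt0.
    rewrite (_ : _ - a = (f_ m (z + k) - f_ m z - a * k) / k); last by rewrite /q; field.
    by rewrite cabsM cabsV ler_pdivrMr // -mulrA -expr2 Ha.
  rewrite (_ : _ - _ = (q (f_ m) h - a) - (q (f_ m) h' - a)); last by ring.
  by apply: le_trans (cabsB _ _) _; rewrite mulrDr lerD // qa.
pose s n : Cplx R := ofR (r / n.+1%:R).
have s0 n : 0 < r / n.+1%:R by rewrite divr_gt0 // succ_gt0.
have cs n : cabs (s n) = r / n.+1%:R by rewrite cabs_ofR gtr0_norm.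
have sn0 n : s n != 0 by rewrite -cabs_gt0 cs.
have sr n : cabs (s n) <= r.
  by rewrite cs ler_pdivrMr ?succ_gt0 // ler_peMr ?(ltW r0) // (ler_nat R 1).
have [||a al _] := @cauchy_climit R (fun n => q f (s n)) (fun n => C * (r / n.+1%:R + r / n.+1%:R)).
- move=> e e0; have D0 : 0 < 2 * C * r + 1 by rewrite ltr_wpDl // mulr_ge0 ?mulr_ge0 // ltW.
  have [N HN] := nat_inv_small (divr_gt0 e0 D0); exists N => n Nn.
  apply: (@le_trans _ _ ((2 * C * r + 1) / n.+1%:R)).
    rewrite (_ : C * _ = 2 * C * r / n.+1%:R); last by ring.
    by apply: ler_wpM2r; rewrite ?invr_ge0 // lerDl ler01.
  by have := HN n Nn; rewrite ler_pdivlMr // mulrC.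
- move=> j k jk; apply: le_trans (qC _ _ (sn0 k) (sn0 j) (sr k) (sr j)) _.
  rewrite !cs; apply: ler_wpM2l => //; rewrite lerD2r; apply: ler_wpM2l; first exact: ltW.
  by rewrite lef_pV2 ?posrE ?succ_gt0 // ler_nat ltnS.
have qa h : h != 0 -> cabs h <= r -> cabs (q f h - a) <= C * cabs h.
  move=> h0 hr; apply/ler_addgt0Pr => e e0.
  have e2 : 0 < e / 2 by rewrite divr_gt0.
  have [N HN] := al _ e2.
  have D0 : 0 < C * r + 1 by rewrite ltr_wpDl // mulr_ge0 // ltW.
  have [N' HN'] := nat_inv_small (divr_gt0 e2 D0).
  set n := maxn N N'; have Nn : (N <= n)%N by exact: leq_maxl.
  have Nn' : (N' <= n)%N by exact: leq_maxr.
  rewrite (_ : _ - a = (q f h - q f (s n)) + (q f (s n) - a)); last by ring.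
  apply: le_trans (cabsD _ _) _.
  apply: le_trans (lerD (qC _ _ h0 (sn0 n) hr (sr n)) (HN n Nn)) _.
  rewrite mulrDr -addrA lerD2l [leRHS]splitr lerD2r cs.
  apply: (@le_trans _ _ ((C * r + 1) / n.+1%:R)).
    by rewrite mulrA; apply: ler_wpM2r; rewrite ?invr_ge0 // lerDl ler01.
  by have := HN' n Nn'; rewrite ler_pdivlMr // mulrC.
apply: (cvgP a); apply/cvgrPdist_le => e /Cplx_gt0 [e' e0 ->].
have C1 : 0 < C + 1 by rewrite ltr_wpDl.
pose d := Num.min r (e' / (C + 1)); have d0 : 0 < d by rewrite lt_min r0 divr_gt0.
exists (ofR d); first by rewrite /= (_ : 0 = ofR 0) // ofR_lt.
move=> h /=; rewrite sub0r normrN normr_cabs ofR_lt => hd h0.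
rewrite normr_cabs ofR_le cabsBC.
have -> : h^-1 *: (f (h *: 1 + z) - f z) = q f h.
  by rewrite /q -[LHS]/(h^-1 * (f (h * 1 + z) - f z)) mulr1 [h + z]addrC mulrC.
move: hd; rewrite lt_min => /andP[/ltW hr /ltW hd].
apply: le_trans (qa h h0 hr) _; apply: (@le_trans _ _ ((C + 1) * cabs h)).
  by rewrite mulrDl mul1r lerDl cabs_ge0.
by rewrite mulrC -ler_pdivlMr.
Qed.

Lemma quad_derivable f z (r C : R) (a : Cplx R) : 0 < r -> 0 <= C ->
  (forall h, cabs h <= r -> cabs (f (z + h) - f z - a * h) <= C * cabs h ^+ 2) ->
  derivable f z 1.
Proof.
move=> r0 C0 fq; apply: (@lim_derivable (fun=> f) f z r C) => // [h _|_]; last by exists a.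
exact: climit_cst.
Qed.

Lemma cplx_derivable_cst (c z : Cplx R) : derivable ((fun=> c) : Cplx R -> Cplx R) z 1.
Proof.
apply: (@quad_derivable _ z 1 0 0) => // h _.
by rewrite subrr mul0r subrr cabs0 mul0r.
Qed.

Lemma cplx_derivableMl c f z : derivable f z 1 -> derivable (fun x => c * f x) z 1.
Proof. by move=> fz; apply: cplx_derivableM fz; exact: cplx_derivable_cst. Qed.

Lemma cplx_derivable_sum (I : Type) (r : seq I) (F : I -> Cplx R -> Cplx R) z :
  (forall i, derivable (F i) z 1) -> derivable (fun x => \sum_(i <- r) F i x) z 1.
Proof.
move=> Fz; elim: r => [|i r IH].
  rewrite (_ : (fun x => _) = fun=> 0); last by apply/funext => x; rewrite big_nil.
  exact: cplx_derivable_cst.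
rewrite (_ : (fun x => _) = fun x => F i x + \sum_(i <- r) F i x); last first.
  by apply/funext => x; rewrite big_cons.
exact (@cplx_derivableD (F i) (fun x => \sum_(i <- r) F i x) z (Fz i) IH).
Qed.

Lemma ln_le_powR (n : nat) (r : R) : 0 < r -> (0 < n)%N -> ln n%:R <= r^-1 * n%:R `^ r.
Proof.
move=> r0 n0; have n1 : 0 < n%:R :> R by rewrite ltr0n.
rewrite -(ler_pM2l r0) mulrA divff ?gt_eqF // mul1r -ln_powR.
have p0 : 0 < n%:R `^ r by rewrite powR_gt0.
have x1 : -1 < n%:R `^ r - 1 by rewrite ltrBrDr addNr.
by have := le_ln1Dx x1; rewrite addrC subrK => /le_trans -> //; rewrite lerBlDr lerDl ler01.
Qed.

(** The factor [n^(2 r)] absorbs [exp (|h| ln n)] and [(ln n)^2]. *)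
Lemma npow_quad n (alpha h : Cplx R) (r : R) : 0 < r -> (0 < n)%N -> cabs h <= r ->
  cabs (npow n (alpha + h) - npow n alpha - npow n alpha * ofR (ln n%:R) * h) <=
  16 / r ^+ 2 * n%:R `^ (cRe alpha + 2 * r) * cabs h ^+ 2.
Proof.
move=> r0 n0 hr; set L := ln n%:R.
have L0 : 0 <= L by rewrite ln_ge0 // (ler_nat R 1).
have np : 0 < n%:R :> R by rewrite ltr0n.
rewrite (_ : _ - _ = npow n alpha * (cexp (h * ofR L) - 1 - h * ofR L)); last first.
  by rewrite npowD /npow -/L; ring.
have cL : cabs (h * ofR L) = cabs h * L by rewrite cabsM cabs_ofR ger0_norm.
rewrite cabsM cabs_npow //.
apply: le_trans (ler_wpM2l (powR_ge0 _ _) (cexp_quad _)) _; rewrite cL.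
have E : expR (cabs h * L) <= n%:R `^ r.
  by rewrite /powR gt_eqF // ler_expR; apply: ler_wpM2r.
have LL : L ^+ 2 <= 4 / r ^+ 2 * n%:R `^ r.
  have r2 : 0 < r / 2 by rewrite divr_gt0.
  have h1 := ln_le_powR r2 n0; rewrite -/L in h1.
  rewrite (_ : 4 / _ * _ = ((r / 2)^-1 * n%:R `^ (r / 2)) ^+ 2).
    by rewrite ler_sqr // nnegrE mulr_ge0 ?powR_ge0 // invr_ge0 ltW.
  have -> : n%:R `^ r = (n%:R `^ (r / 2)) ^+ 2 by rewrite -powR_mulrn ?powR_ge0 // -powRrM divfK.
  rewrite exprMn; congr (_ * _).
  by field; rewrite gt_eqF.
rewrite [leRHS](_ : _ = n%:R `^ cRe alpha * (4 * n%:R `^ r * (4 / r ^+ 2 * n%:R `^ r) * cabs h ^+ 2)); last first.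
  have -> : n%:R `^ (cRe alpha + 2 * r) = n%:R `^ cRe alpha * (n%:R `^ r * n%:R `^ r) :> R.
    have nn : n%:R != 0 :> R by rewrite gt_eqF.
    by rewrite mulr_natl mulr2n !powRD ?nn ?implybT.
  by field; rewrite gt_eqF.
apply: ler_wpM2l; first exact: powR_ge0.
rewrite exprMn [leLHS](_ : _ = 4 * expR (cabs h * L) * L ^+ 2 * cabs h ^+ 2); last by ring.
apply: ler_wpM2r; first exact: sqr_ge0.
apply: ler_pM LL; [by rewrite mulr_ge0 ?expR_ge0|exact: sqr_ge0|].
by apply: ler_wpM2l.
Qed.

Lemma npow_derivable n (z : Cplx R) : derivable (@npow R n) z 1.
Proof.
case: n => [|n].
  rewrite (_ : npow 0 = fun=> 1); first exact: cplx_derivable_cst.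
  by apply/funext => w; rewrite /npow ln0 // ofR0 mulr0 cexp0.
have C0 : 0 <= 16 / 1 ^+ 2 * n.+1%:R `^ (cRe z + 2 * 1) :> R.
  by apply: mulr_ge0; rewrite ?powR_ge0 // expr1n divr_ge0.
apply: (@quad_derivable _ z 1 _ (npow n.+1 z * ofR (ln n.+1%:R)) ltr01 C0) => h h1; exact: npow_quad.
Qed.

End Derivability.

Section MuDerivable.
Variables (R : realType) (xi : probability nat R) (sigma : R).
Hypothesis crit : critical xi sigma.
Variable h : nat.
Hypotheses (h0 : (0 < h)%N) (hc : controlled xi h).
Hypothesis hs : forall k, ~~ (h %| k)%N -> offspring xi k = 0.

Lemma sum_spow_conv (d : R) m : 0 < d -> \sum_(j < m.+1) spow j (- d - 1) <= 1 + d^-1.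
Proof.
move=> d0; rewrite -(big_mkord xpredT (fun j => spow j (- d - 1))) big_nat_recl //.
apply: lerD; first by rewrite /spow powR1.
rewrite -(big_add1 _ _ _ m.+1 xpredT (fun j => spow j (- d - 1))).
by have := tail_spow_le 0 m.+1 d0 (lexx (- d)); rewrite /spow powR1 mulr1.
Qed.

Lemma mu_derivable (alpha : Cplx R) : cRe alpha < 2^-1 -> derivable (mu xi) alpha 1.
Proof.
move=> ha; pose r := (2^-1 - cRe alpha) / 4; have r0 : 0 < r by rewrite divr_gt0 // subr_gt0.
have [C C0 HC] := size_prob_ub crit h0 hc hs.
have r2 : 0 < 2 * r by rewrite mulr_gt0.
pose B := 16 / r ^+ 2 * C; have B0 : 0 <= B by apply: mulr_ge0; rewrite ?divr_ge0 ?sqr_ge0 // ltW.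
have D0 : 0 <= B * (1 + (2 * r)^-1) by apply: mulr_ge0 => //; rewrite addr_ge0 // invr_ge0 ltW.
apply: (@lim_derivable _ (fun m beta => \sum_(j < m.+1) fringe_term xi h beta j) _ alpha r _ r0 D0).
  move=> k kr; apply: (mu_climit crit h0 hc hs); rewrite cReD.
  by have := le_trans (ler_norm _) (le_trans (cabs_Re k) kr); rewrite /r; lra.
move=> m; exists (\sum_(j < m.+1) npow (1 + h * j) alpha * ofR (ln (1 + h * j)%:R) * ofR (size_prob xi (1 + h * j))).
move=> k kr; rewrite mulr_suml -!sumrB; apply: le_trans (cabs_sum _ _ _) _.
apply: (@le_trans _ _ (\sum_(j < m.+1) B * cabs k ^+ 2 * spow j (- (2 * r) - 1))); last first.
  rewrite -mulr_sumr mulrAC; apply: ler_wpM2r; first exact: sqr_ge0.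
  by apply: ler_wpM2l => //; exact: sum_spow_conv.
apply: ler_sum => -[j jm] _ /=; rewrite /fringe_term.
rewrite (_ : _ - _ = (npow (1 + h * j) (alpha + k) - npow (1 + h * j) alpha -
   npow (1 + h * j) alpha * ofR (ln (1 + h * j)%:R) * k) * ofR (size_prob xi (1 + h * j))); last by ring.
rewrite cabsM cabs_ofR ger0_norm ?size_prob_ge0 //.
have Q := npow_quad alpha r0 (isT : (0 < 1 + h * j)%N) kr.
have := HC (h * j)%N; rewrite -add1n => SP.
apply: le_trans (ler_pM (cabs_ge0 _) (size_prob_ge0 _ _) Q SP) _.
rewrite [leLHS](_ : _ = B * cabs k ^+ 2 * ((1 + h * j)%:R `^ (cRe alpha + 2 * r) /
   ((1 + h * j)%:R * Num.sqrt (1 + h * j)%:R))); last by rewrite /B; ring.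
apply: ler_wpM2l; first by apply: mulr_ge0 => //; exact: sqr_ge0.
rewrite add1n -[_ `^ _]/(spow (h * j) (cRe alpha + 2 * r)) -spow_half.
rewrite invfM mulrA -spowB1 -spowN -spowD (_ : _ - 1 - 2^-1 = - (2 * r) - 1); last by rewrite /r; field.
have neg : - (2 * r) - 1 = - (2 * r + 1) by ring.
rewrite neg !spowN lef_pV2 ?posrE ?spow_gt0 //.
apply: ge0_ler_powR; rewrite ?nnegrE ?ler0n ?addr_ge0 ?(ltW r2) //.
by rewrite ler_nat ltnS leq_pmull.
Qed.

End MuDerivable.

Section GammaRatio.
Variable R : realType.
Implicit Types (z w k : Cplx R).

Lemma climitM (u v : nat -> Cplx R) l l' : climit u l -> climit v l' ->
  climit (fun n => u n * v n) (l * l').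
Proof.
move=> ul vl e e0.
have B0 : 0 < cabs l + 1 + (cabs l' + 1) by apply: addr_gt0; rewrite ltr_wpDl ?cabs_ge0.
have e1 : 0 < Num.min 1 (e / (cabs l + 1 + (cabs l' + 1))) by rewrite lt_min ltr01 divr_gt0.
have [N HN] := ul _ e1; have [N' HN'] := vl _ e1; exists (maxn N N') => n.
rewrite geq_max => /andP[Nn Nn'].
have := HN n Nn; rewrite le_min => /andP[h1 h2].
have := HN' n Nn'; rewrite le_min => /andP[h3 h4].
have ub : cabs (v n) <= cabs l' + 1.
  rewrite (_ : v n = l' + (v n - l')); last by ring.
  by apply: le_trans (cabsD _ _) _; rewrite lerD2l.
rewrite (_ : _ - _ = (u n - l) * v n + l * (v n - l')); last by ring.
apply: le_trans (cabsD _ _) _; rewrite !cabsM.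
set E := e / _ in h2 h4; have E0 : 0 <= E by rewrite divr_ge0 // ltW.
rewrite (_ : e = E * (cabs l' + 1) + (cabs l + 1) * E); last first.
  by rewrite /E; field; rewrite gt_eqF.
apply: lerD; first exact: ler_pM (cabs_ge0 _) (cabs_ge0 _) h2 ub.
by apply: ler_pM (cabs_ge0 _) (cabs_ge0 _) _ h4; rewrite lerDl ler01.
Qed.

Lemma climitV (u : nat -> Cplx R) l : l != 0 -> climit u l -> climit (fun n => (u n)^-1) l^-1.
Proof.
move=> l0 ul e e0; have cl : 0 < cabs l by rewrite cabs_gt0.
have e1 : 0 < Num.min (cabs l / 2) (e * cabs l ^+ 2 / 2).
  by rewrite lt_min divr_gt0 // divr_gt0 // mulr_gt0 // exprn_gt0.
have [N HN] := ul _ e1; exists N => n Nn; have := HN n Nn; rewrite le_min => /andP[h1 h2].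
have un : cabs l / 2 <= cabs (u n).
  have : cabs l <= cabs (u n) + cabs (u n - l).
    by rewrite {1}(_ : l = u n - (u n - l)); [exact: cabsB|ring].
  by lra.
have un0 : 0 < cabs (u n) by apply: lt_le_trans un; rewrite divr_gt0.
rewrite (_ : _ - _ = - (u n - l) / (u n * l)); last by field; rewrite l0 -cabs_gt0.
rewrite cabsM cabsN cabsV cabsM ler_pdivrMr ?mulr_gt0 //; apply: le_trans h2 _.
rewrite -mulrA; apply: ler_wpM2l; first exact: ltW.
by rewrite expr2 mulrAC; apply: ler_wpM2r => //; exact: ltW.
Qed.

Lemma gseq_ratio_climit M d z w : 0 <= M -> 0 < d -> away M d z -> away M d w ->
  climit (fun m => gseq w m / gseq z m) (cGamma z / cGamma w).
Proof.
move=> M0 d0 az aw; have [K K0 HK] := gamma_uniform M0 d0.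
have [gz _ _ _ rz] := HK z az; have [gw _ _ _ rw] := HK w aw.
rewrite mulrC -{1}[cGamma z]invrK; apply: climitM (climit_rate rw) _.
by apply: climitV (climit_rate rz); rewrite invr_eq0.
Qed.

Lemma gseq_ratio m z : (forall i : nat, z - chalf R + i%:R != 0) ->
  gseq z m / gseq (z - chalf R) m =
  (\prod_(i < m) ((z + i%:R) / (z - chalf R + i%:R))) * npow m.+1 (- chalf R).
Proof.
move=> z0; rewrite /gseq /rising (_ : 1 - (z - chalf R) = (1 - z) + chalf R); last by ring.
rewrite [npow _ (1 - z + chalf R)]npowD npowN !prodf_div.
have p0 : \prod_(i < m) (z - chalf R + i%:R) != 0 by apply/prodf_neq0 => i _.
have q0 : \prod_(i < m) i.+1%:R != 0 :> Cplx R by apply/prodf_neq0 => i _; rewrite pnatr_eq0.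
have e1 := npow_neq0 m.+1 (1 - z); have e2 := npow_neq0 m.+1 (chalf R).
move: (npow m.+1 (1 - z)) (npow m.+1 (chalf R)) e1 e2 p0 q0 => a b.
move: (\prod_(i < m) (z - _ + _)) (\prod_(i < m) _.+1%:R) => p q a0 b0 p0 q0.
by field; rewrite a0 b0 p0 q0.
Qed.

(** By induction on [m], together with [|prod (1 + x i) - 1| <= exp S - 1]. *)
Lemma prod1_quad (x : nat -> Cplx R) m S : S = \sum_(i < m) cabs (x i) ->
  cabs (\prod_(i < m) (1 + x i) - 1 - \sum_(i < m) x i) <= expR S - 1 - S.
Proof.
move=> ->; suff [//] : cabs (\prod_(i < m) (1 + x i) - 1 - \sum_(i < m) x i) <=
     expR (\sum_(i < m) cabs (x i)) - 1 - \sum_(i < m) cabs (x i) /\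
   cabs (\prod_(i < m) (1 + x i) - 1) <= expR (\sum_(i < m) cabs (x i)) - 1.
elim: m {S} => [|m [IH1 IH2]].
  by rewrite !big_ord0 expR0 !subrr ?subrr cabs0 lexx.
rewrite !big_ord_recr /=; move: (\prod_(i < m) _) (\sum_(i < m) x i) (\sum_(i < m) cabs (x i)) IH1 IH2.
move=> P X S IH1 IH2; set s := cabs (x m); have s0 : 0 <= s by exact: cabs_ge0.
have E : expR S * (1 + s) <= expR (S + s).
  by rewrite expRD; apply: ler_wpM2l; [exact: expR_ge0|exact: expR_ge1Dx].
split.
  rewrite (_ : _ - _ = (P - 1 - X) + x m * (P - 1)); last by ring.
  apply: le_trans (cabsD _ _) _; rewrite cabsM -/s.
  apply: le_trans (lerD IH1 (ler_wpM2l s0 IH2)) _.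
  by rewrite [leLHS](_ : _ = expR S * (1 + s) - 1 - (S + s)); [rewrite !lerD2r|ring].
rewrite (_ : _ - _ = (P - 1) * (1 + x m) + x m); last by ring.
apply: le_trans (cabsD _ _) _; rewrite cabsM -/s.
have s1 : cabs (1 + x m) <= 1 + s by apply: le_trans (cabsD _ _) _; rewrite cabs1.
apply: le_trans (lerD (ler_pM (cabs_ge0 _) (cabs_ge0 _) IH2 s1) (lexx _)) _.
by rewrite [leLHS](_ : _ = expR S * (1 + s) - 1); [rewrite lerD2r|ring].
Qed.

Lemma away_shift M d z k : 0 < d -> away M d z -> cabs k <= d / 2 -> away (M + d) (d / 2) (z + k).
Proof.
move=> d0 [zM za] kd; split.
  by apply: le_trans (cabsD _ _) _; apply: lerD => //; apply: le_trans kd _; lra.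
move=> j; have : cabs (z + j%:R) <= cabs (z + k + j%:R) + cabs k.
  by rewrite {1}(_ : z + j%:R = (z + k + j%:R) - k); [exact: cabsB|ring].
have := za j; have : d / 2 <= d / 2 * j.+1%:R by rewrite ler_peMr ?(ler_nat R 1) // divr_ge0 // ltW.
rewrite [d * j.+1%:R](_ : _ = d / 2 * j.+1%:R + d / 2 * j.+1%:R); last by field.
by move: (d / 2 * _) => t; lra.
Qed.

Lemma sum_invsq (m : nat) : \sum_(i < m) (i.+1%:R ^+ 2)^-1 <= 2 :> R.
Proof.
case: m => [|m]; first by rewrite big_ord0.
have := @sum_spow_conv R 1 m ltr01; rewrite invr1; apply: le_trans.
apply: ler_sum => i _; rewrite (_ : -1 - 1 = - (1 + 1) :> R) ?spowN ?spowD ?spow1 ?expr2 //.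
by rewrite opprD.
Qed.

(** [Gamma (z - 1/2) / Gamma z] is the limit of the products
    [prod_(i < m) (z + i) / (z - 1/2 + i) * (m + 1)^(- 1/2)], whose relative
    increments are controlled by [prod1_quad]. *)
Lemma gamma_ratio_derivable M d z : 0 <= M -> 0 < d ->
  away M d (z - chalf R) -> away (M + 1) d z ->
  derivable (fun x : Cplx R => cGamma (x - chalf R) / cGamma x) z 1.
Proof.
move=> M0 d0 aw az; pose c := chalf R; pose r := d / 2; have r0 : 0 < r by rewrite divr_gt0.
have M1 : 0 <= M + 1 by rewrite addr_ge0.
have M2 : 0 <= M + 1 + d by rewrite addr_ge0 // ltW.
have aw1 : away (M + 1) d (z - c) by case: aw => h1 h2; split => //; apply: le_trans h1 _; rewrite lerDl.
have F0 := gseq_ratio_climit M1 d0 aw1 az.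
have [N HN] := F0 1 ltr01; pose B := cabs (cGamma (z - c) / cGamma z) + 1.
have HB m : (N <= m)%N -> cabs (gseq z m / gseq (z - c) m) <= B.
  move=> Nm; rewrite (_ : gseq z m / _ = cGamma (z - c) / cGamma z + (gseq z m / gseq (z - c) m - cGamma (z - c) / cGamma z)); last by rewrite [RHS]addrC subrK.
  by apply: le_trans (cabsD _ _) _; rewrite lerD2l; exact: HN.
have B0 : 0 <= B by rewrite addr_ge0 // cabs_ge0.
pose E := 16 / d ^+ 4 * expR (2 / d) + 4 / d ^+ 3.
have dp (a j : nat) : 0 <= a%:R / d ^+ j by rewrite divr_ge0 // exprn_ge0 // ltW.
have E0 : 0 <= E by apply: addr_ge0; [exact: mulr_ge0 (dp _ _) (expR_ge0 _)|exact: dp].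
apply: (@lim_derivable _ (fun m x => gseq x (N + m) / gseq (x - c) (N + m)) _ z r (B * E) r0).
- exact: mulr_ge0.
- move=> k kr e e0; have az' := away_shift d0 az kr; have := away_shift d0 aw1 kr.
  rewrite (_ : z - c + k = z + k - c); last by ring.
  move=> aw'; have [N' HN'] := gseq_ratio_climit M2 r0 aw' az' e0.
  by exists N' => n Nn; apply: HN'; exact: leq_trans Nn (leq_addl _ _).
move=> m'; set m := (N + m')%N; pose u i : Cplx R := z - c + i%:R.
exists (gseq z m / gseq (z - c) m * \sum_(i < m) (- c / (u i * (u i + c)))) => k kr.
have ub i : d * i.+1%:R <= cabs (u i) by case: aw => _; apply.
have uc i : d * i.+1%:R <= cabs (u i + c).
  by case: az => _ /(_ i); rewrite /u (_ : z - c + i%:R + c = z + i%:R) //; ring.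
have uk i : d / 2 * i.+1%:R <= cabs (u i + k).
  by have [_ /(_ i)] := away_shift d0 aw kr; rewrite /u -!addrA [k + _]addrC.
have nz (a : R) v i : 0 < a -> a * i.+1%:R <= cabs v -> v != 0.
  by move=> a0 h; rewrite -cabs_gt0; apply: lt_le_trans h; rewrite mulr_gt0.
have u0 i := nz _ _ _ d0 (ub i); have uc0 i := nz _ _ _ d0 (uc i); have uk0 i := nz _ _ _ r0 (uk i).
pose x i := - (k * c) / ((u i + k) * (u i + c)).
have FE : gseq (z + k) m / gseq (z + k - c) m = gseq z m / gseq (z - c) m * \prod_(i < m) (1 + x i).
  rewrite !gseq_ratio; [|by move=> i; exact: u0|]; last first.
    by move=> i; have := uk0 i; rewrite /u (_ : z - c + i%:R + k = z + k - c + i%:R) //; ring.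
  rewrite mulrAC -big_split /=; congr (_ * _); apply: eq_bigr => i _.
  rewrite /x (_ : z + k + i%:R = u i + c + k); last by rewrite /u; ring.
  rewrite (_ : z + k - chalf R + i%:R = u i + k); last by rewrite /u /c; ring.
  rewrite (_ : z + i%:R = u i + c); last by rewrite /u; ring.
  rewrite -/c -/(u i); move: (u0 i) (uc0 i) (uk0 i); move: (u i) => v v0 vc vk.
  by field; rewrite v0 vc vk.
rewrite FE (_ : _ - _ = gseq z m / gseq (z - c) m * ((\prod_(i < m) (1 + x i) - 1 - \sum_(i < m) x i) +
   (\sum_(i < m) x i - (\sum_(i < m) (- c / (u i * (u i + c)))) * k))); last by ring.
rewrite cabsM -mulrA; apply: ler_pM; rewrite ?cabs_ge0 //; first by apply: HB; exact: leq_addr.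
apply: le_trans (cabsD _ _) _; rewrite mulrDl.
have c1 : cabs c <= 1 by rewrite cabs_ofR ger0_norm ?invr_ge0 // invf_le1 // (ler_nat R 1).
have ip i : 0 < i.+1%:R :> R by exact: succ_gt0.
have inv_le (a : R) v i : 0 < a -> a * i.+1%:R <= cabs v -> cabs v^-1 <= (a * i.+1%:R)^-1.
  by move=> a0 h; rewrite cabsV lef_pV2 ?posrE ?mulr_gt0 // (lt_le_trans _ h) ?mulr_gt0.
have kc : cabs (- (k * c)) <= cabs k.
  by rewrite cabsN cabsM -[leRHS]mulr1; apply: ler_wpM2l => //; exact: cabs_ge0.
have xb i : cabs (x i) <= 2 / d ^+ 2 * cabs k * (i.+1%:R ^+ 2)^-1.
  rewrite /x invfM cabsM [cabs (_^-1 * _)]cabsM.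
  apply: le_trans (ler_pM (cabs_ge0 _) (mulr_ge0 (cabs_ge0 _) (cabs_ge0 _)) kc
    (ler_pM (cabs_ge0 _) (cabs_ge0 _) (inv_le _ _ _ r0 (uk i)) (inv_le _ _ _ d0 (uc i)))) _.
  rewrite le_eqVlt; apply/orP; left; apply/eqP; rewrite /r; move: (ip i) => {}ip.
  by field; rewrite !gt_eqF.
pose S := \sum_(i < m) cabs (x i).
have S0 : 0 <= S by apply: sumr_ge0 => i _; exact: cabs_ge0.
have Sb : S <= 4 / d ^+ 2 * cabs k.
  apply: (@le_trans _ _ (2 / d ^+ 2 * cabs k * 2)); last first.
    by rewrite le_eqVlt; apply/orP; left; apply/eqP; field; rewrite gt_eqF.
  apply: le_trans (ler_wpM2l _ (sum_invsq m)); last first.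
    by apply: mulr_ge0; rewrite ?cabs_ge0 // divr_ge0 // sqr_ge0.
  by rewrite mulr_sumr; apply: ler_sum => i _; exact: xb.
have Sd : S <= 2 / d.
  apply: le_trans Sb _; rewrite (_ : 2 / d = 4 / d ^+ 2 * (d / 2)); last by field; rewrite gt_eqF.
  by apply: ler_wpM2l => //; rewrite divr_ge0 // sqr_ge0.
apply: lerD.
  apply: le_trans (prod1_quad (erefl S)) _.
  apply: le_trans (ler_norm _) _; apply: le_trans (expR_sub1x_le S) _; rewrite ger0_norm //.
  rewrite (_ : 16 / _ * _ * _ = (4 / d ^+ 2 * cabs k) ^+ 2 * expR (2 / d)); last first.
    by field; rewrite gt_eqF.
  apply: ler_pM; rewrite ?sqr_ge0 ?expR_ge0 ?ler_expR //.
  by rewrite ler_sqr ?nnegrE ?S0 ?(le_trans S0 Sb).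
rewrite mulr_suml -sumrB; apply: le_trans (cabs_sum _ _ _) _.
have yb i : cabs (x i - - c / (u i * (u i + c)) * k) <= 2 / d ^+ 3 * cabs k ^+ 2 * (i.+1%:R ^+ 2)^-1.
  rewrite (_ : _ - _ = k * (- (k * c)) * (- (u i)^-1 * ((u i + k)^-1 * (u i + c)^-1))); last first.
    rewrite /x; move: (u0 i) (uc0 i) (uk0 i); move: (u i) => v v0 vc vk.
    by field; rewrite v0 vc vk.
  rewrite cabsM [cabs (k * _)]cabsM [cabs (- _ * _)]cabsM [cabs (- _^-1)]cabsN [cabs (_^-1 * _)]cabsM.
  have n0 := @cabs_ge0 R.
  apply: (@le_trans _ _ (cabs k * cabs k * ((d * i.+1%:R)^-1 * ((r * i.+1%:R)^-1 * (d * i.+1%:R)^-1)))).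
    apply: ler_pM; rewrite ?mulr_ge0 ?n0 //; first by apply: ler_wpM2l.
    apply: ler_pM; rewrite ?mulr_ge0 ?n0 //; first exact: inv_le (ub i).
    by apply: ler_pM; rewrite ?n0 //; [exact: inv_le (uk i)|exact: inv_le (uc i)].
  rewrite [leLHS](_ : _ = 2 / d ^+ 3 * cabs k ^+ 2 * (i.+1%:R ^+ 2)^-1 * i.+1%:R^-1); last first.
    by rewrite /r; move: (ip i) => {}ip; field; rewrite !gt_eqF.
  apply: ler_piMr; last by rewrite invf_le1 // (ler_nat R 1).
  apply: mulr_ge0; last by rewrite invr_ge0 sqr_ge0.
  by apply: mulr_ge0; [exact: dp|exact: sqr_ge0].
apply: (@le_trans _ _ (\sum_(i < m) 2 / d ^+ 3 * cabs k ^+ 2 * (i.+1%:R ^+ 2)^-1)).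
  by apply: ler_sum => i _; exact: yb.
rewrite -mulr_sumr (_ : 4 / _ * _ = 2 / d ^+ 3 * cabs k ^+ 2 * 2); last by field; rewrite gt_eqF.
apply: ler_wpM2l (sum_invsq m).
by apply: mulr_ge0; [exact: dp|exact: sqr_ge0].
Qed.

End GammaRatio.

(** * The space of functions on a domain *)

Section FunctionSpace.
Variable R : realType.
Implicit Types (z w : Cplx R) (D : set (Cplx R)).

Lemma ball_cabs z w (r : R) : ball z (ofR r) w <-> cabs (z - w) < r.
Proof. by rewrite -ball_normE /ball_ /= normr_cabs ofR_lt. Qed.

Lemma cplx_nbhsP z (U : set (Cplx R)) :
  nbhs z U <-> exists2 r : R, 0 < r & forall w, cabs (z - w) <= r -> U w.
Proof.
split=> [/nbhs_ballP[e /= /Cplx_gt0[r r0 ->] H]|[r r0 H]].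
  exists (r / 2); first by rewrite divr_gt0.
  move=> w wr; apply: H; apply/ball_cabs; apply: le_lt_trans wr _.
  by rewrite ltr_pdivrMr // ltr_pMr // (ltr_nat R 1).
apply/nbhs_ballP; exists (ofR r); first by rewrite /= (_ : 0 = ofR 0) // ofR_lt.
by move=> w /ball_cabs wr; apply: H; exact: ltW.
Qed.

Lemma cplx_entourageP (E : set (Cplx R * Cplx R)) :
  entourage E <-> exists2 r : R, 0 < r & forall a b, cabs (a - b) <= r -> E (a, b).
Proof.
rewrite -entourage_ballE; split=> [[e /= /Cplx_gt0[r r0 ->] H]|[r r0 H]].
  exists (r / 2); first by rewrite divr_gt0.
  move=> a b ab; apply: H; apply/ball_cabs; apply: le_lt_trans ab _.
  by rewrite ltr_pdivrMr // ltr_pMr // (ltr_nat R 1).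
exists (ofR r); first by rewrite /= (_ : 0 = ofR 0) // ofR_lt.
by move=> -[a b] /= /ball_cabs ab; apply: H; exact: ltW.
Qed.

Definition close_on (K : set (Cplx R)) (r : R) (f g : Cplx R -> Cplx R) :=
  forall z, K z -> cabs (f z - g z) <= r.

(** The compact subsets of [D] are directed, so that single suprema over them
    give a base of neighbourhoods. *)
Lemma funD_nbhsP D (f : funD D) (U : set (funD D)) :
  nbhs f U <-> exists K r, [/\ compact_in D K, 0 < r & close_on K r f `<=` U].
Proof.
split; last first.
  move=> [K [r [KD r0 H]]].
  pose E := [set ab : Cplx R * Cplx R | cabs (ab.1 - ab.2) <= r].
  have entE : entourage E by apply/cplx_entourageP; exists r.
  by apply: filterS H _; exact: (fam_nbhs f entE KD).
pose B := fun i : set (Cplx R) * R => close_on i.1 i.2 f.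
pose I := [set i : set (Cplx R) * R | compact_in D i.1 /\ 0 < i.2].
pose F := filter_from I B.
have FF : Filter F.
  apply: filter_from_filter.
    by exists (set0, 1); split => //=; split; [exact: compact0|exact: sub0set].
  move=> [K r] [L s] [[/= cK KD] r0] [[/= cL LD] s0].
  exists (K `|` L, Num.min r s).
    split => /=; last by rewrite lt_min r0.
    by split; [exact: compactU|move=> z [/KD|/LD]].
  move=> g H; split=> z Kz /=.
    by have := H z (or_introl Kz); rewrite /= le_min => /andP[].
  by have := H z (or_intror Kz); rewrite /= le_min => /andP[].
have Ff : {family compact_in D, F --> f}.
  apply/fam_cvgP => K KD U' /uniform_nbhs[E [/cplx_entourageP[r r0 EU] HU]].
  exists (K, r) => // g Hg; apply: HU => y Ky; apply: EU; exact: Hg.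
move=> /Ff [[K r] [KD r0] H]; exists K, r; split=> //.
Qed.


Definition rect (l u m : R) : set (Cplx R) :=
  [set z | l <= cRe z <= u /\ `|cIm z| <= m].

Lemma rect_compact l u m : compact (rect l u m).
Proof.
have -> : rect l u m = (fun p : R * R => Complex p.1 p.2 : Cplx R) @` (`[l, u] `*` `[- m, m]).
  apply/seteqP; split=> [[a b] [/= h1 h2]|_ [[a b] [/= h1 h2] <-]].
    by exists (a, b) => //; split; rewrite /= in_itv //= -ler_norml.
  by move: h1 h2; rewrite !in_itv /= -ler_norml => h1 h2; split.
apply: continuous_compact; last by apply: compact_setX; exact: segment_compact.
apply: continuous_subspaceT => -[a b] U /cplx_nbhsP[r r0 H].
have r2 : 0 < r / 2 by rewrite divr_gt0.
exists (ball a (r / 2), ball b (r / 2)); first by split; exact: nbhsx_ballx.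
move=> [a' b'] [/=]; rewrite -!ball_normE /ball_ /= => h1 h2; apply: H.
apply: le_trans (cabs_le_ReIm _) _; rewrite cReB cImB /=.
by rewrite [r]splitr; apply: lerD; exact: ltW.
Qed.

(** Every point of [D] has a neighbourhood inside all late rectangles; by
    compactness the index can be chosen uniformly. *)
Lemma rect_exhaust (l u : nat -> R) D :
  (forall z, D z -> exists2 r, 0 < r & exists N, forall k, (N <= k)%N ->
     l k <= cRe z - r /\ cRe z + r <= u k) ->
  forall K, compact_in D K -> exists N, forall k, (N <= k)%N -> K `<=` rect (l k) (u k) k.+1%:R.
Proof.
move=> H K [/compact_near_coveringP cK KD].
have := cK nat \oo (fun k => rect (l k) (u k) k.+1%:R) _; case.
- move=> z /KD /H [r r0 [N HN]].
  pose m := Num.bound (`|cIm z| + r).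
  exists ([set w | cabs (z - w) <= r], [set k | (maxn N m <= k)%N]).
    by split => /=; [apply/cplx_nbhsP; exists r|exists (maxn N m)].
  move=> [w k] [/= wr]; rewrite geq_max => /andP[Nk mk].
  have [h1 h2] := HN k Nk.
  have hre := le_trans (cabs_Re (z - w)) wr; have him := le_trans (cabs_Im (z - w)) wr.
  rewrite cReB ler_norml in hre; rewrite cImB in him.
  split; first by case/andP: hre => h3 h4; apply/andP; split; lra.
  have h5 : `|cIm z| + r <= k.+1%:R.
    apply: le_trans (ltW (archi_boundP _)) _; first by rewrite addr_ge0 // ltW.
    by rewrite ler_nat; apply: leqW.
  apply: le_trans h5; rewrite (_ : cIm w = cIm z - (cIm z - cIm w)); last by ring.
  by apply: le_trans (ler_normB _ _) _; rewrite lerD2l.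
by move=> N _ HN; exists N => k Nk; exact: HN.
Qed.

End FunctionSpace.

(** * Convergence in distribution *)

Section ExpectationBounded.
Variables (d : measure_display) (Omega : measurableType d) (R : realType).
Variable P : probability Omega R.
Implicit Types X : Omega -> R.

Lemma bounded_integrable X (M : R) : measurable_fun setT X -> (forall w, `|X w| <= M) ->
  P.-integrable setT (EFin \o X).
Proof.
move=> mX XM; apply: measurable_bounded_integrable => //.
  by apply: le_lt_trans (probability_le1 P measurableT) _; rewrite ltry.
by exists M; split; rewrite ?num_real // => x Mx y _ /=; apply: le_trans (XM y) (ltW Mx).
Qed.

Definition Ex X : R := fine ('E_P[X])%E.

Lemma ExE X (M : R) : measurable_fun setT X -> (forall w, `|X w| <= M) ->
  ('E_P[X])%E = (Ex X)%:E.
Proof.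
move=> mX XM; rewrite /Ex fineK // unlock.
by apply: integrable_fin_num => //; exact: bounded_integrable XM.
Qed.

Lemma ExN X (M : R) : measurable_fun setT X -> (forall w, `|X w| <= M) ->
  Ex (fun w => - X w) = - Ex X.
Proof.
move=> mX XM; have mN : measurable_fun setT (fun w => - X w) by exact: measurableT_comp.
have NM w : `|- X w| <= M by rewrite normrN.
apply: EFin_inj; rewrite -(ExE mN NM) EFinN -(ExE mX XM) unlock.
rewrite -mulN1e -integralZl //; last exact: bounded_integrable XM.
by apply: eq_integral => w _ /=; rewrite -EFinM mulN1r.
Qed.

Lemma Ex_dominated (X_ : nat -> Omega -> R) X (M : R) :
  (forall k, measurable_fun setT (X_ k)) -> measurable_fun setT X ->
  (forall k w, `|X_ k w| <= M) -> (forall w, `|X w| <= M) ->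
  (forall w e, 0 < e -> exists N, forall k, (N <= k)%N -> `|X w - X_ k w| <= e) ->
  forall e, 0 < e -> exists N, forall k, (N <= k)%N -> `|Ex X - Ex (X_ k)| <= e.
Proof.
move=> mX_ mX X_M XM lim.
have mE (Y : Omega -> R) : measurable_fun setT Y -> measurable_fun setT (EFin \o Y).
  by move=> mY; exact/measurable_EFinP.
have h1 : {ae P, forall w, setT w -> (fun k => (EFin \o X_ k) w) @ \oo --> (EFin \o X) w}.
  apply: aeW => w _; apply: cvg_EFin; first by apply: nearW.
  apply/cvgrPdist_le => e e0; have [N HN] := lim w e e0.
  by exists N => // k /= Nk; exact: HN.
have h2 : P.-integrable setT (EFin \o fun=> M).
  by apply: (@bounded_integrable (fun=> M) `|M|) => //; exact: measurable_cst.
have h3 : {ae P, forall w k, setT w -> (`|(EFin \o X_ k) w| <= (EFin \o fun=> M) w)%E}.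
  by apply: aeW => w k _ /=; rewrite lee_fin.
have [_ _ C] := @dominated_convergence _ Omega R P setT measurableT _ _ _
  (fun k => mE _ (mX_ k)) (mE _ mX) h1 h2 h3.
move=> e e0.
have {}C : (Ex (X_ k))%:E @[k --> \oo] --> (Ex X)%:E.
  rewrite -(ExE mX XM) unlock; apply: cvg_trans C; apply: near_eq_cvg; near=> k.
  by rewrite -(ExE (mX_ k) (X_M k)) unlock.
have {}C : Ex (X_ k) @[k --> \oo] --> Ex X by exact: fine_cvg C.
move/cvgrPdist_le: C => /(_ e e0) [N _ HN].
by exists N => k Nk; exact: HN.
Unshelve. all: by end_near. Qed.

(** Continuity is only assumed within [A], where [Y] takes its values: preimages
    of open sets are traces on [A] of open sets. *)
Lemma random_element_measurable (T : topologicalType) (A : set T) (Y : Omega -> T) (Phi : T -> R) :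
  random_element A Y -> {within A, continuous Phi} -> measurable_fun setT (Phi \o Y).
Proof.
move=> [YA Yo] /subspace_continuousP Phic.
apply: (measurability _ (RGenOpens.measurableE R)) => _ [V [x [y ->]] <-].
rewrite setTI; pose I : set R := `]x, y[%classic.
have oI : open I by exact: interval_open.
pose U : set T := \bigcup_(V in [set V : set T | open V /\ forall g, V g -> A g -> I (Phi g)]) V.
have oU : open U by apply: bigcup_open => V' [].
rewrite [X in measurable X](_ : _ = Y @^-1` U); first exact: Yo.
apply/seteqP; split=> [w Iw|w [V' [oV VI] Vw]]; last exact: VI Vw (YA w).
have : nbhs (Y w) [set g | A g -> I (Phi g)].
  have nI : nbhs (Phi (Y w)) I by exact: open_nbhs_nbhs.
  exact (Phic _ (YA w) I nI).
rewrite nbhsE => -[V' [oV Vw] VI]; exists V' => //; split=> // g Vg Ag; exact: VI.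
Qed.

End ExpectationBounded.

Section ConditionedMean.
Variables (R : realType) (xi : probability nat R) (n : nat).
Hypothesis an : admissible xi n.

Lemma gw_prob_ge0 t : 0 <= gw_prob xi t.
Proof. by apply: prodr_ge0 => s _; exact: fine_ge0. Qed.

Lemma cgw_mean_le (g g' : tree -> R) (e : R) :
  (forall t, trees n t -> g t <= g' t + e) -> cgw_mean xi n g <= cgw_mean xi n g' + e.
Proof.
move=> gg; have fT := finite_trees n.
have sum1 : \sum_(t \in trees n) cgw_prob xi n t = 1.
  rewrite /cgw_prob fsbig_finite //= -mulr_suml -(fsbig_finite _ _ fT).
  by rewrite -/(size_prob xi n) divff // gt_eqF.
rewrite /cgw_mean -[e]mul1r -sum1 !fsbig_finite //= mulr_suml -big_split /= !big_seq.
apply: ler_sum => t; rewrite in_fset_set // inE => tn.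
rewrite -mulrDr; apply: ler_wpM2l; last exact: gg.
by rewrite divr_ge0 ?gw_prob_ge0 // ltW.
Qed.

Lemma cgw_meanN (g : tree -> R) : cgw_mean xi n (fun t => - g t) = - cgw_mean xi n g.
Proof.
have fT := finite_trees n.
by rewrite /cgw_mean !fsbig_finite //= -sumrN; apply: eq_bigr => t _; rewrite mulrN.
Qed.

End ConditionedMean.

Section InfConvolution.
Variables (R : realType) (D : set (Cplx R)) (A : set (funD D)) (Phi : funD D -> R) (M : R).
Hypothesis PhiM : forall x, A x -> `|Phi x| <= M.
Implicit Types (x y : funD D) (C : set (Cplx R)).

Definition far (C : set (Cplx R)) (k : nat) (e : R) (f g : Cplx R -> Cplx R) :=
  forall z, C z -> k%:R * cabs (f z - g z) <= e.

Definition infconv_set C k x : set R :=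
  [set s | exists y e, [/\ A y, 0 <= e, far C k e x y & s = Phi y + e]].

(** The inf-convolution of [Phi] with [k] times the supremum seminorm over
    [C]: the largest minorant of [Phi] on [A] with Lipschitz constant 1 for this
    seminorm. *)
Definition infconv C k x : R := inf (infconv_set C k x).

Let Phi_bounds x : A x -> - M <= Phi x /\ Phi x <= M.
Proof. by move=> /PhiM; rewrite ler_norml => /andP. Qed.

Let set_lb C k x : lbound (infconv_set C k x) (- M).
Proof.
move=> _ [y [e [Ay e0 _ ->]]]; have [h _] := Phi_bounds Ay.
by apply: le_trans h _; rewrite lerDl.
Qed.

Let set_self C k x : A x -> infconv_set C k x (Phi x).
Proof.
by move=> Ax; exists x, 0; split; rewrite ?addr0 // => z _; rewrite subrr cabs0 mulr0.
Qed.

Lemma infconv_le C k x : A x -> infconv C k x <= Phi x.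
Proof. by move=> Ax; apply: ge_inf; [exists (- M)|exact: set_self]. Qed.

Lemma infconv_bound C k x : A x -> `|infconv C k x| <= M.
Proof.
move=> Ax; rewrite ler_norml; apply/andP; split.
  by apply: lb_le_inf; [exists (Phi x); exact: set_self|exact: set_lb].
by apply: le_trans (infconv_le C k Ax) _; have [] := Phi_bounds Ax.
Qed.

Lemma infconv_lip C k e x x' : A x -> 0 <= e -> far C k e x' x ->
  infconv C k x' <= infconv C k x + e.
Proof.
move=> Ax e0 xx; rewrite -lerBlDr; apply: lb_le_inf; first by exists (Phi x); exact: set_self.
move=> _ [y [r [Ay r0 xy ->]]]; rewrite lerBlDr -addrA.
apply: ge_inf; first by exists (- M).
exists y, (r + e); split=> //; first exact: addr_ge0.
move=> z Cz; apply: (@le_trans _ _ (k%:R * (cabs ((x' : Cplx R -> Cplx R) z - (x : Cplx R -> Cplx R) z) +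
   cabs ((x : Cplx R -> Cplx R) z - (y : Cplx R -> Cplx R) z)))).
  apply: ler_wpM2l => //.
  by rewrite [X in cabs X](_ : _ = ((x' : Cplx R -> Cplx R) z - (x : Cplx R -> Cplx R) z) +
     ((x : Cplx R -> Cplx R) z - (y : Cplx R -> Cplx R) z)); [exact: cabsD|ring].
by rewrite mulrDr [leLHS]addrC; apply: lerD; [exact: xy|exact: xx].
Qed.

(** A function far from [x] pays a penalty that exceeds the oscillation [2 M] of
    [Phi] for large [k]; for a function close to [x], continuity applies. *)
Lemma infconv_lim (K : nat -> set (Cplx R)) x e :
  (forall C, compact_in D C -> exists N, forall k, (N <= k)%N -> C `<=` K k) ->
  {within A, continuous Phi} -> A x -> 0 < e ->
  exists N, forall k, (N <= k)%N -> `|Phi x - infconv (K k) k x| <= e.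
Proof.
move=> Kex /subspace_continuousP Phic Ax e0.
have nI : nbhs (Phi x) [set s | `|Phi x - s| <= e].
  by apply/nbhs_ballP; exists e => // s /ltW.
have /funD_nbhsP[C [r [CD r0 H]]] := Phic _ Ax _ nI.
have [N HN] := Kex C CD; exists (maxn N (Num.bound (2 * M / r))) => k.
rewrite geq_max => /andP[Nk rk].
rewrite ger0_norm ?subr_ge0 ?infconv_le // lerBlDr -lerBlDl.
apply: lb_le_inf; first by exists (Phi x); exact: set_self.
move=> _ [y [s [Ay s0 xy ->]]]; have [y1 _] := Phi_bounds Ay; have [x0 x1] := Phi_bounds Ax.
have [cl|ncl] := pselect (close_on C r x y).
  have h : `|Phi x - Phi y| <= e := H y cl Ay.
  by move: h; rewrite ler_norml => /andP[_ h]; lra.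
have [z Cz rz] : exists2 z, C z & r < cabs ((x : Cplx R -> Cplx R) z - (y : Cplx R -> Cplx R) z).
  apply: contrapT => nex; apply: ncl => z Cz; rewrite leNgt; apply/negP => rz.
  by apply: nex; exists z.
have h1 := xy z (HN k Nk z Cz).
have h2 : 2 * M <= k%:R * r.
  rewrite -ler_pdivrMr //; apply: le_trans (ltW (archi_boundP _)) _; last by rewrite ler_nat.
  by rewrite divr_ge0 ?mulr_ge0 // ?(ltW r0) //; lra.
have h3 : k%:R * r <= s by apply: le_trans h1; apply: ler_wpM2l => //; exact: ltW.
lra.
Qed.

End InfConvolution.

Section Slutsky.
Variables (R : realType) (xi : probability nat R).
Variables (d : measure_display) (Omega : measurableType d) (P : probability Omega R).
Variables (D0 D : set (Cplx R)) (K : nat -> set (Cplx R)).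
Hypotheses (DD0 : D `<=` D0) (KD : forall k, compact_in D (K k)).
Hypothesis Kex : forall C, compact_in D C -> exists N, forall k, (N <= k)%N -> C `<=` K k.
Variables (W : nat -> tree -> Cplx R -> Cplx R) (Yt : Omega -> Cplx R -> Cplx R).
Hypothesis hW : cgw_cvg_dist xi P (@analytic_on R D0) W Yt.
Variables (s : Cplx R) (c : Cplx R -> Cplx R).
Hypothesis ca : @analytic_on R D c.

Definition affine (f : Cplx R -> Cplx R) (z : Cplx R) : Cplx R := s * f z + c z.

Lemma affine_nbhs (f : funD D0) (U : set (funD D)) :
  nbhs (affine f : funD D) U -> nbhs f [set g : funD D0 | U (affine g : funD D)].
Proof.
move=> /funD_nbhsP[C [r [[cC CD] r0 H]]]; apply/funD_nbhsP.
have s1 : 0 < cabs s + 1 by rewrite ltr_wpDl ?cabs_ge0.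
exists C, (r / (cabs s + 1)); split; [by split=> // z /CD /DD0|exact: divr_gt0|].
move=> g fg; apply: H => z Cz; rewrite /affine.
rewrite [X in cabs X](_ : _ = s * ((f : Cplx R -> Cplx R) z - (g : Cplx R -> Cplx R) z)); last by ring.
rewrite cabsM; apply: (@le_trans _ _ ((cabs s + 1) * (r / (cabs s + 1)))).
  by apply: ler_pM; rewrite ?cabs_ge0 // ?lerDl //; exact: fg.
by rewrite mulrC divfK // gt_eqF.
Qed.

Lemma affine_analytic f : @analytic_on R D0 f -> @analytic_on R D (affine f).
Proof.
move=> fa z Dz.
exact (@cplx_derivableD _ (fun w => s * f w) c z (@cplx_derivableMl _ s f z (fa z (DD0 Dz))) (ca Dz)).
Qed.

Arguments affine_analytic : clear implicits.

Lemma affine_random : random_element (@analytic_on R D) (fun w => affine (Yt w) : funD D).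
Proof.
have [_ [Ya Yo] _] := hW; split=> [w|U oU]; first exact (affine_analytic _ (Ya w)).
have oV : open [set g : funD D0 | U (affine g : funD D)].
  by rewrite openE => g Ug; apply: affine_nbhs; exact: open_nbhs_nbhs.
exact: (Yo _ oV).
Qed.

Section LowerBound.
Variable Z : nat -> tree -> Cplx R -> Cplx R.
Hypothesis Za : forall n t, admissible xi n -> trees n t -> @analytic_on R D (Z n t).
Hypothesis Zc : forall k e, 0 < e -> \forall n \near within (admissible xi) \oo,
  forall t, trees n t -> close_on (K k) e (Z n t) (affine (W n t)).

(** For fixed [k] the Lipschitz minorant [Psi k] ignores the vanishing difference
    between [Z n] and the affine image of [W n]; then [k] tends to infinity by
    dominated convergence. *)
Lemma affine_mean_lb (Phi : funD D -> R) (M e : R) :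
  {within @analytic_on R D, continuous Phi} -> (forall x, @analytic_on R D x -> `|Phi x| <= M) ->
  0 < e -> \forall n \near within (admissible xi) \oo,
    Ex P (fun w => Phi (affine (Yt w))) - e <= cgw_mean xi n (fun t => Phi (Z n t)).
Proof.
move=> Phic PhiM e0; have [Wa rY Wlim] := hW; have [Ya _] := rY.
pose Psi k (f : funD D0) := infconv (@analytic_on R D) Phi (K k) k (affine f : funD D).
have PsiM k f : @analytic_on R D0 f -> `|Psi k f| <= M.
  move=> fa; exact (@infconv_bound _ _ _ Phi M PhiM (K k) k _ (affine_analytic f fa)).
have Psic k : {within @analytic_on R D0, continuous (Psi k)}.
  apply/subspace_continuousP => f fa; apply/cvgrPdist_le => r r0.
  have k1 : 0 < k%:R * cabs s + 1 by rewrite ltr_wpDl // mulr_ge0 ?cabs_ge0.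
  apply/funD_nbhsP; exists (K k), (r / (k%:R * cabs s + 1)); split.
  - by have [cK KkD] := KD k; split=> // z /KkD /DD0.
  - exact: divr_gt0.
  move=> g fg ga.
  have FG : far (K k) k r (affine f) (affine g).
    move=> z Kz; rewrite /affine.
    rewrite [X in cabs X](_ : _ = s * ((f : Cplx R -> Cplx R) z - (g : Cplx R -> Cplx R) z)); last by ring.
    rewrite cabsM mulrA; apply: (@le_trans _ _ ((k%:R * cabs s + 1) * (r / (k%:R * cabs s + 1)))).
      by apply: ler_pM; rewrite ?mulr_ge0 ?cabs_ge0 // ?lerDl //; exact: fg.
    by rewrite mulrC divfK // gt_eqF.
  have GF : far (K k) k r (affine g) (affine f) by move=> z Kz; rewrite cabsBC; exact: FG.
  rewrite ler_norml; apply/andP; split.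
    rewrite lerBrDl -lerBrDr opprK.
    exact (@infconv_lip _ _ _ Phi M PhiM (K k) k r _ _ (affine_analytic f fa) (ltW r0) GF).
  rewrite lerBlDl.
  exact (@infconv_lip _ _ _ Phi M PhiM (K k) k r _ _ (affine_analytic g ga) (ltW r0) FG).
have mPsi k : measurable_fun setT (fun w => Psi k (Yt w)).
  exact: (random_element_measurable rY (Psic k)).
have mPhi : measurable_fun setT (fun w => Phi (affine (Yt w))).
  exact: (random_element_measurable affine_random Phic).
have e4 : 0 < e / 4 by rewrite divr_gt0.
have [] := @Ex_dominated _ Omega R P (fun k w => Psi k (Yt w)) (fun w => Phi (affine (Yt w))) M
  mPsi mPhi (fun k w => PsiM k _ (Ya w)) (fun w => PhiM _ (affine_analytic _ (Ya w))) _ _ e4.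
  move=> w r r0; exact (@infconv_lim _ _ _ Phi M PhiM K _ r Kex Phic (affine_analytic _ (Ya w)) r0).
move=> k /(_ k (leqnn _)) Ek.
have : (Ex P (fun w => Psi k (Yt w)))%:E = ('E_P[Psi k \o Yt])%E.
  by rewrite (ExE P (mPsi k) (fun w => PsiM k _ (Ya w))).
have := Wlim (Psi k) (conj (Psic k) (ex_intro _ M (PsiM k))).
move=> /[swap] <- C.
have {}C : cgw_mean xi n (fun t => Psi k (W n t)) @[n --> within (admissible xi) \oo] -->
   Ex P (fun w => Psi k (Yt w)) by exact: fine_cvg C.
move/cvgrPdist_le: C => /(_ _ e4) Wn.
have k4 : 0 < e / 4 / k.+1%:R by rewrite divr_gt0.
have Zn := Zc k k4.
have An : within (admissible xi) \oo (admissible xi) by exact: withinT.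
near=> n.
have an : admissible xi n by near: n.
have h1 : `|Ex P (fun w => Psi k (Yt w)) - cgw_mean xi n (fun t => Psi k (W n t))| <= e / 4 by near: n.
have h2 : forall t, trees n t -> close_on (K k) (e / 4 / k.+1%:R) (Z n t) (affine (W n t)) by near: n.
have h3 : cgw_mean xi n (fun t => Psi k (W n t)) <= cgw_mean xi n (fun t => Phi (Z n t)) + e / 4.
  apply: cgw_mean_le => // t tn.
  apply: (@le_trans _ _ (infconv (@analytic_on R D) Phi (K k) k (Z n t : funD D) + e / 4)).
    apply: (@infconv_lip _ _ _ Phi M PhiM (K k) k (e / 4) (Z n t) (affine (W n t)) (Za an tn) (ltW e4)).
    move=> z Kz; rewrite cabsBC; apply: le_trans (ler_wpM2l _ (h2 t tn z Kz)) _ => //.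
    rewrite mulrCA ler_piMr ?(ltW e4) // ler_pdivrMr ?mul1r ?ler_nat //.
  by rewrite lerD2r; exact (@infconv_le _ _ _ Phi M PhiM (K k) k _ (Za an tn)).
move: h1 Ek; rewrite !ler_norml => /andP[h4 h5] /andP[h6 h7]; lra.
Unshelve. all: by end_near. Qed.

End LowerBound.

(** Slutsky's theorem in [H(D)].  The lower bound holds for bounded Lipschitz
    minorants of [Phi], and exchanging [Phi] and [- Phi] gives the upper bound. *)
Theorem affine_cvg_dist (Z : nat -> tree -> Cplx R -> Cplx R) :
  (forall n t, admissible xi n -> trees n t -> @analytic_on R D (Z n t)) ->
  (forall k e, 0 < e -> \forall n \near within (admissible xi) \oo,
     forall t, trees n t -> close_on (K k) e (Z n t) (affine (W n t))) ->
  cgw_cvg_dist xi P (@analytic_on R D) Z (fun w => affine (Yt w)).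
Proof.
move=> Za Zc; split; [exact Za|exact affine_random|].
move=> Phi [Phic [M PhiM]].
have [_ [Ya _] _] := hW.
have mPhi : measurable_fun setT (fun w => Phi (affine (Yt w))).
  exact: (random_element_measurable affine_random Phic).
have YM w : `|Phi (affine (Yt w))| <= M.
  exact (PhiM _ (affine_analytic _ (Ya w))).
have -> : ('E_P[Phi \o (fun w => affine (Yt w))])%E = (Ex P (fun w => Phi (affine (Yt w))))%:E.
  exact: (ExE P mPhi YM).
apply: cvg_EFin; first exact: nearW.
apply/cvgrPdist_le => e e0.
have L := affine_mean_lb Za Zc Phic PhiM e0.
have Nc : {within @analytic_on R D, continuous (fun f : funD D => - Phi f)}.
  move=> x; apply: cvgN; exact: Phic.
have NM x : @analytic_on R D x -> `|- Phi x| <= M by rewrite normrN; exact: PhiM.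
have U := affine_mean_lb Za Zc Nc NM e0.
rewrite (ExN P mPhi YM) in U.
near=> n; rewrite /= ler_norml.
have h1 : Ex P (fun w => Phi (affine (Yt w))) - e <= cgw_mean xi n (fun t => Phi (Z n t)) by near: n.
have h2 : - Ex P (fun w => Phi (affine (Yt w))) - e <= cgw_mean xi n (fun t => - Phi (Z n t)) by near: n.
rewrite cgw_meanN in h2; lra.
Unshelve. all: by end_near. Qed.

End Slutsky.

(** * The two regimes *)

Section Evaluation.
Variables (R : realType) (xi : probability nat R).
Variables (d : measure_display) (Omega : measurableType d) (P : probability Omega R).

Lemma eval_nbhs (D : set (Cplx R)) (alpha : Cplx R) (f : funD D) (U : set (Cplx R)) : D alpha ->
  nbhs ((f : Cplx R -> Cplx R) alpha) U ->
  nbhs f [set g : funD D | U ((g : Cplx R -> Cplx R) alpha)].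
Proof.
move=> Da /cplx_nbhsP[r r0 H]; apply/funD_nbhsP; exists [set alpha], r; split=> //.
  by split; [exact: compact_set1|move=> z ->].
by move=> g fg; apply: H; exact: fg.
Qed.

Lemma eval_cvg_dist (D : set (Cplx R)) (alpha : Cplx R) (Z : nat -> tree -> Cplx R -> Cplx R)
    (Y : Omega -> Cplx R -> Cplx R) : D alpha ->
  cgw_cvg_dist xi P (@analytic_on R D) Z Y ->
  cgw_cvg_dist xi P [set: Cplx R] (fun n t => Z n t alpha) (fun w => Y w alpha).
Proof.
move=> Da [_ [_ Yo] H]; split=> //.
  split=> // U oU; apply: (Yo [set g : funD D | U ((g : Cplx R -> Cplx R) alpha)]).
  by rewrite openE => g Ug; apply: eval_nbhs => //; exact: open_nbhs_nbhs.
move=> Phi [/subspace_continuousP Phic [M PhiM]].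
apply: (H (fun g : funD D => Phi ((g : Cplx R -> Cplx R) alpha))); split; last first.
  by exists M => g _; exact: PhiM.
apply/subspace_continuousP => f fa V nV.
have := eval_nbhs Da (Phic _ I V nV).
by apply: filterS => g /= Vg _; exact: Vg.
Qed.

End Evaluation.

Section Regimes.
Variable R : realType.
Implicit Types (z alpha : Cplx R).

Lemma zone_intro (b : bool) (M y0 : R) z : 0 < y0 -> cabs z <= M ->
  y0 <= cRe z + b%:R / 2 -> (b -> cRe z <= - y0) -> zone b M (Num.min y0 4^-1) y0 z.
Proof.
move=> y00 zM zl zu; set d := Num.min _ _.
have dy : d <= y0 by rewrite ge_min lexx.
have d4 : d <= 4^-1 by rewrite ge_min lexx orbT.
have cl (w : Cplx R) (j : nat) : `|cRe w + j%:R| <= cabs (w + j%:R).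
  by have := cabs_Re (w + j%:R); rewrite cReD cRe_nat.
have dj (j : nat) : d * j%:R <= 4^-1 * j%:R by apply: ler_wpM2r.
have j0 (j : nat) : 0 <= j%:R :> R by [].
have half : cRe (z + chalf R) = cRe z + 2^-1 by rewrite cReD.
split=> //.
  split=> // j; apply: le_trans (cl z j); rewrite -natr1 mulrDr mulr1.
  have := dj j; have := j0 j; case: b zl zu => /= zl zu => jj hj; last first.
    by apply: le_trans (ler_norm _); lra.
  case: j {cl} jj hj => [|j] jj hj.
    have := zu isT; rewrite mulr0 addr0 => h; rewrite -normrN; apply: le_trans (ler_norm _); lra.
  apply: le_trans (ler_norm _).
  have zl' : y0 <= cRe z + 2^-1 by move: zl; rewrite mul1r.
  move: hj; rewrite -[j.+1%:R]natr1; have := j0 j; move: (j%:R) => t t0 hj; lra.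
split; first by apply: le_trans (cabsD _ _) _; apply: lerD => //; rewrite cabs_ofR ger0_norm ?invr_ge0 // invf_le1 // (ler_nat R 1).
move=> j; apply: le_trans (cl _ j); apply: le_trans (ler_norm _).
rewrite half -natr1 mulrDr mulr1; have := dj j; have := j0 j.
by case: b zl zu => /= zl zu jj hj; move: zl; rewrite ?mul1r ?mul0r => zl; lra.
Qed.

(** As in [zone], [b] tells whether the mean is corrected by [n mu]. *)
Definition regime (b : bool) : set (Cplx R) :=
  [set z | if b then 0 < cRe z < 2^-1 else 2^-1 < cRe z].

Definition regime_rect (b : bool) (k : nat) : set (Cplx R) :=
  rect ((~~ b)%:R / 2 + k.+1%:R^-1) (if b then 2^-1 - k.+1%:R^-1 else k.+1%:R) k.+1%:R.

Lemma regime_rect_zone b k alpha : regime_rect b k alpha ->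
  zone b (2 * k.+1%:R + 2) (Num.min k.+1%:R^-1 4^-1) k.+1%:R^-1 (alpha - chalf R).
Proof.
have i0 : 0 < k.+1%:R^-1 :> R by rewrite invr_gt0 succ_gt0.
have k1 : 1 <= k.+1%:R :> R by rewrite (ler_nat R 1).
move: i0 k1 => + + [/andP[h1 h2] h3].
rewrite /regime_rect; move: (k.+1%:R^-1) h1 h2 => y h1 h2 i0 k1.
have rE : cRe (alpha - chalf R) = cRe alpha - 2^-1 by rewrite cReB.
have rk : `|cRe alpha| <= k.+1%:R.
  rewrite ler_norml; case: b h1 h2 => /= h1 h2; apply/andP; split; lra.
apply: zone_intro => //.
- apply: le_trans (cabsB _ _) _; apply: lerD.
    apply: le_trans (cabs_le_ReIm _) _; rewrite mulr_natl mulr2n; exact: lerD.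
  by rewrite cabs_ofR ger0_norm ?invr_ge0 //; lra.
- by rewrite rE; case: b h1 h2 => /= h1 h2; lra.
- by rewrite rE => bt; move: h2; rewrite bt; lra.
Qed.

Lemma regime_rect_sub b k : regime_rect b k `<=` regime b.
Proof.
move=> z [/andP[h1 h2] _]; rewrite /regime /=.
have i0 : 0 < k.+1%:R^-1 :> R by rewrite invr_gt0 succ_gt0.
move: (k.+1%:R^-1) i0 h1 h2 => y i0.
by case: b => /= h1 h2; [apply/andP; split; lra|lra].
Qed.

Lemma regime_exhaust b C : compact_in (regime b) C ->
  exists N, forall k, (N <= k)%N -> C `<=` regime_rect b k.
Proof.
move=> HC; apply: (@rect_exhaust R _ _ (regime b) _ C HC) => z zD.
have kb (x : R) : exists N, forall k, (N <= k)%N -> x <= k.+1%:R.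
  exists (Num.bound `|x|) => k Nk; apply: le_trans (ler_norm x) _.
  by apply: le_trans (ltW (archi_boundP (normr_ge0 x))) _; rewrite ler_nat leqW.
case: b zD {HC} => /= zD.
  move/andP: zD => [z0 z1]; pose r := Num.min (cRe z / 2) ((2^-1 - cRe z) / 2).
  have r0 : 0 < r by rewrite lt_min !divr_gt0 // subr_gt0.
  have r1 : r <= cRe z / 2 by rewrite ge_min lexx.
  have r2 : r <= (2^-1 - cRe z) / 2 by rewrite ge_min lexx orbT.
  have [N HN] := nat_inv_small r0; exists r => //; exists N => k /HN.
  by move: (k.+1%:R^-1) => y yr; split; lra.
have r0 : 0 < (cRe z - 2^-1) / 2 by rewrite divr_gt0 // subr_gt0.
have [N HN] := nat_inv_small r0; have [N' HN'] := kb (cRe z + (cRe z - 2^-1) / 2).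
exists ((cRe z - 2^-1) / 2) => //; exists (maxn N N') => k; rewrite geq_max => /andP[Nk Nk'].
by have := HN k Nk; have := HN' k Nk'; move: (k.+1%:R^-1) => y h1 h2; split; lra.
Qed.

Lemma regime_zone b alpha : regime b alpha -> exists k, regime_rect b k alpha.
Proof.
move=> ra; have [|N HN] := @regime_exhaust b [set alpha].
  by split; [exact: compact_set1|move=> z ->].
by exists N; exact: HN.
Qed.

Section Offspring.
Variables (xi : probability nat R) (sigma : R).
Hypothesis crit : critical xi sigma.

Lemma mean_limit_analytic b : @analytic_on R (regime b) (mean_limit sigma).
Proof.
move=> alpha /regime_zone[k /regime_rect_zone [az azh _ _]].
have d0 : 0 < Num.min k.+1%:R^-1 4^-1 :> R by rewrite lt_min !invr_gt0 succ_gt0 ltr0n.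
have M0 : 0 <= 2 * k.+1%:R + 2 :> R by rewrite addr_ge0 // mulr_ge0.
rewrite subrK in azh.
have G := @gamma_ratio_derivable R _ _ alpha M0 d0 az azh.
exact (@cplx_derivableMl R (ofR sigma^-1) _ alpha (@cplx_derivableMl R (ofR (Num.sqrt 2)^-1) _ alpha G)).
Qed.

Lemma admissible_span h : (0 < h)%N -> (forall k, ~~ (h %| k)%N -> offspring xi k = 0) ->
  forall n, admissible xi n -> exists2 J, n = (1 + h * J)%N & 0 < hit xi h J.
Proof.
move=> h0 hs n an; have n0 : (0 < n)%N.
  by case: n an => // an; move: an; rewrite /admissible /= size_prob0 ltxx.
have : (h %| n.-1)%N.
  by apply: contraLR (an) => hn; rewrite (size_prob_span hs n0 hn) ltxx.
move=> /dvdnP[J nJ]; have nE : n = (1 + h * J)%N by rewrite mulnC -nJ add1n prednK.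
by exists J => //; rewrite hitE mulr_gt0 // -nE.
Qed.

Lemma regime_mean b k e : 0 < e -> \forall n \near within (admissible xi) \oo,
  forall alpha, regime_rect b k alpha ->
  cabs (npow n (- alpha - chalf R) * (cgw_cmean xi n (fun u => treeX u alpha) -
      b%:R * (n%:R * mu xi alpha)) - mean_limit sigma alpha) <= e.
Proof.
move=> e0; have [h h0 [hc hs]] := span_exists crit.
have d0 : 0 < Num.min k.+1%:R^-1 4^-1 :> R by rewrite lt_min !invr_gt0 succ_gt0 ltr0n.
have M0 : 0 <= 2 * k.+1%:R + 2 :> R by rewrite addr_ge0 // mulr_ge0.
have y0 : 0 < k.+1%:R^-1 :> R by rewrite invr_gt0 succ_gt0.
have [J1 HJ1] := mean_asymp crit h0 hc hs b M0 d0 y0 e0.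
exists (1 + h * J1)%N => // n /= Nn an alpha /regime_rect_zone za.
have [J nE hJ] := admissible_span h0 hs an.
by apply: (HJ1 J) => //; move: Nn; rewrite nE leq_add2l leq_pmul2l.
Qed.

Lemma npow_opp_derivable n (c z : Cplx R) : (0 < n)%N ->
  derivable (fun x : Cplx R => npow n (- x - c)) z 1.
Proof.
move=> n0; pose C : R := 16 / 1 ^+ 2 * n%:R `^ (cRe (- z - c) + 2 * 1).
have C0 : 0 <= C by apply: mulr_ge0; rewrite ?powR_ge0 // expr1n divr_ge0.
apply: (@quad_derivable _ _ z 1 C (- (npow n (- z - c) * ofR (ln n%:R))) ltr01 C0) => k k1.
have := @npow_quad R n (- z - c) (- k) 1 ltr01 n0; rewrite cabsN => /(_ k1).
rewrite (_ : - z - c - k = - (z + k) - c); last by ring.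
by rewrite mulrN mulNr.
Qed.

Lemma treeX_derivable t (z : Cplx R) : derivable (fun x : Cplx R => treeX t x) z 1.
Proof.
exact (@cplx_derivable_sum R _ (subtrees t) (fun u x => npow (tree_size u) x) z (fun u => @npow_derivable R (tree_size u) z)).
Qed.

Definition scaledX (b : bool) (n : nat) (t : tree) (alpha : Cplx R) : Cplx R :=
  npow n (- alpha - chalf R) * (treeX t alpha - b%:R * (n%:R * mu xi alpha)).

Lemma scaledX_analytic b n t : admissible xi n -> @analytic_on R (regime b) (scaledX b n t).
Proof.
move=> an z zb; have n0 : (0 < n)%N.
  by case: n an => // an; move: an; rewrite /admissible /= size_prob0 ltxx.
have [h h0 [hc hs]] := span_exists crit.
have D2 : derivable (fun x : Cplx R => - (b%:R * n%:R) * (b%:R * mu xi x)) z 1.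
  apply: cplx_derivableMl; case: b zb => zb.
    by apply: cplx_derivableMl; apply: (mu_derivable crit h0 hc hs); case/andP: zb.
  rewrite (_ : (fun x => _) = (fun=> 0)); last by apply/funext => x; rewrite mul0r.
  exact: cplx_derivable_cst.
have D3 := @cplx_derivableM R _ _ z (@npow_opp_derivable n (chalf R) z n0)
  (@cplx_derivableD R _ _ z (@treeX_derivable t z) D2).
rewrite (_ : scaledX b n t = fun x => npow n (- x - chalf R) *
   (treeX t x + - (b%:R * n%:R) * (b%:R * mu xi x))) //.
apply/funext => x; rewrite /scaledX; case: b {zb D2 D3}; first by rewrite !mul1r mulNr.
by rewrite !mul0r oppr0 mul0r.
Qed.

Lemma regime_cvg (d : measure_display) (Omega : measurableType d) (P : probability Omega R)
    (Yt : Omega -> Cplx R -> Cplx R) b : is_Ytilde P Yt ->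
  cgw_cvg_dist xi P (@analytic_on R (regime b)) (scaledX b)
    (fun w alpha => ofR sigma^-1 * Ylim Yt w alpha).
Proof.
move=> hYt; have hW := hYt xi sigma crit.
have s0 : ofR sigma != 0 by rewrite -cabs_gt0 cabs_ofR normr_gt0 gt_eqF // (sigma_gt0 crit).
rewrite (_ : (fun w alpha => _) = fun w => affine (ofR sigma^-1) (mean_limit sigma) (Yt w)); last first.
  by apply/funext => w; apply/funext => z; rewrite /affine /Ylim /mean_limit mulrDr.
apply: (@affine_cvg_dist R xi d Omega P (@Hplus R) (regime b) (regime_rect b) _ _ _ _ _ hW).
- move=> z; rewrite /regime /Hplus /=; case: b => [/andP[]//|]; apply: lt_trans.
  by rewrite invr_gt0.
- by move=> k; split; [exact: rect_compact|exact: regime_rect_sub].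
- exact: regime_exhaust.
- exact (@mean_limit_analytic b).
- by move=> n t an _; exact (@scaledX_analytic b n t an).
move=> k e e0; have := @regime_mean b k e e0.
apply: filterS => n H t _ z Kz; rewrite [X in cabs X](_ : _ =
  npow n (- z - chalf R) * (cgw_cmean xi n (fun u => treeX u z) -
      b%:R * (n%:R * mu xi z)) - mean_limit sigma z); first exact: H.
rewrite /affine /scaledX /treeX_centered ofRV.
by field.
Qed.

End Offspring.
End Regimes.

Theorem theorem1p10 (R : realType) (d : measure_display)
    (Omega : measurableType d) (P : probability Omega R)
    (Yt : Omega -> Cplx R -> Cplx R) (hYt : is_Ytilde P Yt)
    (xi : probability nat R) (sigma : R) (hxi : critical xi sigma) :
  let Z1 (n : nat) (t : tree) (alpha : Cplx R) : Cplx R :=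
    npow n (- alpha - chalf R) * treeX t alpha in
  let Z2 (n : nat) (t : tree) (alpha : Cplx R) : Cplx R :=
    npow n (- alpha - chalf R) * (treeX t alpha - n%:R * mu xi alpha) in
  let Y (w : Omega) (alpha : Cplx R) : Cplx R :=
    ofR sigma^-1 * Ylim Yt w alpha in
  let D1 : set (Cplx R) := [set z | 2^-1 < cRe z] in
  let D2 : set (Cplx R) := [set z | 0 < cRe z < 2^-1] in
  [/\ (forall alpha : Cplx R, D1 alpha ->
         cgw_cvg_dist xi P [set: Cplx R]
           (fun n t => Z1 n t alpha) (fun w => Y w alpha)),
      cgw_cvg_dist xi P (@analytic_on R D1) Z1 Y,
      (forall alpha : Cplx R, D2 alpha ->
         cgw_cvg_dist xi P [set: Cplx R]
           (fun n t => Z2 n t alpha) (fun w => Y w alpha)) &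
      cgw_cvg_dist xi P (@analytic_on R D2) Z2 Y].
Proof.
move=> Z1 Z2 Y D1 D2.
have E1 : Z1 = scaledX xi false.
  by apply/funext => n; apply/funext => t; apply/funext => z; rewrite /scaledX mul0r subr0.
have E2 : Z2 = scaledX xi true.
  by apply/funext => n; apply/funext => t; apply/funext => z; rewrite /scaledX mul1r.
have C1 : cgw_cvg_dist xi P (@analytic_on R D1) Z1 Y.
  by rewrite E1; exact (regime_cvg hxi false hYt).
have C2 : cgw_cvg_dist xi P (@analytic_on R D2) Z2 Y.
  by rewrite E2; exact (regime_cvg hxi true hYt).
split; [|exact C1| |exact C2] => alpha Da.
  exact (eval_cvg_dist Da C1).
exact (eval_cvg_dist Da C2).
Qed.
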